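(* Let $n\ge1$ and $t>0$. There is no measurable function $W:\mathbb H_{\mathbb C}\to[0,\infty)$ which is left $\mathbb H$-invariant (i.e. $W(hg)=W(g)$ for all $h\in\mathbb H$, $g\in\mathbb H_{\mathbb C}$) and satisfies $$\int_{\mathbb H}|f(h)|^2\,dh=\int_{\mathbb H_{\mathbb C}}|\mathcal H_tf(g)|^2\,W(g)\,dg\quad\text{for all }f\in L^2(\mathbb H).$$ In other words, the image of $\mathcal H_t$ is not a weighted Bergman space with a non-negative left $\mathbb H$-invariant weight.
   Context: $\mathbb H=\mathbb{R}^n\times\mathbb{R}^n\times\mathbb{R}$ with product $(\mathbf x,\mathbf u,\xi)(\mathbf x',\mathbf u',\xi')=(\mathbf x+\mathbf x',\mathbf u+\mathbf u',\xi+\xi'+\frac12(\mathbf x\cdot\mathbf u'-\mathbf u\cdot\mathbf x'))$ and Haar measure $dh=d\mathbf x\,d\mathbf u\,d\xi$; its complexification $\mathbb H_{\mathbb C}=\mathbb{C}^n\times\mathbb{C}^n\times\mathbb{C}$ has the same product formula ($\mathbf a\cdot\mathbf b=\sum a_jb_j$ complex bilinear), Lebesgue measure $dg$, and contains $\mathbb H$ as its real points. Heat kernel: $k_t(\mathbf x,\mathbf u,\xi)=c_n\int_{\mathbb{R}}e^{-i\lambda\xi}e^{-t\lambda^2}\big(\frac{\lambda}{\sinh t\lambda}\big)^n e^{-\frac{\lambda}{4}\coth(t\lambda)(\mathbf x\cdot\mathbf x+\mathbf u\cdot\mathbf u)}d\lambda$ with $c_n=(4\pi)^{-n}$; its holomorphic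 extension $k_t^\sim$ to $\mathbb H_{\mathbb C}$ is given by the same formula with $(\mathbf z,\mathbf w,\zeta)$ in place of $(\mathbf x,\mathbf u,\xi)$. The heat kernel transform is $\mathcal H_tf(g)=\int_{\mathbb H}f(h)\,k_t^\sim(h^{-1}g)\,dh$ for $f\in L^2(\mathbb H)$, $g\in\mathbb H_{\mathbb C}$. *)

(* Defs.v *)
From HB Require Import structures.
From mathcomp Require Import all_boot all_order all_algebra.
From mathcomp Require Import all_classical all_reals all_analysis.
From mathcomp Require Import complex.

Set Implicit Arguments.
Unset Strict Implicit.
Unset Printing Implicit Defensive.

Import Order.TTheory GRing.Theory Num.Theory.
Local Open Scope ring_scope.
Local Open Scope complex_scope.

Section Heisenberg.
Variable R : realType.
Local Notation C := (R[i]).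

Definition cexp (z : C) : C :=
  (expR (complex.Re z) * cos (complex.Im z)) +i* (expR (complex.Re z) * sin (complex.Im z)).

Definition cabs2 (z : C) : R := complex.Re z ^+ 2 + complex.Im z ^+ 2.

Definition sinhR (x : R) : R := (expR x - expR (- x)) / 2.
Definition coshR (x : R) : R := (expR x + expR (- x)) / 2.
Definition cothR (x : R) : R := coshR x / sinhR x.

Fixpoint iint (k : nat) : (k.-tuple R -> \bar R) -> \bar R :=
  match k return (k.-tuple R -> \bar R) -> \bar R with
  | 0 => fun F => F [tuple]
  | k'.+1 => fun F =>
      (\int[@lebesgue_measure R]_x iint (fun s : k'.-tuple R => F [tuple of x :: s]))%E
  end.

Definition cint (k : nat) (F : k.-tuple R -> C) : C :=
  fine (iint (fun s => (complex.Re (F s))%:E)) +i* fine (iint (fun s => (complex.Im (F s))%:E)).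

Definition cint1 (F : R -> C) : C :=
  Rintegral (@lebesgue_measure R) setT (fun x => complex.Re (F x)) +i*
  Rintegral (@lebesgue_measure R) setT (fun x => complex.Im (F x)).

Variable n : nat.

Definition Hpt := (('I_n -> R) * ('I_n -> R) * R)%type.
Definition HCpt := (('I_n -> C) * ('I_n -> C) * C)%type.

Definition cdot (a b : 'I_n -> C) : C := \sum_(j < n) a j * b j.

Definition mulHC (g g' : HCpt) : HCpt :=
  let: (z, w, zeta) := g in let: (z', w', zeta') := g' in
  ((fun j => z j + z' j), (fun j => w j + w' j),
   zeta + zeta' + (1 / 2)%:C * (cdot z w' - cdot w z')).

Definition embH (h : Hpt) : HCpt :=
  let: (x, u, xi) := h in ((fun j => (x j)%:C), (fun j => (u j)%:C), xi%:C).

Definition invH (h : Hpt) : Hpt :=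
  let: (x, u, xi) := h in ((fun j => - x j), (fun j => - u j), - xi).

(* coordinates: H ~ R^(2n+1), ordered (x_1..x_n, u_1..u_n, xi) *)
Definition toH (s : (n + n + 1).-tuple R) : Hpt :=
  ((fun j => tnth s (lshift 1 (lshift n j))),
   (fun j => tnth s (lshift 1 (rshift n j))),
   tnth s (rshift (n + n) ord0)).

(* coordinates: H_C ~ R^(4n+2), ordered
   (Re z, Im z, Re w, Im w, Re zeta, Im zeta) *)
Definition toHC (s : (n + n + n + n + 1 + 1).-tuple R) : HCpt :=
  ((fun j => tnth s (lshift 1 (lshift 1 (lshift n (lshift n (lshift n j))))) +i*
             tnth s (lshift 1 (lshift 1 (lshift n (lshift n (rshift n j)))))),
   (fun j => tnth s (lshift 1 (lshift 1 (lshift n (rshift (n + n) j)))) +i*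
             tnth s (lshift 1 (lshift 1 (rshift (n + n + n) j)))),
   tnth s (lshift 1 (rshift (n + n + n + n) ord0)) +i*
   tnth s (rshift (n + n + n + n + 1) ord0)).

Definition c_n : R := (4 * pi) ^- n.

Definition heat_integrand (t : R) (g : HCpt) (lam : R) : C :=
  let: (z, w, zeta) := g in
  cexp (- ('i * lam%:C * zeta)) * (expR (- (t * lam ^+ 2)))%:C
  * ((lam / sinhR (t * lam)) ^+ n)%:C
  * cexp (- ((lam / 4 * cothR (t * lam))%:C * (cdot z z + cdot w w))).

Definition heat_kernel (t : R) (g : HCpt) : C :=
  c_n%:C * cint1 (heat_integrand t g).

Definition heat_transform (t : R) (f : Hpt -> C) (g : HCpt) : C :=
  cint (fun s => f (toH s) * heat_kernel t (mulHC (embH (invH (toH s))) g)).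

Definition L2H (f : Hpt -> C) : Prop :=
  measurable_fun [set: (n + n + 1).-tuple R] (fun s => complex.Re (f (toH s))) /\
  measurable_fun [set: (n + n + 1).-tuple R] (fun s => complex.Im (f (toH s))) /\
  (iint (fun s => (cabs2 (f (toH s)))%:E) < +oo)%E.

End Heisenberg.

(* Main.v *)
Require Import Defs.
From HB Require Import structures.
From mathcomp Require Import all_boot all_order all_algebra.
From mathcomp Require Import all_classical all_reals all_analysis.
From mathcomp Require Import measurable_realfun complex ring lra.
Import Order.TTheory GRing.Theory Num.Theory.
Import numFieldNormedType.Exports.
Local Open Scope ring_scope.
Local Open Scope classical_set_scope.
Local Notation nc := (@Normc.normc _).

(* The test functions f_(m,l) = (x_1 - i u_1)^m exp (- l S) / (2 + S)^2, with S = (|x|^2 + |u|^2) / 4 + i xi, are superpositions of ground states of the twisted Laplacian, so their heat transforms are explicit: a constant times (z_1 - i w_1)^m exp (- l s) Theta_(l+m) (s), with s = (z.z + w.w) / 4 + i zeta. Along the triple (m-1, l+1), (m, l), (m+1, l-1) the sum l + m is constant and the constants give |F_0|^2 = e^(-2t) |F_1| |F_2| pointwise. Whatever the weight W >= 0, the isometry and AM-GM then bound the norm of f_0 by those of f_1 and f_2; for m large and then l large, the explicit norms of the f_i contradict this bound. *)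

Set Implicit Arguments.
Unset Strict Implicit.
Unset Printing Implicit Defensive.


(** * Complex exponential and modulus in real coordinates *)

Section ComplexExponential.
Context {R : realType}.
Implicit Types (x y : R) (z w : R[i]).

(** At frequency lambda > 0 the heat semigroup multiplies (x_1 - i u_1)^m exp (- lambda (|x|^2 +
    |u|^2) / 4) by exp (- t (lambda^2 + (n + 2 m) lambda)). The minus sign is essential: x_1 + i u_1
    would give an exponent without m. Now lambda^2 + 2 m lambda = (lambda + m)^2 - m^2; with lambda
    = l + mu the first square depends only on l + m and mu, and the second difference of m^2 is the
    2 in e^(-2t). The function exp (- l S) alone has constant modulus in xi, hence is not square
    integrable. Division by (2 + S)^2 cures this, and the Fourier transform in xi still lives on
    lambda >= l > 0. The price is that norms are only squeezed, between multiples of m! / a^m (pi /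
    a)^n with a = (l + 1) / 2 and a = l / 2. For these the squared norm of f_0 is nearly the
    geometric mean of its neighbours', which the factor e^(-2t) forbids. The gap in the squeeze
    costs ((l + 1) / (l - 1))^(m + 1 + n), so l is taken large after m. *)

Lemma eq_ReIm z w : complex.Re z = complex.Re w -> complex.Im z = complex.Im w -> z = w.
Proof. by case: z w => [a b] [c d] /= -> ->. Qed.

Lemma ReD z w : complex.Re (z + w) = complex.Re z + complex.Re w.
Proof. by case: z w => [a b] [c d]. Qed.
Lemma ImD z w : complex.Im (z + w) = complex.Im z + complex.Im w.
Proof. by case: z w => [a b] [c d]. Qed.
Lemma ReN z : complex.Re (- z) = - complex.Re z.
Proof. by case: z. Qed.
Lemma ImN z : complex.Im (- z) = - complex.Im z.
Proof. by case: z. Qed.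
Lemma ReM z w : complex.Re (z * w) = complex.Re z * complex.Re w - complex.Im z * complex.Im w.
Proof. by case: z w => [a b] [c d]. Qed.
Lemma ImM z w : complex.Im (z * w) = complex.Re z * complex.Im w + complex.Im z * complex.Re w.
Proof. by case: z w => [a b] [c d]. Qed.
Lemma ReV z : complex.Re z^-1 = complex.Re z / cabs2 z.
Proof. by case: z => a b. Qed.
Lemma ImV z : complex.Im z^-1 = - complex.Im z / cabs2 z.
Proof. by case: z => a b; rewrite /= mulNr. Qed.
Definition ReImE := (ReD, ImD, ReN, ImN, ReM, ImM).

Lemma Re_real x : complex.Re (x%:C)%C = x. Proof. by []. Qed.
Lemma Im_real x : complex.Im (x%:C)%C = 0. Proof. by []. Qed.

Lemma real_complexM x y : ((x * y)%:C = x%:C * y%:C)%C.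
Proof. exact: (rmorphM (real_complex R)). Qed.
Lemma real_complexD x y : ((x + y)%:C = x%:C + y%:C)%C.
Proof. exact: (rmorphD (real_complex R)). Qed.
Lemma real_complexX x n : ((x ^+ n)%:C = x%:C ^+ n)%C.
Proof. exact: (rmorphXn (real_complex R)). Qed.
Lemma real_complexN x : ((- x)%:C = - x%:C)%C.
Proof. exact: (rmorphN (real_complex R)). Qed.
Lemma real_complexV x : ((x^-1)%:C = x%:C^-1)%C.
Proof. exact: (fmorphV (real_complex R)). Qed.

Lemma normcE2 z : nc z ^+ 2 = cabs2 z.
Proof. by case: z => a b /=; rewrite sqr_sqrtr // addr_ge0 ?sqr_ge0. Qed.
Lemma normc_ge0 z : 0 <= nc z.
Proof. by case: z => a b /=; rewrite sqrtr_ge0. Qed.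
Lemma normc_real x : nc (x%:C)%C = `|x|.
Proof. by rewrite /= expr0n /= addr0 sqrtr_sqr. Qed.
Lemma ler_normcD z w : nc (z + w) <= nc z + nc w.
Proof. exact: le_normcD. Qed.
Lemma normc_opp z : nc (- z) = nc z.
Proof. exact: normcN. Qed.
Lemma normcX z n : nc (z ^+ n) = nc z ^+ n.
Proof.
elim: n => [|n IH]; last by rewrite !exprS Normc.normcM IH.
by rewrite !expr0 normc_real normr1.
Qed.
Lemma normc_prod (I : Type) (r : seq I) (F : I -> R[i]) :
  nc (\prod_(i <- r) F i) = \prod_(i <- r) nc (F i).
Proof. by elim/big_rec2: _ => [|i y1 y2 _ <-]; rewrite ?Normc.normcM //; exact: Normc.normc1. Qed.
Lemma ler_normc_sum (I : Type) (r : seq I) (F : I -> R[i]) :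
  nc (\sum_(i <- r) F i) <= \sum_(i <- r) nc (F i).
Proof.
elim/big_rec2: _ => [|i y1 y2 _ le]; first by rewrite Normc.normc0.
by apply: (le_trans (ler_normcD _ _)); rewrite lerD2l.
Qed.
Lemma ler_Re_normc z : `|complex.Re z| <= nc z.
Proof. by case: z => a b /=; rewrite -sqrtr_sqr ler_sqrt ?lerDl ?addr_ge0 ?sqr_ge0. Qed.
Lemma ler_Im_normc z : `|complex.Im z| <= nc z.
Proof. by case: z => a b /=; rewrite -sqrtr_sqr ler_sqrt ?lerDr ?addr_ge0 ?sqr_ge0. Qed.
Lemma cabs2M z w : cabs2 (z * w) = cabs2 z * cabs2 w.
Proof. by rewrite -!normcE2 Normc.normcM exprMn. Qed.
Lemma cabs2_ge0 z : 0 <= cabs2 z.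
Proof. by rewrite -normcE2 sqr_ge0. Qed.

Lemma cexpD z w : cexp (z + w) = cexp z * cexp w.
Proof.
case: z w => [a b] [c d]; apply: eq_ReIm; rewrite /cexp /= expRD ?cosD ?sinD; ring.
Qed.
Lemma cexp_real x : cexp (x%:C)%C = (expR x)%:C%C.
Proof. by rewrite /cexp /= cos0 sin0 mulr1 mulr0. Qed.
Lemma cexp0 : cexp (0 : R[i]) = 1.
Proof. by rewrite -[0 in LHS]/((0 : R)%:C)%C cexp_real expR0. Qed.
Lemma normc_cexp z : nc (cexp z) = expR (complex.Re z).
Proof.
rewrite /= !exprMn -mulrDr cos2Dsin2 mulr1 sqrtr_sqr ger0_norm //; exact: expR_ge0.
Qed.
Lemma cexp_neq0 z : cexp z != 0.
Proof.
apply/eqP => z0; have := normc_cexp z; rewrite z0 Normc.normc0 => /esym/eqP.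
by rewrite gt_eqF ?expR_gt0.
Qed.
Lemma cexpN z : cexp (- z) = (cexp z)^-1.
Proof. by apply: (mulIf (cexp_neq0 z)); rewrite -cexpD addNr cexp0 mulVf ?cexp_neq0. Qed.
Lemma cexp_sum (I : Type) (r : seq I) (F : I -> R[i]) :
  cexp (\sum_(i <- r) F i) = \prod_(i <- r) cexp (F i).
Proof. by elim/big_rec2: _ => [|i y1 y2 _ <-]; rewrite ?cexp0 ?cexpD. Qed.
Lemma cexp_nat z n : cexp (n%:R * z) = cexp z ^+ n.
Proof.
elim: n => [|n IH]; first by rewrite mul0r cexp0.
by rewrite -natr1 mulrDl mul1r cexpD IH exprSr.
Qed.

End ComplexExponential.

(** * Measurability of complex-valued functions, by components *)

Section ComplexMeasurability.
Context {R : realType} {d} {T : measurableType d}.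
Implicit Types F G : T -> R[i].

Definition cmeasurable F :=
  measurable_fun [set: T] (fun x => complex.Re (F x)) /\
  measurable_fun [set: T] (fun x => complex.Im (F x)).

Lemma cmeasurable_cst (c : R[i]) : cmeasurable (fun=> c).
Proof. by split; exact: measurable_cst. Qed.
Lemma cmeasurable_real (f : T -> R) :
  measurable_fun [set: T] f -> cmeasurable (fun x => (f x)%:C%C).
Proof. by move=> mf; split => //=; exact: measurable_cst. Qed.
Lemma cmeasurableD F G : cmeasurable F -> cmeasurable G -> cmeasurable (fun x => F x + G x).
Proof.
move=> [a b] [c e]; split.
  under eq_fun do rewrite ReD; exact: measurable_funD.
under eq_fun do rewrite ImD; exact: measurable_funD.
Qed.
Lemma cmeasurableN F : cmeasurable F -> cmeasurable (fun x => - F x).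
Proof.
move=> [a b]; split.
  under eq_fun do rewrite ReN; exact: measurableT_comp.
under eq_fun do rewrite ImN; exact: measurableT_comp.
Qed.
Lemma cmeasurableM F G : cmeasurable F -> cmeasurable G -> cmeasurable (fun x => F x * G x).
Proof.
move=> [a b] [c e]; split.
  under eq_fun do rewrite ReM; by apply: measurable_funB; apply: measurable_funM.
under eq_fun do rewrite ImM; by apply: measurable_funD; apply: measurable_funM.
Qed.
Lemma cmeasurableX F n : cmeasurable F -> cmeasurable (fun x => F x ^+ n).
Proof.
move=> mF; elim: n => [|n IH]; first exact: cmeasurable_cst.
under eq_fun do rewrite exprS; exact: cmeasurableM.
Qed.
Lemma cmeasurable_prod (I : Type) (r : seq I) (F : I -> T -> R[i]) :
  (forall i, cmeasurable (F i)) -> cmeasurable (fun x => \prod_(i <- r) F i x).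
Proof.
move=> mF; elim: r => [|i r IH].
  by under eq_fun do rewrite big_nil; exact: cmeasurable_cst.
by under eq_fun do rewrite big_cons; exact: cmeasurableM.
Qed.
Lemma cmeasurable_sum (I : Type) (r : seq I) (F : I -> T -> R[i]) :
  (forall i, cmeasurable (F i)) -> cmeasurable (fun x => \sum_(i <- r) F i x).
Proof.
move=> mF; elim: r => [|i r IH].
  by under eq_fun do rewrite big_nil; exact: cmeasurable_cst.
by under eq_fun do rewrite big_cons; exact: cmeasurableD.
Qed.
Lemma cmeasurable_cexp F : cmeasurable F -> cmeasurable (fun x => cexp (F x)).
Proof.
move=> [a b]; split => /=.
  apply: measurable_funM; first exact: (measurableT_comp (@measurable_expR R)).
  exact: (measurableT_comp (continuous_measurable_fun (@continuous_cos R))).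
apply: measurable_funM; first exact: (measurableT_comp (@measurable_expR R)).
exact: (measurableT_comp (continuous_measurable_fun (@continuous_sin R))).
Qed.
Lemma measurable_invr (f : T -> R) : measurable_fun [set: T] f ->
  measurable_fun [set: T] (fun x => (f x)^-1).
Proof.
(* The measurable power [powR] yields the inverse of a nonnegative base only, hence 1 / x = x
   (x^2)^(-1); at x = 0 both sides are 0. *)
move=> mf; have -> : (fun x => (f x)^-1) = (fun x => f x * (f x ^+ 2) `^ (-1)).
  apply/funext => x; rewrite powR_inv1 ?sqr_ge0 // expr2 invfM.
  by have [->|n0] := eqVneq (f x) 0; rewrite ?invr0 ?mul0r // mulrA divff // mul1r.
apply: measurable_funM => //.
by apply: (measurableT_comp (@measurable_powR R (-1))); apply: measurable_funX.
Qed.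
Lemma cmeasurable_inv F : cmeasurable F -> cmeasurable (fun x => (F x)^-1).
Proof.
move=> [a b]; have mc : measurable_fun [set: T] (fun x => (cabs2 (F x))^-1).
  by apply: measurable_invr; apply: measurable_funD; apply: measurable_funX.
split.
  by under eq_fun do rewrite ReV; apply: measurable_funM.
by under eq_fun do rewrite ImV; apply: measurable_funM => //; apply: measurable_funN.
Qed.
Lemma cmeasurable_cabs2 F : cmeasurable F -> measurable_fun [set: T] (fun x => cabs2 (F x)).
Proof.
by move=> [a b]; apply: measurable_funD; apply: measurable_funX.
Qed.

End ComplexMeasurability.

Lemma cmeasurable_comp {R : realType} {d d'} {T : measurableType d} {T' : measurableType d'}
    (F : T -> R[i]) (g : T' -> T) :
  measurable_fun [set: T'] g -> cmeasurable F -> cmeasurable (fun x => F (g x)).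
Proof. by move=> mg [a b]; split; [exact: (measurableT_comp a)|exact: (measurableT_comp b)]. Qed.

(** * Integrals dominated by a multiple of 1 / (1 + x^2) *)

Section WeightedDomination.
Context {R : realType}.
Implicit Types (x y : R) (f g : R -> R) (F G : R -> R[i]).
Local Notation mu := (@lebesgue_measure R).

(** One majorant serves throughout: polynomials times Gaussians and double poles are all bounded by
    multiples of it. Dominated convergence, Fubini and differentiation under the integral then share
    one kind of hypothesis. *)
Definition cauchy_weight x : R := (1 + x ^+ 2)^-1.
Local Notation w := cauchy_weight.

Lemma cauchy_weight_gt0 x : 0 < w x.
Proof. by rewrite invr_gt0 ltr_pwDl // sqr_ge0. Qed.

Lemma measurable_cauchy_weight : measurable_fun [set: R] w.
Proof.
apply: measurable_invr; apply: measurable_funD; first exact: measurable_cst.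
exact: exprn_measurable.
Qed.

Lemma cauchy_weightE x : w x = (oneDsqr x)^-1.
Proof. by []. Qed.

Lemma integral_cauchy_weight : (\int[mu]_x (w x)%:E = pi%:E)%E.
Proof.
under eq_integral do rewrite cauchy_weightE.
rewrite ge0_symfun_integralT; last 3 first.
- by move=> x; rewrite -cauchy_weightE ltW ?cauchy_weight_gt0.
- by move=> x; exact: continuous_oneDsqrV.
- by move=> x /=; rewrite /oneDsqr sqrrN.
rewrite (_ : [set x | 0 <= x] = `[0%R, +oo[); last first.
  by apply/seteqP; split => x /=; rewrite in_itv /= andbT.
by rewrite integral0y_oneDsqr -EFinM; congr EFin; field.
Qed.

(** A pointwise bound is asked rather than integrability because it passes to integrals over a
    second variable, as in [tame_cint1], and so survives iteration. *)
Definition tame F := cmeasurable F /\ exists K, forall x, nc (F x) <= K * w x.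

Lemma integrable_weight f : measurable_fun [set: R] f ->
  (exists K, forall x, `|f x| <= K * w x) -> mu.-integrable [set: R] (EFin \o f).
Proof.
move=> mf [K fK].
have ig : mu.-integrable [set: R] (fun x => (K%:E * (w x)%:E)%E).
  apply: integrableZl => //; apply/integrableP; split.
    by apply/measurable_EFinP; exact: measurable_cauchy_weight.
  under eq_integral do rewrite /= ger0_norm ?(ltW (cauchy_weight_gt0 _)) //.
  by rewrite integral_cauchy_weight ltry.
apply: (le_integrable measurableT _ _ ig); first exact/measurable_EFinP.
move=> x _ /=; rewrite lee_fin (le_trans (fK x)) //.
by rewrite normrM (ger0_norm (ltW (cauchy_weight_gt0 x))) ler_wpM2r ?ler_norm // ltW ?cauchy_weight_gt0.
Qed.

Lemma tame_Re F : tame F -> mu.-integrable [set: R] (fun x => (complex.Re (F x))%:E).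
Proof.
move=> [[a b] [K FK]]; apply: (integrable_weight a); exists K => x.
exact: le_trans (ler_Re_normc _) (FK x).
Qed.
Lemma tame_Im F : tame F -> mu.-integrable [set: R] (fun x => (complex.Im (F x))%:E).
Proof.
move=> [[a b] [K FK]]; apply: (integrable_weight b); exists K => x.
exact: le_trans (ler_Im_normc _) (FK x).
Qed.

Lemma tameD F G : tame F -> tame G -> tame (fun x => F x + G x).
Proof.
move=> [mF [K FK]] [mG [L GL]]; split; first exact: cmeasurableD.
exists (K + L) => x; rewrite mulrDl; apply: (le_trans (ler_normcD _ _)); exact: lerD.
Qed.
Lemma tameZ (c : R[i]) F : tame F -> tame (fun x => c * F x).
Proof.
move=> [mF [K FK]]; split; first by apply: cmeasurableM => //; exact: cmeasurable_cst.
exists (nc c * K) => x; rewrite Normc.normcM -mulrA ler_wpM2l ?normc_ge0 //.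
Qed.
Lemma tame0 : tame (fun=> 0).
Proof.
split; first exact: cmeasurable_cst.
by exists 0 => x; rewrite mul0r Normc.normc0.
Qed.
Lemma tame_sum (I : Type) (r : seq I) (F : I -> R -> R[i]) :
  (forall i, tame (F i)) -> tame (fun x => \sum_(i <- r) F i x).
Proof.
move=> mF; elim: r => [|i r IH].
  by under eq_fun do rewrite big_nil; exact: tame0.
by under eq_fun do rewrite big_cons; exact: tameD.
Qed.

Lemma eq_cint1 F G : (forall x, F x = G x) -> cint1 F = cint1 G.
Proof. by move=> /funext ->. Qed.

Lemma cint1D F G : tame F -> tame G -> cint1 (fun x => F x + G x) = cint1 F + cint1 G.
Proof.
move=> tF tG; apply: eq_ReIm => /=.
  under eq_Rintegral do rewrite ReD.
  by rewrite RintegralD //; exact: tame_Re.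
under eq_Rintegral do rewrite ImD.
by rewrite RintegralD //; exact: tame_Im.
Qed.

Lemma integrableZ_EFin (c : R) f : mu.-integrable [set: R] (EFin \o f) ->
  mu.-integrable [set: R] (EFin \o (fun x => c * f x)).
Proof. by move=> /(integrableZl measurableT c); under eq_fun do rewrite -EFinM. Qed.

Lemma cint1Z (c : R[i]) F : tame F -> cint1 (fun x => c * F x) = c * cint1 F.
Proof.
move=> tF; have iR := tame_Re tF; have iI := tame_Im tF; apply: eq_ReIm => /=.
  rewrite ReM /=; under eq_Rintegral do rewrite ReM.
  by rewrite RintegralB ?RintegralZl //; exact: integrableZ_EFin.
rewrite ImM /=; under eq_Rintegral do rewrite ImM.
by rewrite RintegralD ?RintegralZl //; exact: integrableZ_EFin.
Qed.

Lemma cint1_0 : cint1 (fun=> 0 : R[i]) = 0.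
Proof.
transitivity (cint1 (fun=> 0 * 0 : R[i])); first by apply: eq_cint1 => x; rewrite mul0r.
by rewrite (cint1Z 0 tame0) mul0r.
Qed.

Lemma cint1_sum (I : Type) (r : seq I) (F : I -> R -> R[i]) :
  (forall i, tame (F i)) -> cint1 (fun x => \sum_(i <- r) F i x) = \sum_(i <- r) cint1 (F i).
Proof.
move=> mF; elim: r => [|i r IH].
  by under eq_fun do rewrite big_nil; rewrite cint1_0 big_nil.
under eq_fun do rewrite big_cons.
by rewrite cint1D //; [rewrite IH big_cons|exact: tame_sum].
Qed.

Lemma Rintegral_weight_le f K : measurable_fun [set: R] f ->
  (forall x, `|f x| <= K * w x) -> `|Rintegral mu setT f| <= K * pi.
Proof.
move=> mf fK; have fi : mu.-integrable [set: R] (EFin \o f).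
  by apply: integrable_weight => //; exists K.
have wi : mu.-integrable [set: R] (EFin \o w).
  apply: integrable_weight; first exact: measurable_cauchy_weight.
  by exists 1 => x; rewrite mul1r ger0_norm // ltW ?cauchy_weight_gt0.
apply: (le_trans (le_normr_Rintegral measurableT fi)).
have -> : K * pi = Rintegral mu setT (fun x => K * w x).
  by rewrite RintegralZl // /Rintegral integral_cauchy_weight.
apply: le_Rintegral => //; last exact: integrableZ_EFin.
exact: (integrable_norm fi).
Qed.

(** Real and imaginary parts are bounded separately, which costs the factor 2; no later estimate is
    sensitive to it. *)
Lemma normc_cint1_le F K : cmeasurable F -> (forall x, nc (F x) <= K * w x) ->
  nc (cint1 F) <= 2 * K * pi.
Proof.
move=> [mR mI] FK; rewrite -mulrA mulr_natl mulr2n.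
have -> : cint1 F = (complex.Re (cint1 F))%:C%C + 'i%C * (complex.Im (cint1 F))%:C%C.
  exact: complexE.
apply: (le_trans (ler_normcD _ _)); rewrite Normc.normcM !normc_real.
have -> : nc ('i%C : R[i]) = 1 by rewrite /= expr0n expr1n add0r sqrtr1.
rewrite mul1r; apply: lerD; apply: Rintegral_weight_le => // x.
  exact: le_trans (ler_Re_normc _) (FK x).
exact: le_trans (ler_Im_normc _) (FK x).
Qed.

End WeightedDomination.

(** * Parameter integrals and Fubini under a product bound *)

Section ParameterIntegral.
Context {R : realType}.
Local Notation mu := (@lebesgue_measure R).
Local Notation w := (@cauchy_weight R).

(** Tonelli makes the integrals of the positive and negative parts measurable; their difference and
    its [fine] stay measurable even where an integral is infinite. *)
Lemma measurable_param_Rintegral d (T : measurableType d) (f : T * R -> R) :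
  measurable_fun [set: T * R] f ->
  measurable_fun [set: T] (fun x => Rintegral mu setT (fun y => f (x, y))).
Proof.
move=> mf; have mEf : measurable_fun [set: T * R] (EFin \o f) by exact/measurable_EFinP.
apply: (measurableT_comp (fine_measurable measurableT)).
under eq_fun do rewrite integralE.
have Ep x : (fun y => (f (x, y))%:E)^\+%E = (EFin \o f)^\+%E \o pair x.
  exact: (funepos_comp (EFin \o f) (pair x)).
have En x : (fun y => (f (x, y))%:E)^\-%E = (EFin \o f)^\-%E \o pair x.
  exact: (funeneg_comp (EFin \o f) (pair x)).
under eq_fun do rewrite Ep En.
apply: emeasurable_funB.
  exact: (measurable_fun_fubini_tonelli_F (m2 := mu) (EFin \o f)^\+%E
    (measurable_funepos mEf) (fun=> funepos_ge0 _ _)).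
exact: (measurable_fun_fubini_tonelli_F (m2 := mu) (EFin \o f)^\-%E
  (measurable_funeneg mEf) (fun=> funeneg_ge0 _ _)).
Qed.

Lemma cmeasurable_cint1 d (T : measurableType d) (G : T * R -> R[i]) :
  cmeasurable G -> cmeasurable (fun x => cint1 (fun y => G (x, y))).
Proof.
move=> [a b]; split => /=.
  exact: (measurable_param_Rintegral (f := fun z => complex.Re (G z))).
exact: (measurable_param_Rintegral (f := fun z => complex.Im (G z))).
Qed.

Lemma integrable_weight2 (f : R * R -> R) K : measurable_fun [set: R * R] f ->
  (forall x y, `|f (x, y)| <= K * w x * w y) ->
  (mu \x mu)%E.-integrable [set: R * R] (EFin \o f).
Proof.
move=> mf fK; apply/integrable12ltyP; first exact/measurable_EFinP.
have K0 x : 0 <= K * w x.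
  by have := le_trans (normr_ge0 _) (fK x 0); rewrite pmulr_lge0 ?cauchy_weight_gt0.
apply: (@le_lt_trans _ _ (\int[mu]_x ((K * w x)%:E * pi%:E))%E); last first.
  have ik : mu.-integrable [set: R] (EFin \o (fun x => (K * w x) * pi)).
    apply: integrable_weight.
      apply: measurable_funM => //; apply: measurable_funM => //.
      exact: measurable_cauchy_weight.
    exists (K * pi) => x; rewrite ger0_norm; first by rewrite mulrAC.
    by apply: mulr_ge0 => //; exact: pi_ge0.
  have /integrableP[_] := ik; apply: le_lt_trans.
  rewrite le_eqVlt; apply/orP; left; apply/eqP; apply: eq_integral => x _.
  by rewrite -EFinM /= ger0_norm // mulr_ge0 ?pi_ge0.
apply: ge0_le_integral => //.
- by move=> x _; apply: integral_ge0.
- apply: (measurable_fun_fubini_tonelli_F (m2 := mu) (fun z => `|(f z)%:E|%E)) => //.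
  by apply: measurableT_comp => //; exact/measurable_EFinP.
- apply/measurable_EFinP; apply: measurable_funM => //; apply: measurable_funM => //.
  exact: measurable_cauchy_weight.
move=> x _; rewrite -integral_cauchy_weight.
rewrite -ge0_integralZl_EFin //; last 2 first.
- by move=> y _; rewrite lee_fin ltW ?cauchy_weight_gt0.
- by apply/measurable_EFinP; exact: measurable_cauchy_weight.
apply: ge0_le_integral => //.
- apply: measurableT_comp => //; apply/measurable_EFinP.
  exact: (measurableT_comp mf (measurable_pair1 x)).
- apply/measurable_EFinP; apply: measurable_funM => //.
  exact: measurable_cauchy_weight.
by move=> y _; rewrite /= lee_fin.
Qed.

Lemma Rintegral_swap (f : R * R -> R) K : measurable_fun [set: R * R] f ->
  (forall x y, `|f (x, y)| <= K * w x * w y) ->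
  Rintegral mu setT (fun x => Rintegral mu setT (fun y => f (x, y))) =
  Rintegral mu setT (fun y => Rintegral mu setT (fun x => f (x, y))).
Proof.
move=> mf fK; have := Fubini (integrable_weight2 mf fK).
have fin1 x : ((fine (\int[mu]_y (f (x, y))%:E))%:E = \int[mu]_y (f (x, y))%:E)%E.
  apply: fineK; apply: integrable_fin_num => //.
  apply: (integrable_weight (f := fun y => f (x, y))).
    exact: (measurableT_comp mf (measurable_pair1 x)).
  by exists (K * w x).
have fin2 y : ((fine (\int[mu]_x (f (x, y))%:E))%:E = \int[mu]_x (f (x, y))%:E)%E.
  apply: fineK; apply: integrable_fin_num => //.
  apply: (integrable_weight (f := fun x => f (x, y))).
    exact: (measurableT_comp mf (measurable_pair2 y)).
  by exists (K * w y) => x; rewrite mulrAC.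
rewrite /Rintegral => /= E; congr fine.
under eq_integral do rewrite fin1.
by under [RHS]eq_integral do rewrite fin2.
Qed.

Section Swap.
Variables (G : R * R -> R[i]) (K : R).
Hypothesis mG : cmeasurable G.
Hypothesis GK : forall x y, nc (G (x, y)) <= K * w x * w y.

Lemma tame_cint1 : tame (fun x => cint1 (fun y => G (x, y))).
Proof.
split; first exact: cmeasurable_cint1.
exists (2 * K * pi) => x.
apply: (le_trans (@normc_cint1_le _ _ (K * w x) _ _)) => //; last by rewrite !mulrA; lra.
exact: (cmeasurable_comp (measurable_pair1 x) mG).
Qed.

Lemma cint1_swap :
  cint1 (fun x => cint1 (fun y => G (x, y))) = cint1 (fun y => cint1 (fun x => G (x, y))).
Proof.
case: mG => mR mI; apply: eq_ReIm => /=.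
  apply: (Rintegral_swap (f := fun z => complex.Re (G z)) (K := K)) => // x y.
  exact: le_trans (ler_Re_normc _) (GK x y).
apply: (Rintegral_swap (f := fun z => complex.Im (G z)) (K := K)) => // x y.
exact: le_trans (ler_Im_normc _) (GK x y).
Qed.
End Swap.

End ParameterIntegral.

(** * Integrals of derivatives, and integrals constant in a parameter *)

Section ContourShift.
Context {R : realType}.
Local Notation mu := (@lebesgue_measure R).
Local Notation w := (@cauchy_weight R).
Implicit Types f g : R -> R.

Lemma cauchy_weight_cvg0 : w n.+1%:R @[n --> \oo] --> (0 : R).
Proof.
apply: (squeeze_cvgr (f := fun=> 0) (h := harmonic)); last 2 first.
- exact: cvg_cst.
- exact: cvg_harmonic.
apply: nearW => n; rewrite ltW ?cauchy_weight_gt0 //= /cauchy_weight.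
have w0 : (0 : R) < 1 + n.+1%:R ^+ 2 by rewrite ltr_pwDl ?sqr_ge0.
rewrite lef_pV2 ?posrE ?ltr0n //.
by rewrite ler_wpDl // -natrX ler_nat -{1}[n.+1]expn1; apply: leq_pexp2l.
Qed.

(** The fundamental theorem of calculus on symmetric intervals: the boundary terms die by the bound
    on [f], and the truncated integrals of [g] converge by domination. *)
Lemma Rintegral_derive0 f g (K : R) :
  (forall x : R, is_derive x (1 : R) f (g x)) -> continuous g ->
  (forall x, `|f x| <= K * w x) -> (forall x, `|g x| <= K * w x) ->
  Rintegral mu setT g = 0.
Proof.
move=> df cg fK gK.
have mg : measurable_fun [set: R] g by exact: continuous_measurable_fun.
have ig : mu.-integrable [set: R] (EFin \o g) by apply: integrable_weight => //; exists K.
have iw : mu.-integrable [set: R] (EFin \o (fun x => K * w x)).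
  apply: integrable_weight.
    by apply: measurable_funM => //; exact: measurable_cauchy_weight.
  exists `|K| => x; rewrite normrM (ger0_norm (ltW (cauchy_weight_gt0 x))) //.
(* [n.+1] keeps the interval nondegenerate already at n = 0. *)
pose In n := `[- n.+1%:R, n.+1%:R]%classic : set R.
pose gn n x := (g x * \1_(In n) x)%:E.
have mgn n : measurable_fun [set: R] (gn n).
  apply/measurable_EFinP; apply: measurable_funM => //; apply: measurable_indic; exact: measurable_itv.
have H1 : {ae mu, forall x, [set: R] x -> gn ^~ x @ \oo --> (EFin \o g) x}.
  apply: aeW => x _; apply: cvg_near_cst.
  near=> n; rewrite /gn indicE mem_set ?mulr1 //= /In /= in_itv /= -ler_norml.
  near: n; exists (Num.trunc `|x|) => // m /= mx.
  by rewrite (le_trans (ltW (truncnS_gt _))) // ler_nat ltnS.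
have H2 : {ae mu, forall x n, [set: R] x -> (`|gn n x| <= (EFin \o (fun x => K * w x)%R) x)%E}.
  apply: aeW => x n _ /=; rewrite lee_fin (le_trans _ (gK x)) // normrM ler_piMr //.
  by rewrite indicE; case: (_ \in _); rewrite ?normr1 ?normr0.
have [_ _ cv] := @dominated_convergence _ _ _ mu setT measurableT gn (EFin \o g)
  (EFin \o (fun x => K * w x)) mgn (measurable_int mu ig) H1 iw H2.
have E n : (\int[mu]_(x in setT) gn n x = (f n.+1%:R - f (- n.+1%:R))%:E)%E.
  rewrite EFinB -(@continuous_FTC2 _ g f).
  - rewrite [RHS]integral_mkcond; apply: eq_integral => x _.
    rewrite /gn patchE indicE; case: ifPn => _; first by rewrite mulr1.
    by rewrite mulr0.
  - by rewrite gtrN ?ltr0n.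
  - exact: continuous_subspaceT.
  - have cf : continuous f.
      move=> x; apply: differentiable_continuous; apply/derivable1_diffP.
      by have [] := df x.
    split.
    + by move=> x _; have [] := df x.
    + exact/cvg_at_right_filter/cf.
    + exact/cvg_at_left_filter/cf.
  - by move=> x _; rewrite derive1E; have [] := df x.
have {}cv : ((f n.+1%:R - f (- n.+1%:R))%:E @[n --> \oo] --> \int[mu]_x (g x)%:E)%E.
  by move: cv; under eq_fun do rewrite E.
have cv0 : f n.+1%:R - f (- n.+1%:R) @[n --> \oo] --> (0 : R).
  apply: norm_cvg0.
  apply: (squeeze_cvgr (f := fun=> 0) (h := fun n => (K + K) * w n.+1%:R)).
  - apply: nearW => n; rewrite normr_ge0 /= (le_trans (ler_normB _ _)) // mulrDl lerD //.
    by rewrite (le_trans (fK _)) // /cauchy_weight sqrrN.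
  - exact: cvg_cst.
  - by rewrite -[X in _ --> X](mulr0 (K + K)); apply: cvgMr; exact: cauchy_weight_cvg0.
have {}cv0 : ((f n.+1%:R - f (- n.+1%:R))%:E @[n --> \oo] --> (0:R)%:E)%E.
  by apply: cvg_EFin cv0; exact: nearW.
by rewrite /Rintegral (cvg_unique (@ereal_hausdorff R) cv cv0).
Unshelve. all: by end_near.
Qed.

(** Differentiation under the integral sign on (a - 1, a + 1), where the bound for M = |a| + 1 is
    uniform, gives derivative 0 at every a. *)
Lemma Rintegral_contour_shift (f q : R -> R -> R) :
  (forall y x : R, is_derive y (1 : R) (fun y => f y x) (q y x)) ->
  (forall y, mu.-integrable [set: R] (EFin \o f y)) ->
  (forall y, Rintegral mu setT (q y) = 0) ->
  (forall M : R, exists K : R, forall y x : R, `|y| <= M -> `|q y x| <= K * w x) ->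
  forall y y', Rintegral mu setT (f y) = Rintegral mu setT (f y').
Proof.
move=> df fi q0 qK y y'.
apply: (is_derive_0_is_cst (f := fun y => Rintegral mu setT (f y))) => a.
have [K qKw] := qK (`|a| + 1).
have Ia : `](a - 1), (a + 1)[%classic a by rewrite /= in_itv /= ltrBlDr ltrDl ltr01 /=.
have d1E z x : partial1of2 f z x = q z x.
  by rewrite partial1of2E; have [_] := df z x.
have K0 x : 0 <= K * w x.
  by apply: (le_trans (normr_ge0 (q a x))); apply: qKw; rewrite lerDl.
have Gi : mu.-integrable [set: R] (EFin \o (fun x => K * w x)).
  apply: integrable_weight.
    by apply: measurable_funM => //; exact: measurable_cauchy_weight.
  by exists K => x; rewrite ger0_norm.
have Gub z x : `](a - 1), (a + 1)[%classic z -> [set: R] x -> `|partial1of2 f z x| <= K * w x.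
  rewrite /= in_itv /= => /andP[z1 z2] _; rewrite d1E; apply: qKw.
  have -> : z = a + (z - a) by ring.
  rewrite (le_trans (ler_normD _ _)) // lerD2l ler_norml; lra.
have dd z x : `](a - 1), (a + 1)[%classic z -> [set: R] x -> derivable (f^~ x) z 1.
  by move=> _ _; have [] := df z x.
have ii z : `](a - 1), (a + 1)[%classic z -> mu.-integrable [set: R] (EFin \o f z) by [].
apply: DeriveDef.
  exact: (derivable_under_integral measurableT Ia ii dd K0 Gi Gub).
rewrite -derive1E (differentiation_under_integral measurableT Ia ii dd K0 Gi Gub).
by rewrite -[RHS](q0 a); apply: eq_Rintegral => x _; rewrite d1E.
Qed.

End ContourShift.

(** * Calculus for complex-valued functions of a real variable *)

Section ComplexDerivative.
Context {R : realType}.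
Implicit Types (x y : R) (F G : R -> R[i]) (d e : R[i]).

(** Contours are moved through real parameters, so derivatives are taken in a real variable and a
    holomorphic dependence appears only as proportionality of two such derivatives. *)
Definition is_cderive F x d :=
  is_derive (x : R) (1 : R) (fun x => complex.Re (F x) : R) (complex.Re d) /\
  is_derive (x : R) (1 : R) (fun x => complex.Im (F x) : R) (complex.Im d).

Lemma is_derive1_eq (f : R -> R) x (d e : R) :
  is_derive (x : R) (1 : R) f d -> d = e -> is_derive (x : R) (1 : R) f e.
Proof. by move=> ? <-. Qed.

Lemma is_derive1D (f g : R -> R) x (a b : R) :
  is_derive (x : R) (1 : R) f a -> is_derive (x : R) (1 : R) g b ->
  is_derive (x : R) (1 : R) (fun x => f x + g x) (a + b).
Proof. exact: is_deriveD. Qed.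

Lemma is_derive1N (f : R -> R) x (a : R) :
  is_derive (x : R) (1 : R) f a -> is_derive (x : R) (1 : R) (fun x => - f x) (- a).
Proof. exact: is_deriveN. Qed.

Lemma is_derive1M (f g : R -> R) x (a b : R) :
  is_derive (x : R) (1 : R) f a -> is_derive (x : R) (1 : R) g b ->
  is_derive (x : R) (1 : R) (fun x => f x * g x) (a * g x + f x * b).
Proof.
move=> da db; apply: is_derive1_eq (is_deriveM da db) _.
by rewrite /GRing.scale /=; ring.
Qed.

Lemma is_cderive_eq F x d e : is_cderive F x d -> d = e -> is_cderive F x e.
Proof. by move=> ? <-. Qed.

Lemma is_cderive_cst (c : R[i]) x : is_cderive (fun=> c) x 0.
Proof. by split; exact: is_derive_cst. Qed.

Lemma is_cderive_real (f : R -> R) x (d : R) :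
  is_derive (x : R) (1 : R) f d -> is_cderive (fun x => (f x)%:C%C) x (d%:C)%C.
Proof. by move=> df; split => //=; exact: is_derive_cst. Qed.

Lemma is_cderive_id x : is_cderive (fun x => x%:C%C) x 1.
Proof. by apply: is_cderive_real; exact: is_derive_id. Qed.

Lemma is_cderiveD F G x d e : is_cderive F x d -> is_cderive G x e ->
  is_cderive (fun x => F x + G x) x (d + e).
Proof.
move=> [a b] [a' b']; split.
  rewrite ReD; under eq_fun do rewrite ReD; exact: is_deriveD.
rewrite ImD; under eq_fun do rewrite ImD; exact: is_deriveD.
Qed.

Lemma is_cderiveM F G x d e : is_cderive F x d -> is_cderive G x e ->
  is_cderive (fun x => F x * G x) x (d * G x + F x * e).
Proof.
move=> [a b] [a' b']; split.
  under eq_fun do rewrite ReM.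
  apply: (is_derive1_eq (is_derive1D (is_derive1M a a') (is_derive1N (is_derive1M b b')))).
  by rewrite /GRing.scale /= ReD !ReM; ring.
under eq_fun do rewrite ImM.
apply: (is_derive1_eq (is_derive1D (is_derive1M a b') (is_derive1M b a'))).
by rewrite /GRing.scale /= ImD !ImM; ring.
Qed.

Lemma is_cderiveX F x d n : is_cderive F x d ->
  is_cderive (fun x => F x ^+ n) x (n%:R * F x ^+ n.-1 * d).
Proof.
move=> dF; elim: n => [|n IH].
  by rewrite mul0r mul0r; exact: is_cderive_cst.
under eq_fun do rewrite exprS.
apply: is_cderive_eq; first exact: is_cderiveM dF IH.
case: n {IH} => [|n] /=; first by rewrite !expr0; ring.
by rewrite exprS -!natr1; ring.
Qed.

Lemma is_cderive_cexp F x d : is_cderive F x d ->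
  is_cderive (fun x => cexp (F x)) x (d * cexp (F x)).
Proof.
move=> [a b].
have ex : is_derive x (1 : R) (fun x => expR (complex.Re (F x))) (complex.Re d * expR (complex.Re (F x))).
  by apply: (is_derive1_eq (is_derive1_comp (f := expR) (is_derive_expR _) a)); rewrite mulrC.
have co : is_derive x (1 : R) (fun x => cos (complex.Im (F x))) (- complex.Im d * sin (complex.Im (F x))).
  by apply: (is_derive1_eq (is_derive1_comp (f := cos) (is_derive_cos _) b)); ring.
have si : is_derive x (1 : R) (fun x => sin (complex.Im (F x))) (complex.Im d * cos (complex.Im (F x))).
  by apply: (is_derive1_eq (is_derive1_comp (f := sin) (is_derive_sin _) b)); rewrite mulrC.
split; rewrite /cexp /=.
  apply: (is_derive1_eq (is_derive1M ex co)).
  by rewrite /GRing.scale /= ReM /=; ring.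
apply: (is_derive1_eq (is_derive1M ex si)).
by rewrite /GRing.scale /= ImM /=; ring.
Qed.

Lemma is_cderiveV F x d : is_cderive F x d -> F x != 0 ->
  is_cderive (fun x => (F x)^-1) x (- d * (F x) ^- 2).
Proof.
move=> [a b] F0.
have c0 : complex.Re (F x) ^+ 2 + complex.Im (F x) ^+ 2 != 0.
  rewrite -/(cabs2 (F x)) -normcE2 expf_eq0 /=.
  by apply: contra F0 => /eqP/Normc.eq0_normc ->.
have dc : is_derive x (1 : R) (fun x => (cabs2 (F x))^-1)
    (- (cabs2 (F x)) ^- 2 * (2 * complex.Re (F x) * complex.Re d + 2 * complex.Im (F x) * complex.Im d)).
  have ds : is_derive (x : R) (1 : R) (fun x => cabs2 (F x)) _ := is_derive1D (is_derive1M a a) (is_derive1M b b).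
  apply: (is_derive1_eq (is_deriveV (f := fun x => cabs2 (F x)) c0 ds)).
  by rewrite /GRing.scale /=; ring.
have E : - d * F x ^- 2 = - d * ((F x)^-1 * (F x)^-1) by rewrite -exprVn expr2.
rewrite {}E; split.
  under eq_fun do rewrite ReV.
  apply: (is_derive1_eq (is_derive1M a dc)).
  rewrite !ReImE !(ReV, ImV); move: c0; rewrite /cabs2.
  set u := complex.Re (F x); set v := complex.Im (F x) => c0; by field.
under eq_fun do rewrite ImV.
apply: (is_derive1_eq (is_derive1M (is_derive1N b) dc)).
rewrite !ReImE !(ReV, ImV); move: c0; rewrite /cabs2.
set u := complex.Re (F x); set v := complex.Im (F x) => c0; by field.
Qed.

Lemma is_cderive_continuous F x d : is_cderive F x d ->
  {for x, continuous (fun x => complex.Re (F x))} /\ {for x, continuous (fun x => complex.Im (F x))}.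
Proof.
by move=> [[a _] [b _]]; split; apply: differentiable_continuous; apply/derivable1_diffP.
Qed.

Lemma cint1_derive0 F G (K : R) :
  (forall x, is_cderive F x (G x)) -> (forall x, exists d, is_cderive G x d) ->
  (forall x, nc (F x) <= K * cauchy_weight x) -> (forall x, nc (G x) <= K * cauchy_weight x) ->
  cint1 G = 0.
Proof.
move=> dF dG FK GK; apply: eq_ReIm => /=.
  apply: (@Rintegral_derive0 _ (fun x => complex.Re (F x)) _ K) => x.
  - by have [] := dF x.
  - by have [d /is_cderive_continuous[]] := dG x.
  - exact: le_trans (ler_Re_normc _) (FK x).
  - exact: le_trans (ler_Re_normc _) (GK x).
apply: (@Rintegral_derive0 _ (fun x => complex.Im (F x)) _ K) => x.
- by have [] := dF x.
- by have [d /is_cderive_continuous[]] := dG x.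
- exact: le_trans (ler_Im_normc _) (FK x).
- exact: le_trans (ler_Im_normc _) (GK x).
Qed.

Lemma is_cderive_cmeasurable F : (forall x, exists d, is_cderive F x d) -> cmeasurable F.
Proof.
move=> dF; split; apply: continuous_measurable_fun => x;
by have [d /is_cderive_continuous[]] := dF x.
Qed.

(* A family [h y] whose [y]-derivative is a multiple of its [x]-derivative has an integral that does not depend on [y]: this is how contours of integration are moved. *)
Lemma cint1_contour_shift (h p : R -> R -> R[i]) (k : R -> R[i]) :
  (forall y x, is_cderive (fun y => h y x) y (k y * p y x)) ->
  (forall y x, is_cderive (h y) x (p y x)) ->
  (forall y x, exists d, is_cderive (p y) x d) ->
  (forall M : R, exists K : R, forall y x, `|y| <= M ->
    [/\ nc (h y x) <= K * cauchy_weight x, nc (p y x) <= K * cauchy_weight x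
      & nc (k y) <= K]) ->
  forall y y', cint1 (h y) = cint1 (h y').
Proof.
move=> dy dx dp B y y'.
have p0 z : cint1 (p z) = 0.
  have [K HK] := B `|z|; apply: (@cint1_derive0 (h z) _ K) => // x.
    by have [] := HK z x (lexx _).
  by have [] := HK z x (lexx _).
have tp z : tame (p z).
  split; first exact: is_cderive_cmeasurable.
  by have [K HK] := B `|z|; exists K => x; have [] := HK z x (lexx _).
have th z : tame (h z).
  split; first by apply: is_cderive_cmeasurable => x; exists (p z x).
  by have [K HK] := B `|z|; exists K => x; have [] := HK z x (lexx _).
have kp0 z : cint1 (fun x => k z * p z x) = 0 by rewrite cint1Z // p0 mulr0.
have kpB (M : R) : exists K : R, forall y x, `|y| <= M -> nc (k y * p y x) <= K * cauchy_weight x.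
  have [K HK] := B M; exists (K * K) => z x zM; have [_ H2 H3] := HK z x zM.
  by rewrite Normc.normcM -mulrA; apply: ler_pM => //; exact: normc_ge0.
apply: eq_ReIm => /=.
  apply: (@Rintegral_contour_shift _ (fun y x => complex.Re (h y x)) (fun y x => complex.Re (k y * p y x))).
  - by move=> z x; have [] := dy z x.
  - by move=> z; exact: tame_Re.
  - by move=> z; have := congr1 (@complex.Re R) (kp0 z).
  - by move=> M; have [K HK] := kpB M; exists K => z x zM; apply: le_trans (ler_Re_normc _) (HK _ _ zM).
apply: (@Rintegral_contour_shift _ (fun y x => complex.Im (h y x)) (fun y x => complex.Im (k y * p y x))).
- by move=> z x; have [] := dy z x.
- by move=> z; exact: tame_Im.
- by move=> z; have := congr1 (@complex.Im R) (kp0 z).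
- by move=> M; have [K HK] := kpB M; exists K => z x zM; apply: le_trans (ler_Im_normc _) (HK _ _ zM).
Qed.

End ComplexDerivative.

Lemma real_complex_nat (R : realType) n : ((n%:R : R)%:C)%C = n%:R :> R[i].
Proof. exact: (rmorph_nat (real_complex R)). Qed.

(** Pascal's rule against a general array [F]: Gaussian moments are not powers, so the binomial
    theorem itself does not apply to them. *)
Lemma binomial_sumS (S : pzRingType) (j : nat) (F : nat -> nat -> S) :
  \sum_(k < j.+2) ('C(j.+1, k))%:R * F (j.+1 - k)%N k =
  \sum_(k < j.+1) ('C(j, k))%:R * (F (j - k).+1 k + F (j - k)%N k.+1).
Proof.
rewrite big_ord_recl /= bin0 subn0.
transitivity (1%:R * F j.+1 0 + (\sum_(k < j.+1) ('C(j, k.+1))%:R * F (j - k)%N k.+1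
   + \sum_(k < j.+1) ('C(j, k))%:R * F (j - k)%N k.+1)).
  congr (_ + _); rewrite -big_split; apply: eq_bigr => k _ /=.
  by rewrite /bump /= add1n subSS binS natrD mulrDl.
rewrite addrA; under [RHS]eq_bigr do rewrite mulrDr.
rewrite big_split; congr (_ + _) => /=.
transitivity (\sum_(k < j.+2) ('C(j, k))%:R * F (j.+1 - k)%N k).
  by rewrite [RHS]big_ord_recl /= bin0 subn0; congr (_ + _).
rewrite big_ord_recr /= bin_small // mul0r addr0.
by apply: eq_bigr => k _; rewrite subSn // -ltnS.
Qed.

(** * Moments of Gaussians with a complex centre *)

Section GaussianMoments.
Context {R : realType}.
Implicit Types (A x y : R) (b : R[i]).
Local Notation mu := (@lebesgue_measure R).
Local Notation w := (@cauchy_weight R).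

(** With r = |x|, r^k (1 + r^2) <= (1 + r)^(k + 2) <= exp ((k + 2) r); the constant is then the
    maximum of exp (- A r^2 + (c + k + 2) r). *)
Lemma gauss_le_cauchy_weight k A c x : 0 < A ->
  `|x| ^+ k * expR (- A * x ^+ 2 + c * `|x|) <= expR ((c + k.+2%:R) ^+ 2 / (4 * A)) * w x.
Proof.
move=> A0; have w0 := cauchy_weight_gt0 x.
rewrite -ler_pdivrMr // /cauchy_weight invrK.
set r := `|x|; have r0 : 0 <= r by exact: normr_ge0.
have -> : x ^+ 2 = r ^+ 2 by rewrite /r -normrX ger0_norm ?sqr_ge0.
have H : r ^+ k * (1 + r ^+ 2) <= expR (k.+2%:R * r).
  have e1 : 1 + r <= expR r by exact: expR_ge1Dx.
  have -> : expR (k.+2%:R * r) = expR r ^+ k * expR r ^+ 2.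
    by rewrite -exprD addn2 expRM_natl.
  apply: ler_pM; rewrite ?exprn_ge0 ?addr_ge0 ?sqr_ge0 //.
    by apply: lerXn2r; rewrite ?nnegrE ?expR_ge0 //; lra.
  apply: (@le_trans _ _ ((1 + r) ^+ 2)); first by nra.
  by apply: lerXn2r; rewrite ?nnegrE ?expR_ge0 //; lra.
rewrite mulrAC; apply: (le_trans (ler_wpM2r (expR_ge0 _) H)).
rewrite -expRD ler_expR ler_pdivlMr; last by rewrite mulr_gt0.
have := sqr_ge0 (2 * A * r - (c + k.+2%:R)); nra.
Qed.

Definition gaussian A b x : R[i] := cexp (- A%:C%C * (x%:C%C - b) ^+ 2).

Lemma normc_gaussian A b x : nc (gaussian A b x) =
  expR (- A * x ^+ 2 + 2 * A * complex.Re b * x + A * (complex.Im b ^+ 2 - complex.Re b ^+ 2)).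
Proof.
rewrite normc_cexp expr2 !ReImE /=; congr expR; ring.
Qed.

(** The bound is uniform for centres in a disc, as moving the centre requires. *)
Lemma gaussian_weight_bound k A (M : R) : 0 < A -> exists K : R, forall b x,
  nc b <= M -> nc (x%:C%C ^+ k * gaussian A b x) <= K * w x.
Proof.
move=> A0; exists (expR (A * M ^+ 2) * expR ((2 * A * M + k.+2%:R) ^+ 2 / (4 * A))) => b x bM.
rewrite Normc.normcM normcX normc_real normc_gaussian -[leRHS]mulrA.
apply: le_trans (ler_wpM2l (expR_ge0 _) (gauss_le_cauchy_weight k (2 * A * M) x A0)).
rewrite [leRHS]mulrCA ler_wpM2l ?exprn_ge0 // -expRD ler_expR.
have h1 := le_trans (ler_Re_normc b) bM.
have h2 := le_trans (ler_Im_normc b) bM.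
have h3 : complex.Re b * x <= M * `|x|.
  by rewrite (le_trans (ler_norm _)) // normrM ler_wpM2r.
have h4 : complex.Im b ^+ 2 <= M ^+ 2.
  by rewrite -[complex.Im b ^+ 2]ger0_norm ?sqr_ge0 // normrX lerXn2r ?nnegrE // (le_trans _ h2).
have h5 := sqr_ge0 (complex.Re b).
have h6 : A * (complex.Re b * x) <= A * (M * `|x|) by rewrite ler_wpM2l // ltW.
have h7 : A * (complex.Im b ^+ 2 - complex.Re b ^+ 2) <= A * M ^+ 2 by rewrite (ler_wpM2l (ltW A0)) //; lra.
lra.
Qed.

Lemma is_cderive_gaussian A b x :
  is_cderive (gaussian A b) x (- (2 * A)%:C%C * (x%:C%C - b) * gaussian A b x).
Proof.
have d1 : is_cderive (fun x => x%:C%C - b) x 1.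
  by apply: is_cderive_eq (is_cderiveD (is_cderive_id x) (is_cderive_cst (- b) x)) _; rewrite addr0.
have d2 := is_cderiveM (is_cderive_cst (- A%:C%C) x) (is_cderiveX 2 d1).
apply: (is_cderive_eq (is_cderive_cexp d2)); rewrite -/(gaussian A b x).
rewrite /= real_complexM; congr (_ * _); rewrite real_complex_nat; ring.
Qed.

Lemma is_cderive_monomial k x : is_cderive (fun x => x%:C%C ^+ k) x (k%:R * x%:C%C ^+ k.-1).
Proof. by apply: is_cderive_eq (is_cderiveX k (is_cderive_id x)) _; rewrite mulr1. Qed.

Lemma tame_gaussian k A b : 0 < A -> tame (fun x => x%:C%C ^+ k * gaussian A b x).
Proof.
move=> A0; split.
  apply: is_cderive_cmeasurable => x; eexists.
  by apply: is_cderiveM; [exact: is_cderive_monomial|exact: is_cderive_gaussian].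
by have [K HK] := gaussian_weight_bound k (nc b) A0; exists K => x; exact: HK.
Qed.

Definition gmoment k A b : R[i] := cint1 (fun x => x%:C%C ^+ k * gaussian A b x).

(** Integration by parts: the derivative of x^k times the Gaussian has integral 0. At k = 0 the term
    in [k.-1] has coefficient 0. *)
Lemma gmoment_rec k A b : 0 < A ->
  gmoment k.+1 A b = b * gmoment k A b + (k%:R / (2 * A)%:C%C) * gmoment k.-1 A b.
Proof.
move=> A0; have t j := tame_gaussian j b A0.
have c0 : (2 * A)%:C%C != 0 :> R[i] by rewrite fmorph_eq0 mulf_neq0 // gt_eqF.
pose G x := k%:R * (x%:C%C ^+ k.-1 * gaussian A b x) +
  ((- (2 * A)%:C%C) * (x%:C%C ^+ k.+1 * gaussian A b x) +
   (2 * A)%:C%C * b * (x%:C%C ^+ k * gaussian A b x)).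
have tG : tame G by apply: tameD; [exact: tameZ|apply: tameD; exact: tameZ].
have EG : cint1 G = k%:R * gmoment k.-1 A b +
  (- (2 * A)%:C%C * gmoment k.+1 A b + (2 * A)%:C%C * b * gmoment k A b).
  by rewrite /G cint1D ?cint1D ?cint1Z //; try (apply: tameD); exact: tameZ.
have dF x : is_cderive (fun x => x%:C%C ^+ k * gaussian A b x) x (G x).
  apply: is_cderive_eq (is_cderiveM (is_cderive_monomial k x) (is_cderive_gaussian A b x)) _.
  by rewrite /G exprS; ring.
have dG x : exists d, is_cderive G x d.
  eexists; apply: is_cderiveD; [|apply: is_cderiveD];
  (apply: is_cderiveM; [exact: is_cderive_cst|]);
  (apply: is_cderiveM; [exact: is_cderive_monomial|exact: is_cderive_gaussian]).
have [_ [K FK]] := t k; have [_ [L GL]] := tG.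
have : cint1 G = 0.
  apply: (@cint1_derive0 _ _ _ (Num.max K L) dF dG) => x.
    by rewrite (le_trans (FK x)) // ler_wpM2r ?le_max ?lexx // ltW ?cauchy_weight_gt0.
  by rewrite (le_trans (GL x)) // ler_wpM2r ?le_max ?lexx ?orbT // ltW ?cauchy_weight_gt0.
rewrite EG; move: c0; set c := (2 * A)%:C%C => c0 /eqP; rewrite addrCA addrC -subr_eq0.
move=> /eqP H; apply: (mulfI c0); rewrite mulrDr; apply/eqP; rewrite -subr_eq0; apply/eqP.
rewrite -[RHS]oppr0 -H; clearbody c; by field.
Qed.

(** The centre moves along the segment from 0 to [b]: for the centre y b, the y-derivative of the
    Gaussian is - b times its x-derivative. *)
Lemma gmoment0_shift A b : 0 < A -> gmoment 0 A b = gmoment 0 A 0.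
Proof.
move=> A0.
pose h (y x : R) := gaussian A (y%:C%C * b) x.
pose p (y x : R) := - (2 * A)%:C%C * (x%:C%C - y%:C%C * b) * gaussian A (y%:C%C * b) x.
have -> : gmoment 0 A b = cint1 (h 1).
  by apply: eq_cint1 => x; rewrite /h expr0 mul1r -[(1%:C)%C]/(1 : R[i]) mul1r.
have -> : gmoment 0 A 0 = cint1 (h 0).
  by apply: eq_cint1 => x; rewrite /h expr0 mul1r -[(0%:C)%C]/(0 : R[i]) mul0r.
apply: (@cint1_contour_shift _ h p (fun=> - b)).
- move=> y x.
  have d1 : is_cderive (fun y => x%:C%C - y%:C%C * b) y (- b).
    under eq_fun do rewrite -mulrN.
    apply: (is_cderive_eq (is_cderiveD (is_cderive_cst (x%:C%C) y)
      (is_cderiveM (is_cderive_id y) (is_cderive_cst (- b) y)))); ring.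
  have d2 := is_cderiveM (is_cderive_cst (- A%:C%C) y) (is_cderiveX 2 d1).
  apply: (is_cderive_eq (is_cderive_cexp d2)); rewrite -/(gaussian A _ x) /p.
  rewrite /= real_complexM real_complex_nat; ring.
- by move=> y x; exact: is_cderive_gaussian.
- move=> y x; eexists; apply: is_cderiveM; last exact: is_cderive_gaussian.
  apply: is_cderiveM; first exact: is_cderive_cst.
  by apply: is_cderiveD; [exact: is_cderive_id|exact: is_cderive_cst].
- move=> M.
  have [K0 H0] := gaussian_weight_bound 0 (M * nc b) A0.
  have [K1 H1] := gaussian_weight_bound 1 (M * nc b) A0.
  pose Kp := `|2 * A| * (K1 + M * nc b * K0).
  exists (Num.max (Num.max K0 Kp) (nc b)) => y x yM.
  have bM : nc (y%:C%C * b) <= M * nc b.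
    by rewrite Normc.normcM normc_real ler_wpM2r ?normc_ge0.
  have w0 := ltW (cauchy_weight_gt0 x).
  have {}H0 : nc (gaussian A (y%:C%C * b) x) <= K0 * w x.
    by have := H0 _ x bM; rewrite expr0 mul1r.
  have {}H1 := H1 _ x bM; rewrite expr1 in H1.
  split.
  + by rewrite (le_trans H0) // ler_wpM2r // !le_max lexx.
  + apply: (@le_trans _ _ (Kp * w x)); last by rewrite ler_wpM2r // !le_max lexx orbT.
    rewrite /p -mulrA Normc.normcM normc_opp normc_real /Kp -mulrA ler_wpM2l //.
    rewrite mulrBl (le_trans (ler_normcD _ _)) // mulrDl lerD //.
    rewrite normc_opp Normc.normcM -[leRHS]mulrA.
    by apply: ler_pM; rewrite ?normc_ge0.
  + by rewrite normc_opp le_max lexx orbT.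
Qed.

Definition gauss_mass A : R := Num.sqrt (pi / A).

Lemma gmoment0 A b : 0 < A -> gmoment 0 A b = (gauss_mass A)%:C%C.
Proof.
move=> A0; rewrite gmoment0_shift //.
(* The standard deviation for which exp (- A x^2) is proportional to the centred normal density: s^2
   = 1 / (2 A). *)
pose s := Num.sqrt (2 * A)^-1.
have s2 : s ^+ 2 = (2 * A)^-1 by rewrite sqr_sqrtr // invr_ge0 ltW // mulr_gt0.
have s0 : s != 0 by rewrite sqrtr_eq0 -ltNge invr_gt0 mulr_gt0.
have A0' : A != 0 by rewrite gt_eqF.
have pE : normal_peak s = (gauss_mass A)^-1.
  by rewrite /normal_peak s2 /gauss_mass; congr (Num.sqrt _)^-1; rewrite -mulr_natr; field.
have m0 : gauss_mass A != 0 by rewrite sqrtr_eq0 -ltNge divr_gt0 ?pi_gt0.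
have I1 : Rintegral mu setT (fun x => expR (- A * x ^+ 2)) = gauss_mass A.
  have i1 := integral_normal_pdf 0 s.
  rewrite (normal_pdfE 0 s0) in i1.
  have ig : mu.-integrable [set: R] (EFin \o (fun x => expR (- A * x ^+ 2))).
    apply: integrable_weight.
      have m1 : measurable_fun [set: R] (fun x : R => - A * x ^+ 2).
        by apply: measurable_funM => //; exact: exprn_measurable.
      exact: (measurableT_comp (@measurable_expR R) m1).
    exists (expR ((0 + 2%:R) ^+ 2 / (4 * A))) => x.
    have := @gauss_le_cauchy_weight 0 A 0 x A0.
    by rewrite expr0 mul1r mul0r addr0 ger0_norm ?expR_ge0.
  apply: (mulfI (invr_neq0 m0)); rewrite mulVf // -RintegralZl //.
  rewrite /Rintegral -[RHS]/(fine (1%E : \bar R)) -i1; congr fine; apply: eq_integral => x _.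
  rewrite pE /normal_fun subr0 s2; congr (_ * expR _)%:E; rewrite -mulr_natr; by field.
have E x : x%:C%C ^+ 0 * gaussian A 0 x = (expR (- A * x ^+ 2))%:C%C.
  by rewrite expr0 mul1r /gaussian subr0 -cexp_real real_complexM real_complexX real_complexN.
rewrite /gmoment (eq_cint1 E); apply: eq_ReIm => //=.
by rewrite Rintegral_cst // mul0r.
Qed.

Lemma gauss_mass_sq A : 0 < A -> gauss_mass A ^+ 2 = pi / A.
Proof. by move=> A0; rewrite sqr_sqrtr // divr_ge0 ?pi_ge0 ?ltW. Qed.

(* The planar moments are read off one-dimensional ones through the binomial formula; the raising recursion [gmoment_rec] makes the correction terms of the two coordinates cancel because [(-i)^2 = -1]. *)
Lemma gmoment_antiholomorphic A b c m : 0 < A ->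
  \sum_(k < m.+1) ('C(m, k))%:R * (- 'i%C) ^+ k * (gmoment (m - k) A b * gmoment k A c)
  = (b - 'i%C * c) ^+ m * (gauss_mass A ^+ 2)%:C%C.
Proof.
move=> A0; set I := 'i%C : R[i]; have I2 : I * I = -1 by rewrite -expr2 sqr_i.
pose e k := gmoment k A b; pose f k := gmoment k A c.
pose D m := \sum_(k < m.+1) ('C(m, k))%:R * (- I) ^+ k * (e (m - k)%N * f k).
rewrite -/(D m); pose r : R[i] := ((2 * A)%:C%C)^-1.
have eS k : e k.+1 = b * e k + k%:R * r * e k.-1 by exact: gmoment_rec.
have fS k : f k.+1 = c * f k + k%:R * r * f k.-1 by exact: gmoment_rec.
clearbody I.
have DS j : D j.+1 = (b - I * c) * D j.
  have -> : D j.+1 = \sum_(k < j.+1) ('C(j, k))%:R * (- I) ^+ k *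
      (e (j - k).+1 * f k - I * e (j - k)%N * f k.+1).
    pose F a k := (- I) ^+ k * (e a * f k).
    transitivity (\sum_(k < j.+2) ('C(j.+1, k))%:R * F (j.+1 - k)%N k).
      by apply: eq_bigr => k _; rewrite /F mulrA.
    by rewrite binomial_sumS; apply: eq_bigr => k _; rewrite /F exprS; ring.
  have S1 : \sum_(k < j.+1) ('C(j, k))%:R * (- I) ^+ k * ((j - k)%:R * e (j - k).-1 * f k) =
    \sum_(k < j.+1) ('C(j, k))%:R * (- I) ^+ k * (I * e (j - k)%N * (k%:R * f k.-1)).
    rewrite big_ord_recr [RHS]big_ord_recl /= subnn !mul0r !mulr0 addr0 add0r.
    apply: eq_bigr => k _; rewrite /bump /= add1n -subnS exprS.
    have Ebin : ('C(j, k))%:R * (j - k)%:R = ('C(j, k.+1))%:R * k.+1%:R :> R[i].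
      by rewrite -!natrM; congr (_%:R); rewrite [LHS]mulnC -mul_bin_left mulnC.
    transitivity (('C(j, k))%:R * (j - k)%:R * ((- I) ^+ k * (e (j - k.+1)%N * f k))).
      by ring.
    rewrite Ebin; transitivity ('C(j, k.+1)%:R * k.+1%:R * (- (I * I)) * ((- I) ^+ k * (e (j - k.+1)%N * f k))); last by ring.
    by rewrite I2 opprK mulr1.
  transitivity ((b - I * c) * D j + r * (
    \sum_(k < j.+1) ('C(j, k))%:R * (- I) ^+ k * ((j - k)%:R * e (j - k).-1 * f k) -
    \sum_(k < j.+1) ('C(j, k))%:R * (- I) ^+ k * (I * e (j - k)%N * (k%:R * f k.-1)))).
    rewrite /D !mulrBr !mulr_sumr -sumrB -big_split; apply: eq_bigr => k _ /=.
    by rewrite eS fS; ring.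
  by rewrite S1 subrr mulr0 addr0.
elim: m => [|j IH]; last by rewrite DS IH mulrA -exprS.
rewrite /D big_ord1 bin0 expr0 /e /f /= !gmoment0 // real_complexX expr2; ring.
Qed.

(** The sum is the planar Gaussian moment of (x^2 + y^2)^m. One induction step brings the factors (2
    (j - k) + 1) / (2 A) and (2 k + 1) / (2 A), whose sum (j + 1) / A is free of k; hence the
    factorial. *)
Lemma gmoment_radial A m : 0 < A ->
  \sum_(k < m.+1) ('C(m, k))%:R * (gmoment (m - k).*2 A 0 * gmoment k.*2 A 0)
  = (m`!%:R / A ^+ m * gauss_mass A ^+ 2)%:C%C.
Proof.
move=> A0; pose e k := gmoment k.*2 A 0.
have cA : A%:C%C != 0 :> R[i] by rewrite fmorph_eq0 gt_eqF.
have eS k : e k.+1 = (2 * k + 1)%:R / (2 * A)%:C%C * e k.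
  by rewrite /e doubleS gmoment_rec // mul0r add0r /= -mul2n addn1.
elim: m => [|j IH].
  by rewrite big_ord1 bin0 expr0 invr1 fact0 !mul1r !gmoment0 // -real_complexM -expr2.
have -> := @binomial_sumS R[i] j (fun a b : nat => e a * e b).
transitivity (j.+1%:R / A%:C%C * \sum_(k < j.+1) ('C(j, k))%:R * (e (j - k)%N * e k)).
  rewrite mulr_sumr; apply: eq_bigr => k _; rewrite !eS.
  have Ej : j.+1%:R = (j - k)%:R + k%:R + 1 :> R[i].
    by rewrite -natrD subnK ?natr1 // -ltnS.
  have E2 i : (2 * i + 1)%N%:R = 2 * i%:R + 1 :> R[i] by rewrite natrD natrM.
  rewrite Ej real_complexM real_complex_nat !E2.
  by clearbody e; clear - cA; move: (A%:C%C) cA => c c0; field.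
rewrite IH factS (exprS A) natrM -real_complex_nat -real_complexV -!real_complexM.
have An : A != 0 by rewrite gt_eqF.
by congr (_%:C%C); field; rewrite ?An ?expf_neq0 ?An.
Qed.

End GaussianMoments.

(** * Laplace inversion of a double pole *)

Section PoleFourier.
Context {R : realType}.
Implicit Types (x y a m : R).
Local Notation w := (@cauchy_weight R).

(** The integrand exp (m s) / s^2 of the inverse Laplace transform on the vertical line Re s = a. *)
Definition pole m a x : R[i] := cexp (m%:C%C * (a +i* x)%C) * ((a +i* x)%C^-1) ^+ 2.

Lemma normc_line a x : nc (a +i* x)%C ^+ 2 = a ^+ 2 + x ^+ 2.
Proof. by rewrite normcE2. Qed.

Lemma line_neq0 a x : 0 < a -> (a +i* x)%C != 0.
Proof.
move=> a0; apply/eqP => /(congr1 (@complex.Re R)) /= E.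
by move: a0; rewrite E ltxx.
Qed.

Lemma normc_pole m a x : 0 < a -> nc (pole m a x) = expR (m * a) / (a ^+ 2 + x ^+ 2).
Proof.
move=> a0; rewrite /pole Normc.normcM normc_cexp normcX Normc.normcV exprVn normc_line.
by rewrite ReM /= mul0r subr0.
Qed.

Lemma pole_weight_bound m a x : 0 < a ->
  nc (pole m a x) <= expR (m * a) * (1 + a ^- 2) * w x.
Proof.
move=> a0; rewrite normc_pole // -mulrA ler_wpM2l ?expR_ge0 // /cauchy_weight.
have a2 : 0 < a ^+ 2 by rewrite exprn_gt0.
have x1 : 0 < 1 + x ^+ 2 by rewrite ltr_pwDl ?sqr_ge0.
have x2 : 0 < a ^+ 2 + x ^+ 2 by rewrite ltr_pwDl ?sqr_ge0.
rewrite ler_pdivlMr // mulrC ler_pdivrMr //.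
have -> : (1 + a ^- 2) * (a ^+ 2 + x ^+ 2) = a ^+ 2 + x ^+ 2 + 1 + x ^+ 2 * a ^- 2.
  by field; rewrite gt_eqF.
have : 0 <= x ^+ 2 * a ^- 2 by rewrite mulr_ge0 ?sqr_ge0 // invr_ge0 ltW.
lra.
Qed.

Lemma pole_weight_bound1 m a x : 1 <= a -> nc (pole m a x) <= expR (m * a) * w x.
Proof.
move=> a1; have a0 : 0 < a by apply: lt_le_trans a1.
rewrite normc_pole // ler_wpM2l ?expR_ge0 // lef_pV2 ?posrE ?ltr_pwDl ?sqr_ge0 ?exprn_gt0 //.
by rewrite lerD2r exprn_ege1.
Qed.

Lemma is_cderive_line a x : is_cderive (fun x => (a +i* x)%C) x 'i%C.
Proof.
by split => /=; [exact: is_derive_cst|exact: is_derive_id].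
Qed.

Definition pole' m a x : R[i] :=
  m%:C%C * 'i%C * pole m a x - 2 * 'i%C * pole m a x * (a +i* x)%C^-1.

(** Stated for any path [l] because it is applied twice: along the line, and across it when the
    abscissa moves. *)
Lemma is_cderive_pole (l : R -> R[i]) m x (d : R[i]) : is_cderive l x d -> l x != 0 ->
  is_cderive (fun x => cexp (m%:C%C * l x) * ((l x)^-1) ^+ 2) x
    (d * (m%:C%C * (cexp (m%:C%C * l x) * ((l x)^-1) ^+ 2)
     - 2 * (cexp (m%:C%C * l x) * ((l x)^-1) ^+ 2) * (l x)^-1)).
Proof.
move=> dl l0.
have d1 := is_cderive_cexp (is_cderiveM (is_cderive_cst (m%:C%C) x) dl).
have d2 := is_cderiveX 2 (is_cderiveV dl l0).
apply: (is_cderive_eq (is_cderiveM d1 d2)) => /=; rewrite -!exprVn; ring.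
Qed.

Lemma pole_derive m a x : 0 < a -> is_cderive (pole m a) x (pole' m a x).
Proof.
move=> a0; apply: (is_cderive_eq (is_cderive_pole m (is_cderive_line a x) (line_neq0 x a0))).
by rewrite -/(pole m a x) /pole'; move: (pole m a x) ((a +i* x)%C^-1) ('i%C : R[i]) => *; ring.
Qed.

(** Laplace inversion would give 2 pi max (m, 0). *)
Definition pole_mass m : R[i] := cint1 (pole m 1).

(** The abscissa is written [expR y]: the contour shift runs over all real parameters, while the
    line must stay to the right of the pole at 0. *)
Lemma cint1_pole m a : 0 < a -> cint1 (pole m a) = pole_mass m.
Proof.
move=> a0.
have lnE : expR (ln a) = a by rewrite lnK // posrE.
pose h (y x : R) := pole m (expR y) x; pose p (y x : R) := pole' m (expR y) x.
pose k (y : R) : R[i] := - 'i%C * (expR y)%:C%C.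
have -> : cint1 (pole m a) = cint1 (h (ln a)) by rewrite /h lnE.
have -> : pole_mass m = cint1 (h 0) by rewrite /h expR0.
have dline y x : is_cderive (fun y => (expR y +i* x)%C) y ((expR y)%:C%C).
  by split => /=; [exact: is_derive_expR|exact: is_derive_cst].
apply: (@cint1_contour_shift _ h p k).
- move=> y x; apply: (is_cderive_eq (is_cderive_pole m (dline y x) (line_neq0 x (expR_gt0 y)))).
  rewrite -/(pole m (expR y) x) /p /k /pole'.
  have I2 : ('i%C : R[i]) * 'i%C = -1 by rewrite -expr2 sqr_i.
  move: (pole m _ x) ((_ +i* x)%C^-1) ('i%C : R[i]) I2 => P V I I2.
  transitivity ((expR y)%:C%C * (- (I * I)) * (m%:C%C * P - 2 * P * V)); last by ring.
  by rewrite I2 opprK mulr1.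
- by move=> y x; apply: pole_derive; exact: expR_gt0.
- move=> y x; have y0 := expR_gt0 y; have dp := pole_derive m x y0; eexists.
  apply: is_cderiveD; first exact: is_cderiveM (is_cderive_cst _ _) dp.
  apply: is_cderive_eq; last reflexivity.
  under eq_fun do rewrite -mulN1r.
  apply: is_cderiveM; first exact: is_cderive_cst.
  apply: is_cderiveM; first exact: is_cderiveM (is_cderive_cst _ _) dp.
  exact: is_cderiveV (is_cderive_line _ _) (line_neq0 x y0).
- move=> M; pose B := expR (`|m| * expR M) * (1 + expR M ^+ 2).
  pose Bp := (`|m| + 2 * expR M) * B.
  have B0 : 0 <= B by rewrite mulr_ge0 ?expR_ge0 ?addr_ge0 ?sqr_ge0.
  exists (Num.max (Num.max B Bp) (expR M)) => y x yM.
  have w0 := ltW (cauchy_weight_gt0 x).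
  have yM1 : expR y <= expR M by rewrite ler_expR (le_trans (ler_norm _)).
  have yM2 : (expR y)^-1 <= expR M.
    by rewrite -expRN ler_expR (le_trans (ler_norm _)) // normrN.
  have Hh : nc (h y x) <= B * w x.
    apply: le_trans (pole_weight_bound m x (expR_gt0 y)) _; rewrite ler_wpM2r // /B.
    apply: ler_pM; rewrite ?expR_ge0 ?addr_ge0 ?invr_ge0 ?exprn_ge0 ?expR_ge0 //.
      rewrite ler_expR (le_trans (ler_norm _)) // normrM (ger0_norm (expR_ge0 y)).
      by rewrite ler_wpM2l.
    by rewrite lerD2l -exprVn lerXn2r // nnegrE ?invr_ge0 expR_ge0.
  have V : nc ((expR y +i* x)%C^-1) <= expR M.
    rewrite Normc.normcV; apply: le_trans yM2.
    have y0 := expR_gt0 y.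
    have yn : expR y <= nc (expR y +i* x)%C.
      by have := ler_Re_normc (expR y +i* x)%C; rewrite /= ger0_norm ?expR_ge0.
    by rewrite lef_pV2 ?posrE // (lt_le_trans y0).
  have ni : nc ('i%C : R[i]) = 1 by rewrite /= expr0n expr1n add0r sqrtr1.
  split.
  + by rewrite (le_trans Hh) // ler_wpM2r // !le_max lexx.
  + apply: (@le_trans _ _ (Bp * w x)); last by rewrite ler_wpM2r // !le_max lexx orbT.
    have -> : Bp * w x = `|m| * (B * w x) + 2 * (expR M * (B * w x)).
      by rewrite /Bp !mulrDl !mulrA.
    rewrite /p /pole'; rewrite /h in Hh; move: (pole m _ x) Hh => P Hh.
    rewrite (le_trans (ler_normcD _ _)) // lerD //.
      by rewrite !Normc.normcM normc_real ni mulr1 ler_wpM2l.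
    rewrite normc_opp !Normc.normcM ni mulr1 -real_complex_nat normc_real ger0_norm //.
    rewrite -mulrA ler_wpM2l // mulrC; apply: ler_pM; rewrite ?normc_ge0 //.
  + rewrite /k Normc.normcM normc_opp ni mul1r normc_real ger0_norm ?expR_ge0 //.
    by rewrite le_max yM1 orbT.
Qed.

(** Pushing the line to the right kills the integral, since its modulus is at most 2 pi exp (m a).
    The inequality exp (m a) (1 - m a) <= 1 and one explicit abscissa replace the limit. *)
Lemma pole_mass_negative m : m < 0 -> pole_mass m = 0.
Proof.
move=> m0; apply: Normc.eq0_normc; apply/eqP; rewrite eq_le normc_ge0 andbT leNgt; apply/negP => e0.
set e := nc _ in e0.
have B a : 1 <= a -> e * (1 - m * a) <= 2 * pi.
  move=> a1; have a0 : 0 < a by apply: lt_le_trans a1.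
  have h : e <= 2 * expR (m * a) * pi.
    rewrite /e -(cint1_pole m a0); apply: normc_cint1_le.
      by apply: is_cderive_cmeasurable => x; eexists; exact: pole_derive.
    by move=> x; exact: pole_weight_bound1.
  have h1 : 0 <= 1 - m * a by rewrite subr_ge0; nra.
  apply: (le_trans (ler_wpM2r h1 h)).
  have h2 : 1 - m * a <= expR (- (m * a)) by exact: expR_ge1Dx.
  have h3 : expR (m * a) * (1 - m * a) <= 1.
    by apply: (le_trans (ler_wpM2l (expR_ge0 _) h2)); rewrite -expRD subrr expR0.
  have h4 := pi_ge0 R.
  have -> : 2 * expR (m * a) * pi * (1 - m * a) = 2 * pi * (expR (m * a) * (1 - m * a)) by ring.
  by rewrite ler_piMr // mulr_ge0.
have p4 := pi_ge0 R.
have em : 0 < e * - m by rewrite mulr_gt0 // oppr_gt0.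
(* At this abscissa the left side of [B] equals e + e (- m) + 2 pi, which exceeds 2 pi. *)
have X0 : 1 <= 1 + 2 * pi / (e * - m).
  by rewrite lerDl divr_ge0 ?(ltW em) // mulr_ge0.
have := B _ X0.
have -> : e * (1 - m * (1 + 2 * pi / (e * - m))) = e + e * - m + 2 * pi.
  have m1 : m != 0 by rewrite lt_eqF.
  have e1 : e != 0 by rewrite gt_eqF.
  by clearbody e; field; rewrite ?oppr_eq0 m1 e1.
lra.
Qed.

End PoleFourier.

(** * Absolutely convergent iterated integrals *)

Section IteratedIntegral.
Context {R : realType}.
Local Notation mu := (@lebesgue_measure R).
Local Notation w := (@cauchy_weight R).

(* [citer F v] says that every partial integral of [F] is absolutely convergent, which [cint] does not record, and that the total integral is [v]. *)
Fixpoint citer (k : nat) : (k.-tuple R -> R[i]) -> R[i] -> Prop :=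
  match k return (k.-tuple R -> R[i]) -> R[i] -> Prop with
  | 0 => fun F v => F [tuple] = v
  | k'.+1 => fun F v => exists2 h : R -> R[i], tame h /\ cint1 h = v &
      forall x, citer (fun s : k'.-tuple R => F [tuple of x :: s]) (h x)
  end.

Lemma eq_citer k (F G : k.-tuple R -> R[i]) v v' :
  (forall s, F s = G s) -> v = v' -> citer F v -> citer G v'.
Proof. by move=> /funext -> ->. Qed.

Lemma citer_iint k (F : k.-tuple R -> R[i]) v : citer F v ->
  iint (fun s => (complex.Re (F s))%:E) = (complex.Re v)%:E /\
  iint (fun s => (complex.Im (F s))%:E) = (complex.Im v)%:E.
Proof.
elim: k F v => [|k IH] F v /=; first by move=> ->.
move=> [h [th <-] hx] /=; split.
  under eq_integral do rewrite (IH _ _ (hx _)).1.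
  by rewrite /Rintegral fineK //; apply: integrable_fin_num => //; exact: tame_Re.
under eq_integral do rewrite (IH _ _ (hx _)).2.
by rewrite /Rintegral fineK //; apply: integrable_fin_num => //; exact: tame_Im.
Qed.

Lemma citer_cint k (F : k.-tuple R -> R[i]) v : citer F v -> cint F = v.
Proof. by move=> /citer_iint[E1 E2]; apply: eq_ReIm; rewrite /cint ?E1 ?E2. Qed.

Lemma citerD k (F G : k.-tuple R -> R[i]) u v :
  citer F u -> citer G v -> citer (fun s => F s + G s) (u + v).
Proof.
elim: k F G u v => [|k IH] F G u v /=; first by move=> -> ->.
move=> [f [tf <-] fx] [g [tg <-] gx]; exists (fun x => f x + g x).
  by rewrite cint1D //; split => //; exact: tameD.
by move=> x; apply: IH.
Qed.

Lemma citerZ k (c : R[i]) (F : k.-tuple R -> R[i]) v :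
  citer F v -> citer (fun s => c * F s) (c * v).
Proof.
elim: k F v => [|k IH] F v /=; first by move=> ->.
move=> [f [tf <-] fx]; exists (fun x => c * f x).
  by rewrite cint1Z //; split => //; exact: tameZ.
by move=> x; apply: IH.
Qed.

Lemma citer0 k : citer (fun _ : k.-tuple R => 0) 0.
Proof.
elim: k => [//|k IH] /=; exists (fun=> 0) => //.
by rewrite cint1_0; split => //; exact: tame0.
Qed.

Lemma citer_sum k (I : Type) (r : seq I) (F : I -> k.-tuple R -> R[i]) (v : I -> R[i]) :
  (forall i, citer (F i) (v i)) -> citer (fun s => \sum_(i <- r) F i s) (\sum_(i <- r) v i).
Proof.
move=> H; elim: r => [|i r IH].
  by apply: eq_citer (citer0 k) => [s|]; rewrite big_nil.
by apply: eq_citer (citerD (H i) IH) => [s|]; rewrite big_cons.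
Qed.

(** The last coordinate is integrated innermost; on the Heisenberg group it is xi, so the
    xi-integral can be evaluated before the planar ones. *)
Lemma citer_last k (F : (k + 1).-tuple R -> R[i]) v :
  (forall s : k.-tuple R, tame (fun x => F [tuple of s ++ [tuple x]])) ->
  citer (fun s : k.-tuple R => cint1 (fun x => F [tuple of s ++ [tuple x]])) v ->
  citer F v.
Proof.
elim: k F v => [|k IH] F v tF /=.
  move=> <-; exists (fun x => F [tuple x]); last first.
    by move=> x; congr F; apply: val_inj.
  have E x : F [tuple of [tuple] ++ [tuple x]] = F [tuple x] by congr F; apply: val_inj.
  split; last by apply: eq_cint1 => x; rewrite E.
  by have := tF [tuple]; under eq_fun do rewrite E.
move=> [h th hx]; exists h => // x.
have E (s : k.-tuple R) y : F [tuple of [tuple of x :: s] ++ [tuple y]] =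
    F [tuple of x :: [tuple of s ++ [tuple y]]] by congr F; apply: val_inj.
apply: IH => [s|].
  by have := tF [tuple of x :: s]; under eq_fun do rewrite E.
apply: eq_citer (hx x) => // s.
by apply: eq_cint1 => y; rewrite E.
Qed.

(** Fubini moves the integral over [l] outside all coordinate integrals, which then factor. The
    bounds on [h] are asked only where [a l] is nonzero, since in the application they hold only
    above the lowest frequency of the test function. *)
Lemma citer_cint1_prod k (a : R -> R[i]) (h : 'I_k -> R * R -> R[i]) (M : 'I_k -> R -> R) (K : R) :
  cmeasurable a -> (forall j, cmeasurable (h j)) ->
  (forall j l, 0 <= M j l) ->
  (forall l, a l != 0 -> forall j x, nc (h j (l, x)) <= M j l * w x) ->
  (forall l, nc (a l) * \prod_j M j l <= K * w l) ->
  citer (fun s => cint1 (fun l => a l * \prod_j h j (l, tnth s j)))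
        (cint1 (fun l => a l * \prod_j cint1 (fun x => h j (l, x)))).
Proof.
elim: k a h M K => [|k IH] a h M K ma mh M0 hM aK.
  by apply: eq_cint1 => l; rewrite !big_ord0.
pose G (z : R * R) := a z.2 * h ord0 (z.2, z.1) * \prod_(j < k) cint1 (fun y => h (lift ord0 j) (z.2, y)).
have K0 : 0 <= K.
  have h0 : 0 <= nc (a 0) * \prod_j M j 0 by rewrite mulr_ge0 ?normc_ge0 ?prodr_ge0.
  by have := le_trans h0 (aK 0); rewrite pmulr_lge0 // cauchy_weight_gt0.
have mG : cmeasurable G.
  apply: cmeasurableM.
    apply: cmeasurableM; first exact: (cmeasurable_comp measurable_snd ma).
    apply: (cmeasurable_comp _ (mh ord0)); apply: measurable_fun_pair.
      exact: measurable_snd.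
    exact: measurable_fst.
  apply: cmeasurable_prod => j.
  exact: (cmeasurable_comp measurable_snd (cmeasurable_cint1 (mh (lift ord0 j)))).
have th j l : a l != 0 -> tame (fun y => h j (l, y)).
  move=> al; split; last by exists (M j l) => x; exact: hM.
  exact: (cmeasurable_comp (measurable_pair1 l) (mh j)).
have GK x l : nc (G (x, l)) <= (K * (2 * pi) ^+ k) * w x * w l.
  have wx := ltW (cauchy_weight_gt0 x); have wl := ltW (cauchy_weight_gt0 l).
  have [al|al] := eqVneq (a l) 0.
    by rewrite /G al !mul0r Normc.normc0 !mulr_ge0 ?exprn_ge0 ?mulr_ge0 ?pi_ge0.
  rewrite /G /= !Normc.normcM normc_prod.
  apply: (@le_trans _ _ (nc (a l) * (M ord0 l * w x) * \prod_(j < k) (2 * pi * M (lift ord0 j) l))).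
    apply: ler_pM; rewrite ?mulr_ge0 ?normc_ge0 ?prodr_ge0 //.
      by move=> j _; exact: normc_ge0.
      by rewrite ler_wpM2l ?normc_ge0 // hM.
    apply: ler_prod => j _; rewrite normc_ge0 /= mulrAC; apply: normc_cint1_le.
      exact: (cmeasurable_comp (measurable_pair1 l) (mh (lift ord0 j))).
    by move=> y; exact: hM.
  rewrite big_split /= prodr_const card_ord.
  have := aK l; rewrite big_ord_recl => H.
  have c0 : 0 <= (2 * pi) ^+ k * w x by rewrite mulr_ge0 // exprn_ge0 // mulr_ge0 ?pi_ge0.
  have := ler_wpM2r c0 H; set P := \prod_(i < k) _; set Q := (2 * pi) ^+ k.
  have -> : nc (a l) * (M ord0 l * P) * (Q * w x) = nc (a l) * (M ord0 l * w x) * (Q * P) by ring.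
  by have -> : K * w l * (Q * w x) = K * Q * w x * w l by ring.
exists (fun x => cint1 (fun l => G (x, l))).
  split; first exact: tame_cint1 mG GK.
  rewrite (cint1_swap mG GK); apply: eq_cint1 => l; rewrite big_ord_recl /G /=.
  have [->|al] := eqVneq (a l) 0.
    by rewrite !mul0r -[RHS]cint1_0; apply: eq_cint1 => x; rewrite !mul0r.
  transitivity (cint1 (fun x => (a l * \prod_(j < k) cint1 (fun y => h (lift ord0 j) (l, y))) * h ord0 (l, x))).
    by apply: eq_cint1 => x; rewrite mulrAC.
  by rewrite cint1Z; [ring|exact: th].
(* The factor of the first coordinate, frozen at [x], joins [a], and its bound turns the constant
   into [K * w x]. *)
move=> x; have {}IH := IH (fun l => a l * h ord0 (l, x)) (fun j => h (lift ord0 j))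
  (fun j => M (lift ord0 j)) (K * w x).
apply: eq_citer (IH _ _ _ _ _) => //.
- move=> s; apply: eq_cint1 => l; rewrite big_ord_recl mulrA tnth0; congr (_ * _).
  by apply: eq_bigr => j _; rewrite tnthS.
- apply: cmeasurableM => //.
  exact: (cmeasurable_comp (measurable_pair2 x) (mh ord0)).
- by move=> l; rewrite mulf_eq0 negb_or => /andP[al _] j y; exact: hM.
- move=> l; have wx := ltW (cauchy_weight_gt0 x); have wl := ltW (cauchy_weight_gt0 l).
  have [al|al] := eqVneq (a l) 0.
    by rewrite al mul0r Normc.normc0 mul0r !mulr_ge0.
  rewrite Normc.normcM.
  apply: (@le_trans _ _ (nc (a l) * (M ord0 l * w x) * \prod_(j < k) M (lift ord0 j) l)).
    by rewrite ler_wpM2r ?prodr_ge0 // ler_wpM2l ?normc_ge0 // hM.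
  have := ler_wpM2l wx (aK l); rewrite big_ord_recl.
  set P := \prod_(i < k) _.
  have -> : w x * (nc (a l) * (M ord0 l * P)) = nc (a l) * (M ord0 l * w x) * P by ring.
  by have -> : w x * (K * w l) = K * w x * w l by ring.
Qed.

End IteratedIntegral.

(** * Linearity and monotonicity of nonnegative iterated integrals *)

Section NonnegativeIteratedIntegral.
Context {R : realType}.
Local Notation mu := (@lebesgue_measure R).
Local Open Scope ereal_scope.

Lemma iint_ge0 k (F : k.-tuple R -> \bar R) : (forall s, 0 <= F s) -> 0 <= iint F.
Proof. by elim: k F => [|k IH] F F0 //=; apply: integral_ge0 => x _; exact: IH. Qed.

(** The parameter space is arbitrary so that the induction can absorb one integration variable after
    another into it. *)
Lemma measurable_iint_param k d (T : measurableType d) (F : T * k.-tuple R -> \bar R) :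
  measurable_fun [set: T * k.-tuple R] F -> (forall z, 0 <= F z) ->
  measurable_fun [set: T] (fun x => iint (fun s => F (x, s))).
Proof.
elim: k d T F => [|k IH] d T F mF F0 /=; first exact: (measurableT_comp mF (measurable_pair2 [tuple])).
pose G (z : (T * R) * k.-tuple R) := F (z.1.1, [tuple of z.1.2 :: z.2]).
have mG : measurable_fun [set: (T * R) * k.-tuple R] G.
  apply: (measurableT_comp mF); apply: measurable_fun_pair.
    exact: (measurableT_comp measurable_fst measurable_fst).
  apply: (@measurable_cons _ _ _ _ (fun z : (T * R) * k.-tuple R => z.1.2) _ (fun z => z.2)).
    exact: (measurableT_comp measurable_snd measurable_fst).
  exact: measurable_snd.
have m1 := IH _ _ G mG (fun z => F0 _).
exact: (measurable_fun_fubini_tonelli_F (m2 := mu) _ m1 (fun z => iint_ge0 (fun s => F0 _))).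
Qed.

Lemma measurable_cons1 k (x : R) :
  measurable_fun [set: k.-tuple R] (fun s : k.-tuple R => [tuple of x :: s]).
Proof.
by apply: (@measurable_cons _ _ _ _ (fun=> x) _ id) => //; exact: measurable_cst.
Qed.

Lemma measurable_iint k (F : k.+1.-tuple R -> \bar R) :
  measurable_fun [set: k.+1.-tuple R] F -> (forall s, 0 <= F s) ->
  measurable_fun [set: R] (fun x => iint (fun s : k.-tuple R => F [tuple of x :: s])).
Proof.
move=> mF F0.
apply: (@measurable_iint_param k _ _ (fun z : R * k.-tuple R => F [tuple of z.1 :: z.2])) => //.
apply: (measurableT_comp mF).
apply: (@measurable_cons _ _ _ _ (fun z : R * k.-tuple R => z.1) _ (fun z => z.2)).
  exact: measurable_fst.
exact: measurable_snd.
Qed.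

Lemma iintD k (F G : k.-tuple R -> \bar R) :
  measurable_fun [set: k.-tuple R] F -> measurable_fun [set: k.-tuple R] G ->
  (forall s, 0 <= F s) -> (forall s, 0 <= G s) ->
  iint (fun s => F s + G s) = iint F + iint G.
Proof.
elim: k F G => [|k IH] F G mF mG F0 G0 //=.
rewrite -ge0_integralD //.
- apply: eq_integral => x _; apply: IH => //.
    exact: (measurableT_comp mF (measurable_cons1 x)).
  exact: (measurableT_comp mG (measurable_cons1 x)).
- by move=> x _; exact: iint_ge0.
- exact: measurable_iint.
- by move=> x _; exact: iint_ge0.
- exact: measurable_iint.
Qed.

Lemma iintZl k (c : R) (F : k.-tuple R -> \bar R) : (0 <= c)%R ->
  measurable_fun [set: k.-tuple R] F -> (forall s, 0 <= F s) ->
  iint (fun s => c%:E * F s) = c%:E * iint F.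
Proof.
move=> c0; elim: k F => [|k IH] F mF F0 //=.
rewrite -ge0_integralZl_EFin //.
- apply: eq_integral => x _; apply: IH => //.
  exact: (measurableT_comp mF (measurable_cons1 x)).
- by move=> x _; exact: iint_ge0.
- exact: measurable_iint.
Qed.

Lemma le_iint k (F G : k.-tuple R -> \bar R) :
  measurable_fun [set: k.-tuple R] F -> measurable_fun [set: k.-tuple R] G ->
  (forall s, 0 <= F s) -> (forall s, F s <= G s) -> iint F <= iint G.
Proof.
elim: k F G => [|k IH] F G mF mG F0 FG //=.
have G0 s : 0 <= G s by exact: le_trans (F0 s) (FG s).
apply: ge0_le_integral => //.
- by move=> x _; exact: iint_ge0.
- exact: measurable_iint.
- exact: measurable_iint.
- move=> x _; apply: IH => //.
    exact: (measurableT_comp mF (measurable_cons1 x)).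
  exact: (measurableT_comp mG (measurable_cons1 x)).
Qed.

End NonnegativeIteratedIntegral.

(** * Bounds on hyperbolic functions *)

Section HyperbolicBounds.
Context {R : realType}.
Implicit Types (x t l : R).

Lemma sinhRN x : sinhR (- x) = - sinhR x.
Proof. by rewrite /sinhR opprK; field. Qed.

Lemma cothRN x : cothR (- x) = - cothR x.
Proof.
by rewrite /cothR sinhRN /coshR opprK [expR (- x) + _]addrC invrN mulrN.
Qed.

Lemma sinhR_ge x : 0 <= x -> x * expR (- x) <= sinhR x.
Proof.
move=> x0; have h : 1 + 2 * x <= expR (2 * x) by exact: expR_ge1Dx.
have E : expR (2 * x) * expR (- x) = expR x by rewrite -expRD; congr expR; ring.
have p := expR_gt0 (- x).
have := ler_wpM2r (ltW p) h; rewrite E /sinhR ler_pdivlMr //; lra.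
Qed.

Lemma sinhR_gt0 x : 0 < x -> 0 < sinhR x.
Proof.
by move=> x0; apply: lt_le_trans (sinhR_ge (ltW x0)); rewrite mulr_gt0 ?expR_gt0.
Qed.

Lemma coshRE x : coshR x = sinhR x + expR (- x).
Proof. by rewrite /coshR /sinhR; field. Qed.

Lemma cothR_sub1 x : 0 < x -> cothR x - 1 = expR (- x) / sinhR x.
Proof.
move=> x0; have s0 := sinhR_gt0 x0; rewrite /cothR coshRE; field.
by rewrite gt_eqF.
Qed.

Lemma cothR_add1 x : 0 < x -> cothR x + 1 = expR x / sinhR x.
Proof.
move=> x0; have s0 : sinhR x != 0 by rewrite gt_eqF ?sinhR_gt0.
rewrite /cothR -[X in _ + X](divff s0) -mulrDl; congr (_ / _); rewrite /coshR /sinhR; lra.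
Qed.

Lemma cothR_gt1 x : 0 < x -> 1 < cothR x.
Proof. by move=> x0; rewrite -subr_gt0 cothR_sub1 // divr_gt0 ?expR_gt0 ?sinhR_gt0. Qed.

(** At x = t lambda this ratio is the origin of the damping exp (- 2 t m lambda). *)
Lemma cothR_ratio x : 0 < x -> cothR x - 1 = expR (- (2 * x)) * (cothR x + 1).
Proof.
move=> x0; rewrite cothR_sub1 // cothR_add1 // mulrA -expRD; congr (expR _ / _); ring.
Qed.

Lemma normr_div_sinhR t l : 0 < t -> `|l / sinhR (t * l)| <= t^-1 * expR (t * `|l|).
Proof.
move=> t0; wlog l0 : l / 0 <= l.
  move=> H; have [/H//|/ltW l0] := leP 0 l.
  have := H (- l); rewrite oppr_ge0 normrN mulrN sinhRN invrN mulrNN; exact.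
(* At 0 the quotient is 0 / 0 = 0 rather than its limit 1 / t; the bound covers both values. *)
rewrite (ger0_norm l0); have [->|l1] := eqVneq l 0.
  by rewrite mul0r normr0 mulr_ge0 ?expR_ge0 // invr_ge0 ltW.
have tl : 0 < t * l by rewrite mulr_gt0 // lt_def l1.
have s0 := sinhR_gt0 tl.
rewrite ger0_norm; last by rewrite divr_ge0 // ltW.
have h := sinhR_ge (ltW tl).
have e1 : expR (- (t * l)) * expR (t * l) = 1 by rewrite -expRD addNr expR0.
have h2 : t * l <= sinhR (t * l) * expR (t * l).
  by have := ler_wpM2r (expR_ge0 (t * l)) h; rewrite -[leLHS]mulrA e1 mulr1.
have -> : l / sinhR (t * l) = t^-1 * (t * l) / sinhR (t * l) by rewrite mulKf ?gt_eqF.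
rewrite -mulrA; apply: ler_wpM2l; first by rewrite invr_ge0 ltW.
by rewrite ler_pdivrMr // [leRHS]mulrC.
Qed.

(** Nonnegativity lets a square in the exponent be discarded; the upper bound leaves at most
    exponential growth in the frequency. *)
Lemma mulr_cothR_bounds t l : 0 < t -> 0 <= l * cothR (t * l) <= `|l| + t^-1.
Proof.
move=> t0; wlog l0 : l / 0 <= l.
  move=> H; have [/H//|/ltW l0] := leP 0 l.
  have := H (- l); rewrite oppr_ge0 normrN mulrN cothRN mulrNN; exact.
rewrite (ger0_norm l0); have [->|l1] := eqVneq l 0.
  by rewrite mul0r lexx add0r invr_ge0 ltW.
have tl : 0 < t * l by rewrite mulr_gt0 // lt_def l1.
have s0 := sinhR_gt0 tl; have c1 := cothR_gt1 tl.
apply/andP; split; first by rewrite mulr_ge0 // (le_trans _ (ltW c1)).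
rewrite -[cothR _](subrK 1) mulrDr mulr1 addrC lerD2l cothR_sub1 //.
have -> : l * (expR (- (t * l)) / sinhR (t * l)) = t^-1 * (t * l * expR (- (t * l))) / sinhR (t * l).
  by rewrite -[t * l * _]mulrA mulKf ?gt_eqF // mulrA.
rewrite -mulrA; apply: ler_piMr; first by rewrite invr_ge0 ltW.
rewrite ler_pdivrMr // mul1r; exact: sinhR_ge (ltW tl).
Qed.

End HyperbolicBounds.

(** * Functions of exponential growth in the frequency *)

Section ExponentialType.
Context {R : realType}.
Implicit Types (F G : R -> R[i]) (l t c : R).

(** All factors of the heat integrand other than exp (- t lambda^2) grow this way. The class is
    closed under products, and the Gaussian makes its measurable members tame; the form 1 + |l|
    merges the multiplicative constant with the rate. *)
Definition exp_type F := exists c : R, forall l, nc (F l) <= expR (c * (1 + `|l|)).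

Lemma exp_type_cst (a : R[i]) : exp_type (fun=> a).
Proof.
exists (nc a) => l; apply: (@le_trans _ _ (1 + nc a * (1 + `|l|))); last exact: expR_ge1Dx.
have a0 := normc_ge0 a; have l0 := normr_ge0 l; nra.
Qed.

Lemma exp_typeM F G : exp_type F -> exp_type G -> exp_type (fun l => F l * G l).
Proof.
move=> [c Fc] [d Gd]; exists (c + d) => l; rewrite Normc.normcM mulrDl expRD.
by apply: ler_pM; rewrite ?normc_ge0.
Qed.

Lemma exp_typeX F k : exp_type F -> exp_type (fun l => F l ^+ k).
Proof.
move=> EF; elim: k => [|k IH]; first exact: exp_type_cst.
by under eq_fun do rewrite exprS; exact: exp_typeM.
Qed.

Lemma exp_type_prod (I : Type) (r : seq I) (F : I -> R -> R[i]) :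
  (forall i, exp_type (F i)) -> exp_type (fun l => \prod_(i <- r) F i l).
Proof.
move=> H; elim: r => [|i r IH].
  by under eq_fun do rewrite big_nil; exact: exp_type_cst.
by under eq_fun do rewrite big_cons; exact: exp_typeM.
Qed.

Lemma exp_type_cexp F (c d : R) : 0 <= c -> 0 <= d ->
  (forall l, complex.Re (F l) <= c + d * `|l|) -> exp_type (fun l => cexp (F l)).
Proof.
move=> c0 d0 H; exists (c + d) => l; rewrite normc_cexp ler_expR (le_trans (H l)) //.
have := normr_ge0 l; nra.
Qed.

Lemma exp_type_real (f : R -> R) :
  (exists c : R, forall l, `|f l| <= expR (c * (1 + `|l|))) -> exp_type (fun l => (f l)%:C%C).
Proof. by move=> [c H]; exists c => l; rewrite normc_real. Qed.

Lemma tame_gauss_exp_type t F : 0 < t -> cmeasurable F -> exp_type F ->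
  tame (fun l => (expR (- (t * l ^+ 2)))%:C%C * F l).
Proof.
move=> t0 mF [c Fc]; split.
  apply: cmeasurableM => //; apply: cmeasurable_real.
  have m1 : measurable_fun [set: R] (fun l : R => - (t * l ^+ 2)).
    by apply: measurable_funN; apply: measurable_funM => //; exact: exprn_measurable.
  exact: (measurableT_comp (@measurable_expR R) m1).
exists (expR c * expR ((c + 2%:R) ^+ 2 / (4 * t))) => l.
rewrite Normc.normcM normc_real ger0_norm ?expR_ge0 //.
apply: (le_trans (ler_wpM2l (expR_ge0 _) (Fc l))).
have := @gauss_le_cauchy_weight R 0 t c l t0; rewrite expr0 mul1r => H.
rewrite -mulrA; apply: le_trans (ler_wpM2l (expR_ge0 c) H).
by rewrite -!expRD ler_expR; lra.
Qed.

End ExponentialType.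

(** * One coordinate of the heat integrand against a ground state *)

Section TwistedGaussian.
Context {R : realType}.
Implicit Types (t l x : R) (p q : R[i]).

(* One coordinate of the heat kernel integrand times the ground state [exp (- l x^2 / 4)]; [(p, q)] is [(z_j, w_j)] or [(w_j, - z_j)]. *)
Definition twist t p q l x : R[i] :=
  cexp (- (l / 4)%:C%C * x%:C%C ^+ 2 + 'i%C * (l / 2)%:C%C * x%:C%C * q
        - (l / 4 * cothR (t * l))%:C%C * (p - x%:C%C) ^+ 2).

(** Rate and complex centre come from completing the square in the exponent of [twist], as [twistE]
    records. *)
Definition twist_rate t l : R := l * (1 + cothR (t * l)) / 4.
Definition twist_center t l p q : R[i] := ('i%C * q + (cothR (t * l))%:C%C * p) / (1 + cothR (t * l))%:C%C.

Lemma twist_rate_gt0 t l : 0 < t -> 0 < l -> 0 < twist_rate t l.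
Proof.
move=> t0 l0; rewrite divr_gt0 // mulr_gt0 // addr_gt0 //.
by apply: lt_trans (cothR_gt1 _); rewrite // mulr_gt0.
Qed.

Lemma twistE t p q l x : 0 < t -> 0 < l ->
  twist t p q l x = gaussian (twist_rate t l) (twist_center t l p q) x *
    cexp ((twist_rate t l)%:C%C * twist_center t l p q ^+ 2 - (l / 4 * cothR (t * l))%:C%C * p ^+ 2).
Proof.
move=> t0 l0; rewrite /twist /gaussian -cexpD /twist_rate /twist_center.
have tl : 0 < t * l by rewrite mulr_gt0.
have c1 : 1 + cothR (t * l) != 0.
  by rewrite gt_eqF // addr_gt0 // (lt_trans _ (cothR_gt1 tl)).
move: (cothR _) c1 => c c1; congr cexp.
have cc : (1 + c)%:C%C != 0 :> R[i] by rewrite fmorph_eq0.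
rewrite !(real_complexM, real_complexV, real_complex_nat) real_complexD rmorph1 in cc *.
move: (l%:C%C) (c%:C%C) (x%:C%C) ('i%C : R[i]) cc => L C X I cc.
by field.
Qed.

(** For the conjugate pair the cross terms in p q cancel, and with C = coth (t l) there remains (C^2
    - 1) / (C + 1) - C = - 1. So the planar Gaussian reproduces the ground state. *)
Lemma twist_pair t l p q : 0 < t -> 0 < l ->
  (twist_rate t l)%:C%C * twist_center t l p q ^+ 2 - (l / 4 * cothR (t * l))%:C%C * p ^+ 2 +
  ((twist_rate t l)%:C%C * twist_center t l q (- p) ^+ 2 - (l / 4 * cothR (t * l))%:C%C * q ^+ 2)
  = - (l / 4)%:C%C * (p ^+ 2 + q ^+ 2).
Proof.
move=> t0 l0; rewrite /twist_rate /twist_center.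
have tl : 0 < t * l by rewrite mulr_gt0.
have c1 : 1 + cothR (t * l) != 0.
  by rewrite gt_eqF // addr_gt0 // (lt_trans _ (cothR_gt1 tl)).
move: (cothR _) c1 => c c1.
have cc : (1 + c)%:C%C != 0 :> R[i] by rewrite fmorph_eq0.
rewrite !(real_complexM, real_complexV, real_complex_nat) real_complexD rmorph1 in cc *.
have I2 : ('i%C : R[i]) ^+ 2 = -1 by exact: sqr_i.
move: (l%:C%C) (c%:C%C) ('i%C : R[i]) cc I2 => L C I cc I2.
transitivity (L / 4 * (I ^+ 2 * (p ^+ 2 + q ^+ 2) - C * (p ^+ 2 + q ^+ 2)) / (1 + C)); first by field.
by rewrite I2; field.
Qed.

(** The factor is (C - 1) / (C + 1) with C = coth (t l). With + i in place of - i the centres would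
    combine to p + i q with no factor, and the dependence on m that drives the proof would be
    lost. *)
Lemma twist_center_antiholomorphic t l p q : 0 < t -> 0 < l ->
  twist_center t l p q - 'i%C * twist_center t l q (- p) = (expR (- (2 * (t * l))))%:C%C * (p - 'i%C * q).
Proof.
move=> t0 l0; rewrite /twist_center.
have tl : 0 < t * l by rewrite mulr_gt0.
have c1 : 1 + cothR (t * l) != 0.
  by rewrite gt_eqF // addr_gt0 // (lt_trans _ (cothR_gt1 tl)).
have r := cothR_ratio tl.
move: (cothR _) c1 r => c c1 r.
have cc : (1 + c)%:C%C != 0 :> R[i] by rewrite fmorph_eq0.
have {}r : (expR (- (2 * (t * l))))%:C%C = (c%:C%C - 1) / (1 + c%:C%C) :> R[i].
  have := congr1 (fun x : R => x%:C%C : R[i]) r.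
  rewrite real_complexM !real_complexD real_complexN rmorph1 => ->.
  rewrite real_complexD rmorph1 in cc; by rewrite [c%:C%C + 1]addrC mulfK.
rewrite r {r}; rewrite real_complexD rmorph1 in cc *.
have I2 : ('i%C : R[i]) ^+ 2 = -1 by exact: sqr_i.
move: (c%:C%C) ('i%C : R[i]) cc I2 => C I cc I2.
transitivity ((I * q + C * p + I ^+ 2 * p - I * C * q) / (1 + C)); first by field.
by rewrite I2; field.
Qed.

(** The decay in x is taken from exp (- l x^2 / 4), so [l] must stay away from 0; half of that
    exponent absorbs the linear term in x. *)
Lemma twist_weight_bound k t a p q : 0 < t -> 0 < a ->
  exists c : R, forall l x, a <= l ->
    nc (x%:C%C ^+ k * twist t p q l x) <= expR (c * (1 + `|l|)) * cauchy_weight x.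
Proof.
move=> t0 a0; pose K := expR ((0 + k.+2%:R) ^+ 2 / (4 * (a / 8))).
pose c1 := nc q ^+ 2 / 2 + complex.Im p ^+ 2 / 4 * (1 + t^-1).
exists (c1 + K) => l x al; have l0 : 0 < l by exact: lt_le_trans al.
have /andP[k0 k1] := mulr_cothR_bounds l t0; rewrite (ger0_norm (ltW l0)) in k1 *.
rewrite Normc.normcM normcX normc_real /twist normc_cexp.
set E := complex.Re _.
have EE : E = - (l / 4) * x ^+ 2 - l / 2 * x * complex.Im q
   - (l * cothR (t * l)) / 4 * ((complex.Re p - x) ^+ 2 - complex.Im p ^+ 2).
  rewrite /E !expr2 !ReImE /=; ring.
have ti : 0 < t^-1 by rewrite invr_gt0.
have q1 : - (x * complex.Im q) <= `|x| * nc q.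
  by rewrite (le_trans (ler_norm _)) // normrN normrM ler_wpM2l // ler_Im_normc.
have xx : x ^+ 2 = `|x| ^+ 2 by rewrite -normrX ger0_norm ?sqr_ge0.
have Eb : E <= c1 * (1 + l) + (- (a / 8) * x ^+ 2 + 0 * `|x|).
  rewrite EE mul0r addr0.
  have s1 := sqr_ge0 (complex.Re p - x); have s2 := sqr_ge0 (complex.Im p).
  have s3 : 0 <= l * cothR (t * l) / 4 * (complex.Re p - x) ^+ 2.
    by rewrite mulr_ge0 // divr_ge0.
  have s4 : l * cothR (t * l) / 4 * complex.Im p ^+ 2 <= (l + t^-1) / 4 * complex.Im p ^+ 2.
    by rewrite ler_wpM2r // ler_wpM2r.
  have s5 : (a / 8) * x ^+ 2 <= (l / 8) * x ^+ 2 by rewrite ler_wpM2r ?sqr_ge0 // ler_wpM2r.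
  have s6 : l * (- (x * complex.Im q)) <= l * (`|x| * nc q) by rewrite ler_wpM2l // ltW.
  have s7 : 0 <= l * (`|x| / 2 - nc q) ^+ 2 by rewrite mulr_ge0 ?sqr_ge0 // ltW.
  have s8 : 0 <= complex.Im p ^+ 2 * (1 + l * t^-1).
    by rewrite mulr_ge0 // addr_ge0 // mulr_ge0 // ltW.
  have s9 := sqr_ge0 (nc q).
  rewrite xx in s5 *; rewrite /c1.
  move: s3 s4 s5 s6 s7 s8 s9; move: (cothR _) (complex.Re p) (complex.Im p) (complex.Im q) (nc q) (t^-1) `|x|.
  clear => *; nra.
apply: (@le_trans _ _ (`|x| ^+ k * (expR (c1 * (1 + l)) * expR (- (a / 8) * x ^+ 2 + 0 * `|x|)))).
  by rewrite ler_wpM2l ?exprn_ge0 // -expRD ler_expR.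
have a8 : 0 < a / 8 by rewrite divr_gt0.
rewrite [leLHS]mulrCA [(c1 + K) * _]mulrDl (expRD (c1 * _)) -[leRHS]mulrA; apply: ler_wpM2l; first exact: expR_ge0.
apply: (le_trans (gauss_le_cauchy_weight k 0 x a8)).
rewrite ler_wpM2r ?(ltW (cauchy_weight_gt0 x)) // -/K.
have K0 : 0 <= K by exact: expR_ge0.
apply: (@le_trans _ _ (1 + K * (1 + l))); last exact: expR_ge1Dx.
nra.
Qed.

End TwistedGaussian.

(** * Translation invariance of the integral on the line *)

Section Translation.
Context {R : realType}.
Local Notation mu := (@lebesgue_measure R).

(** Lebesgue measure is determined by its values on half-open intervals, hence equals its image
    under a translation. *)
Lemma integral_translate (c : R) (f : R -> \bar R) : measurable_fun [set: R] f ->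
  (\int[mu]_x f (x + c)%R = \int[mu]_x f x)%E.
Proof.
move=> mf.
have ms : measurable_fun [set: measurableTypeR R] (fun x : measurableTypeR R => (x + c : measurableTypeR R)).
  by apply: measurable_funD => //; exact: measurable_cst.
have HU A : measurable A -> mu A = pushforward mu (fun x : measurableTypeR R => (x + c : measurableTypeR R)) A.
  move=> mA; apply: lebesgue_measure_unique => // X [[a b]] /= _ <-.
  rewrite /pushforward (_ : _ @^-1` _ = `](a - c), (b - c)]%classic); last first.
    by apply/seteqP; split => x /=; rewrite !in_itv /= ltrBlDr lerBrDr.
  rewrite !lebesgue_measure_itv /= !lte_fin ltrD2r; case: ifP => // _.
  by rewrite -!EFinD; congr EFin; ring.
have ge0E (g : R -> \bar R) : measurable_fun [set: R] g -> (forall x, 0 <= g x)%E ->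
    (\int[mu]_x g (x + c)%R = \int[mu]_x g x)%E.
  move=> mg g0.
  rewrite [RHS](eq_measure_integral (pushforward mu (fun x : measurableTypeR R => (x + c : measurableTypeR R)))).
    by rewrite ge0_integral_pushforward // preimage_setT.
  by move=> A mA _; exact: HU.
rewrite integralE [RHS]integralE.
have Ep : (fun x => f (x + c)%R)^\+%E = (fun x => f^\+%E (x + c)%R).
  exact: (funepos_comp f (fun x => x + c)%R).
have En : (fun x => f (x + c)%R)^\-%E = (fun x => f^\-%E (x + c)%R).
  exact: (funeneg_comp f (fun x => x + c)%R).
rewrite Ep En (ge0E f^\+%E) ?(ge0E f^\-%E) //.
- exact: measurable_funeneg.
- exact: measurable_funepos.
Qed.

Lemma cint1_translate (c : R) (F : R -> R[i]) : cmeasurable F ->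
  cint1 (fun x => F (x + c)) = cint1 F.
Proof.
move=> [mR mI]; apply: eq_ReIm; rewrite /cint1 /Rintegral /=; congr fine.
  exact: (@integral_translate c (fun x => (complex.Re (F x))%:E) ((measurable_EFinP _ _).2 mR)).
exact: (@integral_translate c (fun x => (complex.Im (F x))%:E) ((measurable_EFinP _ _).2 mI)).
Qed.

End Translation.

(** * Integrals of products over the coordinates *)

Section ProductIntegrals.
Context {R : realType}.
Local Notation w := (@cauchy_weight R).

Lemma citer_prod k (h : 'I_k -> R -> R[i]) : (forall j, tame (h j)) ->
  citer (fun s => \prod_j h j (tnth s j)) (\prod_j cint1 (h j)).
Proof.
elim: k h => [|k IH] h th; first by rewrite /= !big_ord0.
exists (fun x => (\prod_(j < k) cint1 (h (lift ord0 j))) * h ord0 x).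
  split; first exact: tameZ.
  by rewrite cint1Z // big_ord_recl mulrC.
move=> x; apply: eq_citer (citerZ (h ord0 x) (IH (fun j => h (lift ord0 j)) _)) => //.
  move=> s; rewrite big_ord_recl tnth0; congr (_ * _).
  by apply: eq_bigr => j _; rewrite tnthS.
by rewrite mulrC.
Qed.

(** Companion of [citer_cint1_prod]: tameness of its value as a function of the frequency lets sums
    over monomials enter the frequency integral. *)
Lemma tame_cint1_prod k (a : R -> R[i]) (h : 'I_k -> R * R -> R[i]) (M : 'I_k -> R -> R) (K : R) :
  cmeasurable a -> (forall j, cmeasurable (h j)) ->
  (forall j l, 0 <= M j l) ->
  (forall l, a l != 0 -> forall j x, nc (h j (l, x)) <= M j l * w x) ->
  (forall l, nc (a l) * \prod_j M j l <= K * w l) ->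
  tame (fun l => a l * \prod_j cint1 (fun x => h j (l, x))).
Proof.
move=> ma mh M0 hM aK; split.
  apply: cmeasurableM => //; apply: cmeasurable_prod => j; exact: cmeasurable_cint1.
exists ((2 * pi) ^+ k * K) => l.
have p0 : 0 <= (2 * pi : R) ^+ k by rewrite exprn_ge0 // mulr_ge0 // pi_ge0.
rewrite -mulrA; apply: le_trans (ler_wpM2l p0 (aK l)).
have [->|al] := eqVneq (a l) 0; first by rewrite !mul0r Normc.normc0 !mul0r mulr0.
rewrite Normc.normcM normc_prod mulrCA ler_wpM2l ?normc_ge0 //.
have -> : (2 * pi) ^+ k = \prod_(j < k) (2 * pi : R) by rewrite prodr_const card_ord.
rewrite -big_split; apply: ler_prod => j _; apply/andP; split; first exact: normc_ge0.
change (nc (cint1 (fun x => h j (l, x))) <= 2 * pi * M j l).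
have -> : (2 * pi) * M j l = 2 * M j l * pi by ring.
apply: normc_cint1_le; last by move=> y; exact: hM.
exact: (cmeasurable_comp (measurable_pair1 l) (mh j)).
Qed.

End ProductIntegrals.

(** * The integral over the central variable *)

Section PoleKernel.
Context {R : realType}.
Implicit Types (l rho x : R).
Local Notation w := (@cauchy_weight R).

Definition ipole l x : R[i] := cexp ('i%C * l%:C%C * x%:C%C).

Lemma ipoleE l x : ipole l x = cexp (0 +i* (l * x))%C.
Proof. by rewrite /ipole; congr cexp; apply: eq_ReIm; rewrite /=; ring. Qed.

Lemma normc_ipole l x : nc (ipole l x) = 1.
Proof. by rewrite ipoleE normc_cexp /= expR0. Qed.

(** This is exp (- l S) / (2 + S)^2 at S = rho + i x. The shift by 2 keeps the line of integration
    at abscissa at least 2, uniformly in rho >= 0. *)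
Definition bergman_factor l rho x : R[i] :=
  cexp (- l%:C%C * (rho +i* x)%C) * (((2 + rho) +i* x)%C^-1) ^+ 2.

(** Against the character of frequency [lam], the factor becomes a pole integrand of parameter lam -
    l on the line of abscissa 2 + rho; what remains contains exp (- lam rho), the ground state at
    frequency [lam]. *)
Lemma bergman_factor_pole l rho lam x : bergman_factor l rho x * ipole lam x =
  (expR (- (2 * (lam - l))) * expR (- (lam * rho)))%:C%C * pole (lam - l) (2 + rho) x.
Proof.
rewrite /bergman_factor /pole mulrAC mulrA -expRD -cexp_real -!cexpD; congr (cexp _ * _).
by apply: eq_ReIm; rewrite !ReImE /=; ring.
Qed.

Lemma normc_bergman_factor l rho x : 0 <= rho ->
  nc (bergman_factor l rho x) <= expR (- (l * rho)) * w x.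
Proof.
move=> r0; rewrite /bergman_factor Normc.normcM normc_cexp.
have -> : complex.Re (- l%:C%C * (rho +i* x)%C) = - (l * rho) by rewrite !ReImE /=; ring.
rewrite ler_wpM2l ?expR_ge0 //.
have a1 : 1 <= 2 + rho by lra.
by have := pole_weight_bound1 0 x a1; rewrite /pole mul0r cexp0 !mul0r expR0 !mul1r.
Qed.

Lemma cmeasurable_line (a : R) : cmeasurable (fun x : R => (a +i* x)%C).
Proof. by split => /=; [exact: measurable_cst|exact: measurable_id]. Qed.

(** Fubini puts the x-integral inside; it yields the spectral density exp (- 2 (lam - l))
    [pole_mass (lam - l)], which vanishes for lam < l and no longer depends on rho. *)
Lemma pole_kernel_integral l rho (Q : R -> R[i]) : 0 <= rho -> tame Q ->
  tame (fun x => bergman_factor l rho x * cint1 (fun lam => ipole lam x * Q lam)) /\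
  cint1 (fun x => bergman_factor l rho x * cint1 (fun lam => ipole lam x * Q lam)) =
  cint1 (fun lam => (expR (- (2 * (lam - l))))%:C%C * pole_mass (lam - l) *
                    ((expR (- (lam * rho)))%:C%C * Q lam)).
Proof.
move=> r0 tQ; have [mQ [K QK]] := tQ.
pose G (z : R * R) := bergman_factor l rho z.1 * ipole z.2 z.1 * Q z.2.
have mR2 : measurable_fun [set: R * R] (fst : R * R -> R) by exact: measurable_fst.
have mS2 : measurable_fun [set: R * R] (snd : R * R -> R) by exact: measurable_snd.
have mG : cmeasurable G.
  apply: cmeasurableM; last exact: (cmeasurable_comp mS2 mQ).
  apply: cmeasurableM.
    apply: (cmeasurable_comp (F := bergman_factor l rho) mR2).
    apply: cmeasurableM.
      apply: cmeasurable_cexp; apply: cmeasurableM; first exact: cmeasurable_cst.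
      exact: cmeasurable_line.
    by apply: cmeasurableX; apply: cmeasurable_inv; exact: cmeasurable_line.
  apply: cmeasurable_cexp; apply: cmeasurableM; last exact: cmeasurable_real.
  by apply: cmeasurableM; [exact: cmeasurable_cst|exact: cmeasurable_real].
have K0 : 0 <= K.
  by have := le_trans (normc_ge0 _) (QK 0); rewrite pmulr_lge0 ?cauchy_weight_gt0.
have GK x lam : nc (G (x, lam)) <= (expR (- (l * rho)) * K) * w x * w lam.
  rewrite /G (Normc.normcM _ (Q lam)) (Normc.normcM (bergman_factor l rho x)) normc_ipole mulr1.
  have -> : expR (- (l * rho)) * K * w x * w lam = expR (- (l * rho)) * w x * (K * w lam) by ring.
  by apply: ler_pM; rewrite ?normc_ge0 // normc_bergman_factor.
have tI x : tame (fun lam => ipole lam x * Q lam).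
  split.
    apply: cmeasurableM => //; apply: cmeasurable_cexp; apply: cmeasurableM; last exact: cmeasurable_cst.
    by apply: cmeasurableM; [exact: cmeasurable_cst|apply: cmeasurable_real; exact: measurable_id].
  by exists K => lam; rewrite Normc.normcM normc_ipole mul1r.
have E x : bergman_factor l rho x * cint1 (fun lam => ipole lam x * Q lam) = cint1 (fun lam => G (x, lam)).
  by rewrite -cint1Z //; apply: eq_cint1 => lam; rewrite mulrA.
split; first by under eq_fun do rewrite E; exact: tame_cint1 mG GK.
under eq_fun do rewrite E.
rewrite (cint1_swap mG GK); apply: eq_cint1 => lam.
have a0 : 0 < 2 + rho by lra.
rewrite -(cint1_pole (lam - l) a0) mulrA.
transitivity (cint1 (fun x => ((expR (- (2 * (lam - l))) * expR (- (lam * rho)))%:C%C * Q lam) * pole (lam - l) (2 + rho) x)).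
  by apply: eq_cint1 => x; rewrite /G /= bergman_factor_pole mulrAC.
rewrite cint1Z; last first.
  split; first by apply: is_cderive_cmeasurable => x; eexists; exact: pole_derive.
  by eexists => x; exact: pole_weight_bound.
by rewrite real_complexM; ring.
Qed.

End PoleKernel.

(** * Growth and measurability of the factors of the heat integrand *)

Section HeatFactors.
Context {R : realType}.
Implicit Types (t l : R) (F : R -> R[i]).

Lemma measurable_sinhR d (T : measurableType d) (f : T -> R) : measurable_fun [set: T] f ->
  measurable_fun [set: T] (fun x => sinhR (f x)) /\ measurable_fun [set: T] (fun x => coshR (f x)).
Proof.
move=> mf.
have m1 : measurable_fun [set: T] (fun x => expR (f x)) by exact: (measurableT_comp (@measurable_expR R) mf).
have m2 : measurable_fun [set: T] (fun x => expR (- f x)).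
  exact: (measurableT_comp (@measurable_expR R) (measurable_funN mf)).
by split; (apply: measurable_funM; last exact: measurable_cst);
  [apply: measurable_funB|apply: measurable_funD].
Qed.

Lemma measurable_div_sinhR d (T : measurableType d) t (f : T -> R) : measurable_fun [set: T] f ->
  measurable_fun [set: T] (fun x => f x / sinhR (t * f x)).
Proof.
move=> mf; have mt : measurable_fun [set: T] (fun x => t * f x) by apply: measurable_funM.
have [m1 _] := measurable_sinhR mt.
by apply: measurable_funM => //; exact: measurable_invr.
Qed.

Lemma measurable_mulr_cothR d (T : measurableType d) t (f : T -> R) : measurable_fun [set: T] f ->
  measurable_fun [set: T] (fun x => f x / 4 * cothR (t * f x)).
Proof.
move=> mf; have mt : measurable_fun [set: T] (fun x => t * f x) by apply: measurable_funM.
have [m1 m2] := measurable_sinhR mt.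
apply: measurable_funM; first by apply: measurable_funM => //; exact: measurable_cst.
by apply: measurable_funM => //; exact: measurable_invr.
Qed.

Lemma cmeasurable_twist d (T : measurableType d) t p q (f g : T -> R) :
  measurable_fun [set: T] f -> measurable_fun [set: T] g ->
  cmeasurable (fun z => twist t p q (f z) (g z)).
Proof.
move=> mf mg; have mC c : measurable_fun [set: T] (fun=> c : R) by exact: measurable_cst.
apply: cmeasurable_cexp; apply: cmeasurableD.
  apply: cmeasurableD.
    apply: cmeasurableM; last by apply: cmeasurableX; exact: cmeasurable_real.
    by apply: cmeasurableN; apply: cmeasurable_real; apply: measurable_funM.
  apply: cmeasurableM; last exact: cmeasurable_cst.
  apply: cmeasurableM; last exact: cmeasurable_real.
  apply: cmeasurableM; first exact: cmeasurable_cst.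
  by apply: cmeasurable_real; apply: measurable_funM.
apply: cmeasurableN; apply: cmeasurableM.
  by apply: cmeasurable_real; exact: measurable_mulr_cothR.
apply: cmeasurableX; apply: cmeasurableD; first exact: cmeasurable_cst.
by apply: cmeasurableN; exact: cmeasurable_real.
Qed.

Lemma cmeasurable_pole_mass : cmeasurable (@pole_mass R).
Proof.
apply: (@cmeasurable_cint1 _ _ _ (fun z : R * R => pole z.1 1 z.2)).
have m1 : measurable_fun [set: R * R] (fst : R * R -> R) by exact: measurable_fst.
have m2 : measurable_fun [set: R * R] (snd : R * R -> R) by exact: measurable_snd.
have mL := cmeasurable_comp m2 (cmeasurable_line (1 : R)).
apply: cmeasurableM; last by apply: cmeasurableX; exact: cmeasurable_inv.
apply: cmeasurable_cexp; apply: cmeasurableM => //; exact: cmeasurable_real.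
Qed.

Lemma exp_type_pole_mass l : exp_type (fun lam => pole_mass (lam - l)).
Proof.
have [c Hc] := exp_type_cst ((2 * pi : R)%:C%C).
exists (c + (1 + `|l|)) => lam.
apply: (@le_trans _ _ (2 * expR (lam - l) * pi)).
  apply: normc_cint1_le.
    by apply: is_cderive_cmeasurable => x; eexists; exact: pole_derive.
  by move=> x; have := pole_weight_bound1 (lam - l) x (lexx 1); rewrite mulr1.
have := Hc lam; rewrite normc_real ger0_norm ?mulr_ge0 ?pi_ge0 // => H.
have -> : 2 * expR (lam - l) * pi = (2 * pi) * expR (lam - l) by ring.
rewrite [leRHS](_ : _ = expR (c * (1 + `|lam|)) * expR ((1 + `|l|) * (1 + `|lam|))); last first.
  by rewrite -expRD -mulrDl.
apply: ler_pM; rewrite ?expR_ge0 ?mulr_ge0 ?pi_ge0 //.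
rewrite ler_expR; have := ler_norm lam; have := ler_norm (- l); rewrite normrN.
have := normr_ge0 lam; have := normr_ge0 l; nra.
Qed.

Lemma exp_type_expR (c d : R) : exp_type (fun lam => (expR (c + d * lam))%:C%C).
Proof.
apply: exp_type_real; exists (`|c| + `|d|) => lam; rewrite ger0_norm ?expR_ge0 // ler_expR.
have h : d * lam <= `|d| * `|lam| by rewrite (le_trans (ler_norm _)) // normrM.
have := ler_norm c; have := normr_ge0 c; have := normr_ge0 d; have := normr_ge0 lam; nra.
Qed.

Lemma exp_type_linear_cexp (v : R[i]) : exp_type (fun lam => cexp (lam%:C%C * v)).
Proof.
apply: (exp_type_cexp (c := 0) (d := nc v)) => // [|lam]; first exact: normc_ge0.
rewrite add0r ReM /= mul0r subr0 (le_trans (ler_norm _)) // normrM mulrC.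
by rewrite ler_wpM2r // ler_Re_normc.
Qed.

Lemma exp_type_coth_cexp t (v : R[i]) : 0 < t ->
  exp_type (fun lam => cexp (- ((lam / 4 * cothR (t * lam))%:C%C * v))).
Proof.
move=> t0; have ti : 0 <= t^-1 by rewrite invr_ge0 ltW.
apply: (exp_type_cexp (c := t^-1 * nc v) (d := nc v)) => [||lam]; rewrite ?mulr_ge0 ?normc_ge0 //.
have /andP[k0 k1] := mulr_cothR_bounds lam t0.
rewrite ReN ReM /= mul0r subr0 (le_trans (ler_norm _)) // normrN normrM mulrAC.
have -> : `|lam * cothR (t * lam) / 4| = lam * cothR (t * lam) / 4 by rewrite ger0_norm // divr_ge0.
have v1 := ler_Re_normc v; have v0 := normr_ge0 (complex.Re v).
apply: (@le_trans _ _ ((`|lam| + t^-1) * nc v)); last by rewrite mulrDl addrC [nc v * _]mulrC.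
apply: ler_pM => //; first by rewrite divr_ge0.
by rewrite ler_pdivrMr //; have := normr_ge0 lam; lra.
Qed.

Lemma exp_type_div_sinhR t k : 0 < t -> exp_type (fun lam => ((lam / sinhR (t * lam)) ^+ k)%:C%C).
Proof.
move=> t0; under eq_fun do rewrite real_complexX; apply: exp_typeX; apply: exp_type_real.
have [c Hc] := exp_type_cst ((t^-1)%:C%C).
exists (c + t) => lam; apply: (le_trans (normr_div_sinhR lam t0)).
rewrite [leRHS](_ : _ = expR (c * (1 + `|lam|)) * expR (t * (1 + `|lam|))); last first.
  by rewrite -expRD -mulrDl.
have ti : 0 <= t^-1 by rewrite invr_ge0 ltW.
apply: ler_pM; rewrite ?expR_ge0 //.
  by have := Hc lam; rewrite normc_real ger0_norm.
by rewrite ler_expR ler_pM2l //; lra.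
Qed.

End HeatFactors.

(** * The heat integrand at a translated point *)

Section HeatTransform.
Context {R : realType}.
Variables (n : nat) (t : R).
Hypothesis t0 : 0 < t.
Local Notation N := n.+1.
Implicit Types (x u : 'I_N -> R) (z w : 'I_N -> R[i]) (zeta : R[i]) (m : nat) (l : R).

Definition htest m l (h : Hpt R N) : R[i] :=
  let: (x, u, xi) := h in
  ((x ord0)%:C%C - 'i%C * (u ord0)%:C%C) ^+ m *
  bergman_factor l ((\sum_j (x j ^+ 2 + u j ^+ 2)) / 4) xi.

(** What is left of the heat integrand at h^(-1) g once the xi-dependence and the Gaussian in the
    frequency are split off. *)
Definition kernel_slice x u z w zeta l : R[i] :=
  cexp (- ('i%C * l%:C%C * (zeta + (1 / 2)%:C%C * (\sum_j (u j)%:C%C * z j - \sum_j (x j)%:C%C * w j)))) *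
  ((l / sinhR (t * l)) ^+ N)%:C%C *
  cexp (- ((l / 4 * cothR (t * l))%:C%C * \sum_j ((z j - (x j)%:C%C) ^+ 2 + (w j - (u j)%:C%C) ^+ 2))).

Lemma heat_integrandE x u xi z w zeta l :
  heat_integrand t (mulHC (embH (invH (x, u, xi))) (z, w, zeta)) l =
  ipole l xi * ((expR (- (t * l ^+ 2)))%:C%C * kernel_slice x u z w zeta l).
Proof.
rewrite /heat_integrand /mulHC /embH /invH /kernel_slice /ipole /cdot.
have -> : \sum_j (- x j)%:C%C * w j = - \sum_j (x j)%:C%C * w j.
  by rewrite -sumrN; apply: eq_bigr => j _; rewrite real_complexN mulNr.
have -> : \sum_j (- u j)%:C%C * z j = - \sum_j (u j)%:C%C * z j.
  by rewrite -sumrN; apply: eq_bigr => j _; rewrite real_complexN mulNr.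
rewrite -big_split /=.
have -> : \sum_(i < N) (((- x i)%:C%C + z i) * ((- x i)%:C%C + z i) + ((- u i)%:C%C + w i) * ((- u i)%:C%C + w i)) =
  \sum_j ((z j - (x j)%:C%C) ^+ 2 + (w j - (u j)%:C%C) ^+ 2).
  by apply: eq_bigr => j _; rewrite !real_complexN; ring.
set S1 := \sum_j _ * w j; set S2 := \sum_j _ * z j.
have -> : - ('i%C * l%:C%C * ((- xi)%:C%C + zeta + (1 / 2)%:C%C * (- S1 - - S2))) =
  'i%C * l%:C%C * xi%:C%C + - ('i%C * l%:C%C * (zeta + (1 / 2)%:C%C * (S2 - S1))).
  by rewrite real_complexN; move: ('i%C : R[i]) ((1 / 2)%:C%C) => I c; ring.
by rewrite cexpD !mulrA; congr (_ * _ * _); rewrite mulrAC.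
Qed.

(** The symplectic term contributes (i l / 2) (x_j w_j - u_j z_j) to coordinate j, whence the
    argument [- z j] in the second product. *)
Lemma kernel_slice_twist x u z w zeta l :
  (expR (- (l * ((\sum_j (x j ^+ 2 + u j ^+ 2)) / 4))))%:C%C * kernel_slice x u z w zeta l =
  cexp (- ('i%C * l%:C%C * zeta)) * ((l / sinhR (t * l)) ^+ N)%:C%C *
  (\prod_j twist t (z j) (w j) l (x j) * \prod_j twist t (w j) (- z j) l (u j)).
Proof.
rewrite /kernel_slice /twist -!cexp_sum -cexp_real.
transitivity (((l / sinhR (t * l)) ^+ N)%:C%C * (cexp ((- (l * ((\sum_j (x j ^+ 2 + u j ^+ 2)) / 4)))%:C%C) *
  (cexp (- ('i%C * l%:C%C * (zeta + (1 / 2)%:C%C * (\sum_j (u j)%:C%C * z j - \sum_j (x j)%:C%C * w j)))) *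
   cexp (- ((l / 4 * cothR (t * l))%:C%C * \sum_j ((z j - (x j)%:C%C) ^+ 2 + (w j - (u j)%:C%C) ^+ 2)))))).
  by rewrite !mulrA; congr (_ * _); rewrite -!mulrA [RHS]mulrCA; congr (_ * _); rewrite mulrC.
rewrite [RHS]mulrAC mulrC -!cexpD; congr (cexp _ * _).
rewrite -big_split /=.
have -> : (- (l * ((\sum_j (x j ^+ 2 + u j ^+ 2)) / 4)))%:C%C =
    \sum_j (- (l / 4)%:C%C * ((x j)%:C%C ^+ 2 + (u j)%:C%C ^+ 2)) :> R[i].
  have E (X : R) : - (l * (X / 4)) = - (l / 4) * X by ring.
  rewrite -mulr_sumr E (real_complexM (- (l / 4))) (real_complexN (l / 4)); congr (_ * _).
  by rewrite rmorph_sum; apply: eq_bigr => j _; rewrite -!real_complexX -real_complexD.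
rewrite -sumrB mulrDr opprD !mulr_sumr -sumrN -sumrN.
rewrite [LHS]addrC -!addrA; congr (_ + _); rewrite -!big_split; apply: eq_bigr => j _ /=.
move: (cothR _) => c; rewrite !(real_complexM, real_complexV, real_complex_nat, rmorph1).
by move: ('i%C : R[i]) (c%:C%C) (l%:C%C) => I C L; field.
Qed.

Lemma exp_type_kernel_slice x u z w zeta : exp_type (kernel_slice x u z w zeta).
Proof.
apply: exp_typeM; last exact: exp_type_coth_cexp.
apply: exp_typeM; last exact: exp_type_div_sinhR.
set v := zeta + _.
have E lam : - ('i%C * lam%:C%C * v) = lam%:C%C * (- 'i%C * v).
  by move: ('i%C : R[i]) => I; ring.
by under eq_fun do rewrite E; exact: exp_type_linear_cexp.
Qed.

Lemma cmeasurable_kernel_slice x u z w zeta : cmeasurable (kernel_slice x u z w zeta).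
Proof.
have mi : measurable_fun [set: R] (id : R -> R) by exact: measurable_id.
apply: cmeasurableM.
  apply: cmeasurableM.
    apply: cmeasurable_cexp; apply: cmeasurableN; apply: cmeasurableM; last exact: cmeasurable_cst.
    by apply: cmeasurableM; [exact: cmeasurable_cst|exact: cmeasurable_real].
  by apply: cmeasurable_real; apply: measurable_funX; exact: (measurable_div_sinhR t mi).
apply: cmeasurable_cexp; apply: cmeasurableN; apply: cmeasurableM; last exact: cmeasurable_cst.
by apply: cmeasurable_real; exact: (measurable_mulr_cothR t mi).
Qed.

End HeatTransform.

(** * Reduction of the heat transform to a frequency integral *)

Section HeatTransformOfTestFunction.
Context {R : realType}.
Variables (n : nat) (t : R).
Hypothesis t0 : 0 < t.
Local Notation N := n.+1.
Local Notation w := (@cauchy_weight R).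
Variables (z v : 'I_N -> R[i]) (zeta : R[i]).
Implicit Types (m k : nat) (l lam : R).

(** Writes a power of the first coordinate as a product over all coordinates, so that every
    coordinate integral has the same shape. *)
Definition mono_exp k (j : 'I_N) : nat := if j == ord0 then k else 0%N.

Lemma prod_mono_exp (S : comPzRingType) (y : 'I_N -> S) k : \prod_j (y j) ^+ mono_exp k j = y ord0 ^+ k.
Proof. by rewrite big_ord_recl /mono_exp eqxx big1 ?mulr1. Qed.

Definition slice_factor k k' (j : 'I_(N + N)) (lx : R * R) : R[i] :=
  match fintype.split j with
  | inl i => lx.2%:C%C ^+ mono_exp k i * twist t (z i) (v i) lx.1 lx.2
  | inr i => lx.2%:C%C ^+ mono_exp k' i * twist t (v i) (- z i) lx.1 lx.2
  end.

Lemma slice_factorl k k' i lx : slice_factor k k' (lshift N i) lx =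
  lx.2%:C%C ^+ mono_exp k i * twist t (z i) (v i) lx.1 lx.2.
Proof. by rewrite /slice_factor (unsplitK (inl i)). Qed.

Lemma slice_factorr k k' i lx : slice_factor k k' (rshift N i) lx =
  lx.2%:C%C ^+ mono_exp k' i * twist t (v i) (- z i) lx.1 lx.2.
Proof. by rewrite /slice_factor (unsplitK (inr i)). Qed.

Lemma prod_slice_factor k k' l (s : (N + N).-tuple R) :
  \prod_j slice_factor k k' j (l, tnth s j) =
  (tnth s (lshift N ord0))%:C%C ^+ k * (tnth s (rshift N ord0))%:C%C ^+ k' *
  (\prod_j twist t (z j) (v j) l (tnth s (lshift N j)) *
   \prod_j twist t (v j) (- z j) l (tnth s (rshift N j))).
Proof.
rewrite big_split_ord /=; under eq_bigr do rewrite slice_factorl.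
under [X in _ * X]eq_bigr do rewrite slice_factorr.
rewrite !big_split /= (prod_mono_exp (fun j => (tnth s (lshift N j))%:C%C)).
by rewrite (prod_mono_exp (fun j => (tnth s (rshift N j))%:C%C)) mulrACA.
Qed.

Lemma cmeasurable_slice_factor k k' j : cmeasurable (slice_factor k k' j).
Proof.
have m1 : measurable_fun [set: R * R] (fst : R * R -> R) by exact: measurable_fst.
have m2 : measurable_fun [set: R * R] (snd : R * R -> R) by exact: measurable_snd.
rewrite /slice_factor; case: (fintype.split j) => i; (apply: cmeasurableM;
  [by apply: cmeasurableX; exact: cmeasurable_real|exact: cmeasurable_twist]).
Qed.

Lemma slice_factor_bound l k k' : 0 < l -> exists c : 'I_(N + N) -> R, forall j lam x,
  l <= lam -> nc (slice_factor k k' j (lam, x)) <= expR (c j * (1 + `|lam|)) * w x.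
Proof.
move=> l0.
have H (j : 'I_(N + N)) : exists c : R, forall lam x, l <= lam ->
    nc (slice_factor k k' j (lam, x)) <= expR (c * (1 + `|lam|)) * w x.
  by rewrite /slice_factor; case: (fintype.split j) => i /=; exact: twist_weight_bound.
by have [c Hc] := choice H; exists c.
Qed.

(** The part of the frequency integrand that does not involve the planar coordinates, up to [c_n]
    and the Gaussian restored in [damped]. *)
Definition amplitude l lam : R[i] :=
  (expR (- (2 * (lam - l))))%:C%C * pole_mass (lam - l) *
  (cexp (- ('i%C * lam%:C%C * zeta)) * ((lam / sinhR (t * lam)) ^+ N)%:C%C).

(** This confines the analysis to frequencies at least l > 0, where [slice_factor_bound] applies. *)
Lemma amplitude0 l lam : lam < l -> amplitude l lam = 0.
Proof. by move=> h; rewrite /amplitude pole_mass_negative ?subr_lt0 // mulr0 mul0r. Qed.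

Lemma exp_type_shifted_pole_mass l :
  exp_type (fun lam => (expR (- (2 * (lam - l))))%:C%C * pole_mass (lam - l)) /\
  cmeasurable (fun lam => (expR (- (2 * (lam - l))))%:C%C * pole_mass (lam - l)).
Proof.
have ms : measurable_fun [set: R] (fun lam : R => lam - l).
  by apply: measurable_funB => //; exact: measurable_cst.
split.
  apply: exp_typeM; last exact: exp_type_pole_mass.
  have E lam : - (2 * (lam - l)) = 2 * l + (- 2) * lam by ring.
  by under eq_fun do rewrite E; exact: exp_type_expR.
apply: cmeasurableM; last exact: (cmeasurable_comp ms cmeasurable_pole_mass).
apply: cmeasurable_real.
have m1 : measurable_fun [set: R] (fun lam : R => - (2 * (lam - l))).
  by apply: measurable_funN; apply: measurable_funM.
exact: (measurableT_comp (@measurable_expR R) m1).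
Qed.

Lemma exp_type_amplitude l : exp_type (amplitude l) /\ cmeasurable (amplitude l).
Proof.
have [e1 m1] := exp_type_shifted_pole_mass l.
have mi : measurable_fun [set: R] (id : R -> R) by exact: measurable_id.
split.
  apply: exp_typeM => //; apply: exp_typeM; last exact: exp_type_div_sinhR.
  have E lam : - ('i%C * lam%:C%C * zeta) = lam%:C%C * (- 'i%C * zeta).
    by move: ('i%C : R[i]) => I; ring.
  by under eq_fun do rewrite E; exact: exp_type_linear_cexp.
apply: cmeasurableM => //; apply: cmeasurableM.
  apply: cmeasurable_cexp; apply: cmeasurableN; apply: cmeasurableM; last exact: cmeasurable_cst.
  by apply: cmeasurableM; [exact: cmeasurable_cst|exact: cmeasurable_real].
by apply: cmeasurable_real; apply: measurable_funX; exact: (measurable_div_sinhR t mi).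
Qed.

Definition damped l lam : R[i] := (expR (- (t * lam ^+ 2)))%:C%C * amplitude l lam.

Definition slice_integral k k' lam : R[i] := \prod_j cint1 (fun x => slice_factor k k' j (lam, x)).

Lemma citer_slice l k k' : 0 < l ->
  citer (fun s => cint1 (fun lam => damped l lam * \prod_j slice_factor k k' j (lam, tnth s j)))
        (cint1 (fun lam => damped l lam * slice_integral k k' lam)) /\
  tame (fun lam => damped l lam * slice_integral k k' lam).
Proof.
move=> l0; have [c Hc] := slice_factor_bound k k' l0.
have [eA mA] := exp_type_amplitude l.
have [mD _] := tame_gauss_exp_type t0 mA eA; rewrite -/(damped l) in mD.
(* The growth constants of all coordinates are collected in [F], so that a single Gaussian in the
   frequency pays for them. *)
pose F lam := amplitude l lam * \prod_j (expR (c j * (1 + `|lam|)))%:C%C.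
have mc j : measurable_fun [set: R] (fun lam : R => expR (c j * (1 + `|lam|))).
  have m1 : measurable_fun [set: R] (fun lam : R => c j * (1 + `|lam|)).
    have mn : measurable_fun [set: R] (fun lam : R => `|lam|).
      exact: (measurableT_comp (@normr_measurable R setT) (@measurable_id _ R setT)).
    by apply: measurable_funM; [|apply: measurable_funD].
  exact: (measurableT_comp (@measurable_expR R) m1).
have eF : exp_type F.
  apply: exp_typeM => //; apply: exp_type_prod => j; apply: exp_type_real.
  by exists (c j) => lam; rewrite ger0_norm ?expR_ge0.
have mF : cmeasurable F.
  by apply: cmeasurableM => //; apply: cmeasurable_prod => j; exact: cmeasurable_real.
have [_ [K HK]] := tame_gauss_exp_type t0 mF eF.
have aK lam : nc (damped l lam) * \prod_j expR (c j * (1 + `|lam|)) <= K * w lam.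
  apply: le_trans (HK lam); rewrite /F /damped mulrA [leRHS]Normc.normcM ler_wpM2l ?normc_ge0 //.
  rewrite normc_prod; apply: ler_prod => j _.
  apply/andP; split; first exact: expR_ge0.
  have e0 := expR_ge0 (c j * (1 + `|lam|)).
  by rewrite normc_real (ger0_norm e0).
have hM lam : damped l lam != 0 -> forall j x,
    nc (slice_factor k k' j (lam, x)) <= expR (c j * (1 + `|lam|)) * w x.
  move=> d0 j x; apply: Hc; rewrite leNgt; apply: contra d0 => h.
  by rewrite /damped amplitude0 // mulr0.
have M0 (j : 'I_(N + N)) (lam : R) : 0 <= expR (c j * (1 + `|lam|)) by exact: expR_ge0.
split.
  exact: (citer_cint1_prod mD (cmeasurable_slice_factor k k') M0 hM aK).
exact: (tame_cint1_prod mD (cmeasurable_slice_factor k k') M0 hM aK).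
Qed.

Lemma toH_cat (s : (N + N).-tuple R) (xi : R) : toH [tuple of s ++ [tuple xi]] =
  ((fun j => tnth s (lshift N j)), (fun j => tnth s (rshift N j)), xi).
Proof.
rewrite /toH; congr (_, _, _); try (apply/funext => j); rewrite ?tnth_lshift //.
by rewrite tnth_rshift.
Qed.

(** The xi-integral is done first, through [citer_last] and [pole_kernel_integral]; the frequency
    integral it leaves is then moved outside the planar ones. *)
Lemma citer_htest m l : 0 < l ->
  citer (fun s => htest m l (toH s) * heat_kernel t (mulHC (embH (invH (toH s))) (z, v, zeta)))
   (\sum_(k < m.+1) (c_n R N)%:C%C * (('C(m, k))%:R * (- 'i%C) ^+ k) *
      cint1 (fun lam => damped l lam * slice_integral (m - k) k lam)).
Proof.
move=> l0; apply: citer_last => [s|].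
  under eq_fun do rewrite toH_cat.
  set x := fun j => tnth s (lshift N j); set u := fun j => tnth s (rshift N j).
  have tQ := tame_gauss_exp_type t0 (cmeasurable_kernel_slice t x u z v zeta)
    (exp_type_kernel_slice t0 x u z v zeta).
  have r0 : 0 <= (\sum_j (x j ^+ 2 + u j ^+ 2)) / 4.
    by rewrite divr_ge0 // sumr_ge0 // => j _; rewrite addr_ge0 ?sqr_ge0.
  have [tb _] := pole_kernel_integral l r0 tQ.
  have := tameZ ((c_n R N)%:C%C * ((x ord0)%:C%C - 'i%C * (u ord0)%:C%C) ^+ m) tb.
  congr tame; apply/funext => xi; rewrite /htest /heat_kernel.
  under [in RHS]eq_cint1 do rewrite heat_integrandE.
  have B (a b c i : R[i]) : c * a * (b * i) = a * b * (c * i) by ring.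
  exact: B.
have H := citer_sum (index_enum 'I_m.+1)
  (fun k : 'I_m.+1 => citerZ ((c_n R N)%:C%C * (('C(m, k))%:R * (- 'i%C) ^+ k)) (citer_slice (m - k) k l0).1).
apply: (eq_citer _ _ H) => // s.
under [RHS]eq_cint1 do rewrite toH_cat.
set x := fun j => tnth s (lshift N j); set u := fun j => tnth s (rshift N j).
have eS := exp_type_kernel_slice t0 x u z v zeta.
have mS := cmeasurable_kernel_slice t x u z v zeta.
have tQ := tame_gauss_exp_type t0 mS eS.
set rho := (\sum_j (x j ^+ 2 + u j ^+ 2)) / 4.
have r0 : 0 <= rho.
  by rewrite divr_ge0 // sumr_ge0 // => j _; rewrite addr_ge0 ?sqr_ge0.
have [tb Eb] := pole_kernel_integral l r0 tQ.
pose T lam := damped l lam * (\prod_j twist t (z j) (v j) lam (x j) * \prod_j twist t (v j) (- z j) lam (u j)).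
have ET lam : (expR (- (2 * (lam - l))))%:C%C * pole_mass (lam - l) *
    ((expR (- (lam * rho)))%:C%C * ((expR (- (t * lam ^+ 2)))%:C%C * kernel_slice t x u z v zeta lam)) = T lam.
  have A (a b c d : R[i]) : a * (b * (c * d)) = a * c * (b * d) by ring.
  have B (a c y p : R[i]) : a * c * (y * p) = c * (a * y) * p by ring.
  by rewrite A (kernel_slice_twist t x u z v zeta lam) B.
have tT : tame T.
  have [e1 m1] := exp_type_shifted_pole_mass l.
  pose F lam := ((expR (- (2 * (lam - l))))%:C%C * pole_mass (lam - l)) *
    ((expR (- (lam * rho)))%:C%C * kernel_slice t x u z v zeta lam).
  have eF : exp_type F.
    apply: exp_typeM => //; apply: exp_typeM => //.
    have E lam : - (lam * rho) = 0 + (- rho) * lam by ring.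
    by under eq_fun do rewrite E; exact: exp_type_expR.
  have mF : cmeasurable F.
    apply: cmeasurableM => //; apply: cmeasurableM => //; apply: cmeasurable_real.
    have mr : measurable_fun [set: R] (fun lam : R => - (lam * rho)).
      by apply: measurable_funN; apply: measurable_funM => //; exact: measurable_cst.
    exact: (measurableT_comp (@measurable_expR R) mr).
  have := tame_gauss_exp_type t0 mF eF; congr tame; apply/funext => lam.
  by rewrite -ET /F mulrCA; congr (_ * _); rewrite mulrCA.
have -> : cint1 (fun xi => htest m l (x, u, xi) * heat_kernel t (mulHC (embH (invH (x, u, xi))) (z, v, zeta))) =
  (c_n R N)%:C%C * ((x ord0)%:C%C - 'i%C * (u ord0)%:C%C) ^+ m * cint1 T.
  have <- : _ = cint1 T := etrans Eb (eq_cint1 ET).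
  rewrite -(cint1Z ((c_n R N)%:C%C * ((x ord0)%:C%C - 'i%C * (u ord0)%:C%C) ^+ m) tb).
  apply: eq_cint1 => xi; rewrite /htest /heat_kernel; under eq_cint1 do rewrite heat_integrandE.
  have B (a b c i : R[i]) : a * b * (c * i) = c * a * (b * i) by ring.
  exact: B.
(* Each monomial of (x - i u)^m times [T] is a product over the coordinates under the frequency
   integral, the form that [citer_slice] handles. *)
rewrite exprDn mulr_sumr mulr_suml; apply: eq_bigr => k _.
have -> : cint1 (fun lam => damped l lam * \prod_j slice_factor (m - k) k j (lam, tnth s j)) =
  (x ord0)%:C%C ^+ (m - k) * (u ord0)%:C%C ^+ k * cint1 T.
  rewrite -(cint1Z ((x ord0)%:C%C ^+ (m - k) * (u ord0)%:C%C ^+ k) tT).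
  by apply: eq_cint1 => lam; rewrite prod_slice_factor mulrCA.
rewrite -(mulNr 'i%C) exprMn -[(_ * (_ * _)) *+ _]mulr_natl.
have B (c C I X U J : R[i]) : c * (C * I) * (X * U * J) = c * (C * (X * (I * U))) * J by ring.
exact: B.
Qed.

End HeatTransformOfTestFunction.

(** * Closed form of the heat transform of a test function *)

Section HeatTransformFormula.
Context {R : realType}.
Variables (n : nat) (t : R).
Hypothesis t0 : 0 < t.
Local Notation N := n.+1.
Implicit Types (z v : 'I_N -> R[i]) (zeta : R[i]) (m k : nat) (l lam : R).

Definition ground_energy z v : R[i] := \sum_j (z j ^+ 2 + v j ^+ 2).

Lemma cint1_twist k p q lam : 0 < lam ->
  cint1 (fun x => x%:C%C ^+ k * twist t p q lam x) =
  gmoment k (twist_rate t lam) (twist_center t lam p q) *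
  cexp ((twist_rate t lam)%:C%C * twist_center t lam p q ^+ 2 - (lam / 4 * cothR (t * lam))%:C%C * p ^+ 2).
Proof.
move=> l0; have A0 := twist_rate_gt0 t0 l0.
rewrite mulrC /gmoment -cint1Z; last exact: tame_gaussian.
by apply: eq_cint1 => x; rewrite twistE // mulrA mulrC.
Qed.

(** Coordinates other than the first contribute only Gaussian masses, and [twist_pair] merges the
    leftover exponents into one ground state. *)
Lemma slice_integralE k k' z v lam : 0 < lam -> slice_integral t z v k k' lam =
  gmoment k (twist_rate t lam) (twist_center t lam (z ord0) (v ord0)) *
  gmoment k' (twist_rate t lam) (twist_center t lam (v ord0) (- z ord0)) *
  (((gauss_mass (twist_rate t lam)) ^+ 2) ^+ n)%:C%C *
  cexp (- (lam / 4)%:C%C * ground_energy z v).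
Proof.
move=> l0; have A0 := twist_rate_gt0 t0 l0.
rewrite /slice_integral big_split_ord /=.
under eq_bigr do under eq_cint1 do rewrite slice_factorl.
under [X in _ * X]eq_bigr do under eq_cint1 do rewrite slice_factorr.
under eq_bigr do rewrite cint1_twist //.
under [X in _ * X]eq_bigr do rewrite cint1_twist //.
rewrite !big_split /= mulrACA -!cexp_sum -cexpD.
rewrite [X in cexp X](_ : _ = - (lam / 4)%:C%C * ground_energy z v); last first.
  by rewrite -big_split /ground_energy mulr_sumr; apply: eq_bigr => i _; exact: twist_pair.
congr (_ * _).
rewrite !big_ord_recl mulrACA; congr (_ * _).
have H (e : nat) p q : \prod_(i < n) gmoment (mono_exp e (lift ord0 i)) (twist_rate t lam)
    (twist_center t lam (p (lift ord0 i)) (q (lift ord0 i))) = (gauss_mass (twist_rate t lam))%:C%C ^+ n.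
  have -> : (gauss_mass (twist_rate t lam))%:C%C ^+ n = \prod_(i < n) (gauss_mass (twist_rate t lam))%:C%C.
    by rewrite prodr_const card_ord.
  by apply: eq_bigr => i _; rewrite /mono_exp /= gmoment0.
rewrite (H _ z v) (H _ v (fun i => - z i)).
by rewrite !real_complexX -exprMn expr2.
Qed.

(** Each coordinate pair contributes 1 / (sinh (t lam) (coth (t lam) + 1)) = exp (- t lam), the
    decay at the bottom of the spectrum of the twisted Laplacian. *)
Lemma heat_constant lam : 0 < lam ->
  c_n R N * (lam / sinhR (t * lam)) ^+ N * (gauss_mass (twist_rate t lam) ^+ 2) ^+ N = expR (- (N%:R * t * lam)).
Proof.
move=> l0; have tl : 0 < t * lam by rewrite mulr_gt0.
rewrite gauss_mass_sq ?twist_rate_gt0 // /c_n -exprVn -!exprMn.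
have s0 : sinhR (t * lam) != 0 by rewrite gt_eqF ?sinhR_gt0.
have c0 : cothR (t * lam) + 1 != 0.
  by rewrite gt_eqF // addr_gt0 // (lt_trans _ (cothR_gt1 tl)).
have p0 : (pi : R) != 0 by rewrite gt_eqF ?pi_gt0.
have l1 : lam != 0 by rewrite gt_eqF.
have -> : (4 * pi)^-1 * (lam / sinhR (t * lam)) * (pi / twist_rate t lam) = (sinhR (t * lam) * (cothR (t * lam) + 1))^-1.
  rewrite /twist_rate [1 + cothR _]addrC; move: (cothR _ + 1) (sinhR _) (pi : R) c0 s0 p0 => c s P c0 s0 p0.
  by field; rewrite c0 s0 l1 p0.
rewrite cothR_add1 // mulrCA mulfV // mulr1 -expRN -expRM_natl; congr expR; ring.
Qed.

Lemma sum_slice_integral m z v lam : 0 < lam ->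
  \sum_(k < m.+1) ('C(m, k))%:R * (- 'i%C) ^+ k * slice_integral t z v (m - k) k lam =
  ((gauss_mass (twist_rate t lam) ^+ 2) ^+ N * expR (- (2 * t * m%:R * lam)))%:C%C *
  (z ord0 - 'i%C * v ord0) ^+ m * cexp (- (lam / 4)%:C%C * ground_energy z v).
Proof.
move=> l0; have A0 := twist_rate_gt0 t0 l0.
under eq_bigr do rewrite slice_integralE // !mulrA.
rewrite -!mulr_suml; under eq_bigr do rewrite -[_ * gmoment _ _ _ * gmoment _ _ _]mulrA.
rewrite gmoment_antiholomorphic // twist_center_antiholomorphic // exprMn -real_complexX -expRM_natl.
have -> : m%:R * - (2 * (t * lam)) = - (2 * t * m%:R * lam) by ring.
rewrite (exprS (gauss_mass _ ^+ 2)) (real_complexM _ (expR _)) (real_complexM (gauss_mass _ ^+ 2)).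
have B (e Z g G X : R[i]) : e * Z * g * G * X = g * G * e * Z * X by ring.
exact: B.
Qed.

(* Depends on the test function only through [l + m], the quantity kept fixed by the three test functions of the proof. *)
Definition theta (q : R) (s : R[i]) : R[i] := cint1 (fun mu =>
  (expR (- (2 * mu)))%:C%C * pole_mass mu *
  ((expR (- (t * mu ^+ 2 + (N%:R * t + 2 * t * q) * mu)))%:C%C * cexp (- (mu%:C%C * s)))).

(** The holomorphic extension of S to the complexified group. *)
Definition heat_phase z v zeta : R[i] := ground_energy z v / 4 + 'i%C * zeta.

(** The substitution lambda = mu + l turns t lambda^2 + 2 t m lambda into t l^2 + 2 t m l plus t
    mu^2 + 2 t (l + m) mu; only the second part stays under the integral. *)
Lemma heat_transform_htest m l z v zeta : 0 < l ->
  heat_transform t (htest m l) (z, v, zeta) =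
  (z ord0 - 'i%C * v ord0) ^+ m *
  (expR (- (t * l ^+ 2 + N%:R * t * l + 2 * t * m%:R * l)))%:C%C *
  cexp (- (l%:C%C * heat_phase z v zeta)) * theta (l + m%:R) (heat_phase z v zeta).
Proof.
move=> l0; rewrite /heat_transform (citer_cint (citer_htest t0 z v zeta m l0)).
have tS k := (citer_slice t0 z v zeta (m - k) k l0).2.
under eq_bigr => k _ do rewrite -(cint1Z _ (tS k)).
rewrite -cint1_sum; last by move=> k; apply: tameZ; exact: tS.
set s := heat_phase z v zeta.
pose P := (z ord0 - 'i%C * v ord0) ^+ m.
pose H lam : R[i] := P * ((expR (- (2 * (lam - l))))%:C%C * pole_mass (lam - l) *
  ((expR (- (t * lam ^+ 2 + (N%:R * t + 2 * t * m%:R) * lam)))%:C%C * cexp (- (lam%:C%C * s)))).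
have EH lam : \sum_(k < m.+1) (c_n R N)%:C%C * (('C(m, k))%:R * (- 'i%C) ^+ k) *
    (damped n t zeta l lam * slice_integral t z v (m - k) k lam) = H lam.
  (* Below [l] both sides vanish, so closed forms valid for positive frequencies are enough. *)
  have [ll|ll] := ltP lam l.
    rewrite /H pole_mass_negative ?subr_lt0 // mulr0 mul0r mulr0 big1 // => k _.
    by rewrite /damped amplitude0 // mulr0 mul0r mulr0.
  have lam0 : 0 < lam by exact: lt_le_trans ll.
  transitivity ((c_n R N)%:C%C * damped n t zeta l lam *
     \sum_(k < m.+1) ('C(m, k))%:R * (- 'i%C) ^+ k * slice_integral t z v (m - k) k lam).
    rewrite mulr_sumr; apply: eq_bigr => k _.
    by rewrite [LHS]mulrACA; congr (_ * _); rewrite mulrC.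
  rewrite sum_slice_integral // /damped /amplitude /H -/P.
  set X := (expR (- (2 * (lam - l))))%:C%C * pole_mass (lam - l).
  set E1 := cexp (- ('i%C * lam%:C%C * zeta)); set E2 := cexp (- (lam / 4)%:C%C * _).
  have EE : cexp (- (lam%:C%C * s)) = E1 * E2.
    rewrite /E1 /E2 -cexpD; congr cexp; rewrite /s /heat_phase !(real_complexM, real_complexV, real_complex_nat).
    by move: ('i%C : R[i]) (lam%:C%C) (ground_energy z v) => I L G; field.
  rewrite EE.
  have ER : expR (- (t * lam ^+ 2 + (N%:R * t + 2 * t * m%:R) * lam)) =
      expR (- (t * lam ^+ 2)) * (c_n R N * (lam / sinhR (t * lam)) ^+ N * (gauss_mass (twist_rate t lam) ^+ 2) ^+ N)
      * expR (- (2 * t * m%:R * lam)).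
    by rewrite heat_constant // -!expRD; congr expR; ring.
  rewrite ER !real_complexM.
  have B (a b c d e Y F1 F2 Q : R[i]) : c * (a * (Y * (F1 * b))) * (d * e * Q * F2) =
    Q * (Y * (a * (c * b * d) * e * (F1 * F2))) by ring.
  exact: B.
rewrite (eq_cint1 EH).
have [e1 m1] := exp_type_shifted_pole_mass l.
have mi : measurable_fun [set: R] (id : R -> R) by exact: measurable_id.
have mexp (c d : R) : cmeasurable (fun mu : R => (expR (- (t * mu ^+ 2 + (c + d) * mu)))%:C%C).
  apply: cmeasurable_real.
  have mm : measurable_fun [set: R] (fun mu : R => - (t * mu ^+ 2 + (c + d) * mu)).
    have m2 : measurable_fun [set: R] (fun mu : R => t * mu ^+ 2).
      by apply: measurable_funM => //; exact: exprn_measurable.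
    have m3 : measurable_fun [set: R] (fun mu : R => (c + d) * mu) by apply: measurable_funM.
    exact: (measurable_funN (measurable_funD m2 m3)).
  exact: (measurableT_comp (@measurable_expR R) mm).
have mcexp : cmeasurable (fun mu : R => cexp (- (mu%:C%C * s))).
  apply: cmeasurable_cexp; apply: cmeasurableN; apply: cmeasurableM; last exact: cmeasurable_cst.
  exact: cmeasurable_real.
have mH : cmeasurable H.
  apply: cmeasurableM; first exact: cmeasurable_cst.
  by apply: cmeasurableM => //; apply: cmeasurableM.
have [e2 m2] := exp_type_shifted_pole_mass (0 : R).
pose Th mu : R[i] := (expR (- (2 * mu)))%:C%C * pole_mass mu *
  ((expR (- (t * mu ^+ 2 + (N%:R * t + 2 * t * (l + m%:R)) * mu)))%:C%C * cexp (- (mu%:C%C * s))).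
have tTh : tame Th.
  pose F mu : R[i] := (expR (- (2 * (mu - 0))))%:C%C * pole_mass (mu - 0) *
    ((expR (0 + (- (N%:R * t + 2 * t * (l + m%:R))) * mu))%:C%C * cexp (mu%:C%C * - s)).
  have eF : exp_type F.
    apply: exp_typeM => //; apply: exp_typeM; first exact: exp_type_expR.
    exact: exp_type_linear_cexp.
  have mF : cmeasurable F.
    apply: cmeasurableM => //; apply: cmeasurableM.
      apply: cmeasurable_real.
      have mm : measurable_fun [set: R] (fun mu : R => 0 + (- (N%:R * t + 2 * t * (l + m%:R))) * mu).
        by apply: measurable_funD => //; apply: measurable_funM.
      exact: (measurableT_comp (@measurable_expR R) mm).
    apply: cmeasurable_cexp; apply: cmeasurableM; last exact: cmeasurable_cst.
    exact: cmeasurable_real.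
  have := tame_gauss_exp_type t0 mF eF; congr tame; apply/funext => mu.
  rewrite /F /Th subr0 mulrCA; congr (_ * _); rewrite mulrA -real_complexM -expRD mulrN.
  by congr ((expR _)%:C%C * _); ring.
rewrite -(cint1_translate l mH) -[theta _ _]/(cint1 Th) -(cint1Z _ tTh); apply: eq_cint1 => mu.
rewrite /H /Th addrK -/P.
have -> : cexp (- ((mu + l)%:C%C * s)) = cexp (- (l%:C%C * s)) * cexp (- (mu%:C%C * s)).
  by rewrite -cexpD real_complexD; congr cexp; ring.
have -> : expR (- (t * (mu + l) ^+ 2 + (N%:R * t + 2 * t * m%:R) * (mu + l))) =
  expR (- (t * l ^+ 2 + N%:R * t * l + 2 * t * m%:R * l)) *
  expR (- (t * mu ^+ 2 + (N%:R * t + 2 * t * (l + m%:R)) * mu)).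
  by rewrite -expRD; congr expR; ring.
rewrite real_complexM.
have B (Q E p F1 F2 C1 C2 : R[i]) : Q * (E * p * (F1 * F2 * (C1 * C2))) = Q * F1 * C1 * (E * p * (F2 * C2)).
  by ring.
exact: B.
Qed.

End HeatTransformFormula.

(** * Algebra of the squared modulus *)

Section SquaredModulus.
Context {R : realType}.
Implicit Types (z : R[i]) (k : nat).

Lemma cabs2X z k : cabs2 (z ^+ k) = cabs2 z ^+ k.
Proof. by rewrite -!normcE2 normcX -!exprM mulnC. Qed.

Lemma cabs2V z : cabs2 z^-1 = (cabs2 z)^-1.
Proof. by rewrite -!normcE2 Normc.normcV exprVn. Qed.

Lemma cabs2_cexp z : cabs2 (cexp z) = expR (2 * complex.Re z).
Proof. by rewrite -normcE2 normc_cexp -expRM_natl. Qed.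

Lemma cabs2_real (x : R) : cabs2 (x%:C)%C = x ^+ 2.
Proof. by rewrite /cabs2 /= expr0n addr0. Qed.

End SquaredModulus.

(** * Two-sided bounds on the norms of the test functions *)

Section TestFunctionNorm.
Context {R : realType}.
Variable n : nat.
Local Notation N := n.+1.
Local Notation mu := (@lebesgue_measure R).
Local Notation tupleH := ((N + N + 1).-tuple R).
Implicit Types (s : tupleH) (m k : nat) (l a : R).

Definition radius2 s : R :=
  \sum_(j < N) (tnth s (lshift 1 (lshift N j)) ^+ 2 + tnth s (lshift 1 (rshift N j)) ^+ 2).
Definition plane2 s : R :=
  tnth s (lshift 1 (lshift N ord0)) ^+ 2 + tnth s (lshift 1 (rshift N ord0)) ^+ 2.
Definition height s : R := tnth s (rshift (N + N) ord0).

(** Comparison function in which height and radius are decoupled, so that its integral is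
    explicit. *)
Definition envelope m a s : R := plane2 s ^+ m * expR (- (a * radius2 s)) * ((4 + height s ^+ 2)^-1) ^+ 2.

Lemma radius2_ge0 s : 0 <= radius2 s.
Proof. by apply: sumr_ge0 => j _; rewrite addr_ge0 ?sqr_ge0. Qed.

Lemma cabs2_htest m l s : cabs2 (htest m l (toH s)) =
  plane2 s ^+ m * expR (- (l / 2 * radius2 s)) *
  (((2 + radius2 s / 4) ^+ 2 + height s ^+ 2)^-1) ^+ 2.
Proof.
rewrite /htest /toH /bergman_factor !cabs2M !cabs2X cabs2V cabs2_cexp mulrA; congr (_ * _ * _).
- by congr (_ ^+ m); rewrite /cabs2 !ReImE /= /plane2; ring.
- by congr expR; rewrite !ReImE /= -/(radius2 s); field.
Qed.

Lemma htest_upper m l s : cabs2 (htest m l (toH s)) <= envelope m (l / 2) s.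
Proof.
rewrite cabs2_htest /envelope; have r0 := radius2_ge0 s; have h0 := sqr_ge0 (height s).
have p0 : 0 <= plane2 s by rewrite addr_ge0 ?sqr_ge0.
rewrite ler_wpM2l ?mulr_ge0 ?exprn_ge0 ?expR_ge0 //.
have A : 0 < 4 + height s ^+ 2 by lra.
have B : 4 + height s ^+ 2 <= (2 + radius2 s / 4) ^+ 2 + height s ^+ 2 by nra.
have C := lt_le_trans A B.
have D : ((2 + radius2 s / 4) ^+ 2 + height s ^+ 2)^-1 <= (4 + height s ^+ 2)^-1 by rewrite lef_pV2 ?posrE.
by rewrite lerXn2r // nnegrE invr_ge0 ltW.
Qed.

(** With q a quarter of [radius2], (2 + q)^2 = 4 (1 + q / 2)^2 <= 4 exp q, so the denominator is at
    most exp q (4 + height^2). Squaring costs exp (- 2 q), which raises the rate from l / 2 to (l +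
    1) / 2. *)
Lemma htest_lower m l s : envelope m ((l + 1) / 2) s <= cabs2 (htest m l (toH s)).
Proof.
rewrite cabs2_htest /envelope; have r0 := radius2_ge0 s; have h0 := sqr_ge0 (height s).
have p0 : 0 <= plane2 s by rewrite addr_ge0 ?sqr_ge0.
have -> : expR (- ((l + 1) / 2 * radius2 s)) = expR (- (l / 2 * radius2 s)) * expR (- (radius2 s / 4)) ^+ 2.
  by rewrite -expRM_natl -expRD; congr expR; field.
rewrite mulrA -[leLHS]mulrA -exprMn ler_wpM2l ?mulr_ge0 ?exprn_ge0 ?expR_ge0 //.
have A : 0 < 4 + height s ^+ 2 by lra.
set q := radius2 s / 4; have q0 : 0 <= q by rewrite divr_ge0.
have B : (2 + q) ^+ 2 + height s ^+ 2 <= expR q * (4 + height s ^+ 2).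
  have e1 : 1 + q / 2 <= expR (q / 2) by exact: expR_ge1Dx.
  have e2 : (1 + q / 2) ^+ 2 <= expR q.
    have -> : expR q = expR (q / 2) ^+ 2 by rewrite -expRM_natl; congr expR; field.
    by rewrite lerXn2r // nnegrE ?expR_ge0 //; lra.
  have := ler_wpM2r (ltW A) e2; apply: le_trans; nra.
have C : 0 < (2 + q) ^+ 2 + height s ^+ 2 by nra.
rewrite lerXn2r ?nnegrE ?mulr_ge0 ?expR_ge0 ?invr_ge0 ?(ltW A) ?(ltW C) //.
by rewrite expRN -invfM lef_pV2 ?posrE // mulr_gt0 ?expR_gt0.
Qed.

(** One term of the binomial expansion of (x_1^2 + u_1^2)^m, split over the coordinates; hence the
    doubled exponents. *)
Definition envelope_factor m k a (j : 'I_(N + N + 1)) (x : R) : R[i] :=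
  match fintype.split j with
  | inl j' => match fintype.split j' with
    | inl i => x%:C%C ^+ mono_exp (m - k).*2 i * gaussian a 0 x
    | inr i => x%:C%C ^+ mono_exp k.*2 i * gaussian a 0 x
    end
  | inr _ => (((4 + x ^+ 2)^-1) ^+ 2)%:C%C
  end.

Lemma envelope_factorE m k a : [/\
  forall i, envelope_factor m k a (lshift 1 (lshift N i)) =1 (fun x => x%:C%C ^+ mono_exp (m - k).*2 i * gaussian a 0 x),
  forall i, envelope_factor m k a (lshift 1 (rshift N i)) =1 (fun x => x%:C%C ^+ mono_exp k.*2 i * gaussian a 0 x)
  & forall i, envelope_factor m k a (rshift (N + N) i) =1 (fun x => (((4 + x ^+ 2)^-1) ^+ 2)%:C%C)].
Proof.
split => i x; rewrite /envelope_factor.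
- by rewrite (unsplitK (inl (lshift N i))) (unsplitK (inl i)).
- by rewrite (unsplitK (inl (rshift N i))) (unsplitK (inr i)).
- by rewrite (unsplitK (inr i)).
Qed.

Lemma gaussian0E a (x : R) : gaussian a 0 x = (expR (- (a * x ^+ 2)))%:C%C.
Proof. by rewrite /gaussian subr0 -cexp_real -mulNr real_complexM real_complexX real_complexN. Qed.

Lemma envelope_sum m a s : (envelope m a s)%:C%C =
  \sum_(k < m.+1) ('C(m, k))%:R * \prod_j envelope_factor m k a j (tnth s j).
Proof.
have E (k : 'I_m.+1) : \prod_j envelope_factor m k a j (tnth s j) =
    (tnth s (lshift 1 (lshift N ord0)))%:C%C ^+ (m - k).*2 * (tnth s (lshift 1 (rshift N ord0)))%:C%C ^+ k.*2 *
    ((expR (- (a * radius2 s)))%:C%C * (((4 + height s ^+ 2)^-1) ^+ 2)%:C%C).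
  have [E1 E2 E3] := envelope_factorE m k a.
  rewrite big_split_ord big_ord1 big_split_ord /= E3.
  under eq_bigr do rewrite E1 gaussian0E.
  under [X in _ * X * _]eq_bigr do rewrite E2 gaussian0E.
  rewrite !big_split /= (prod_mono_exp (fun j => (tnth s (lshift 1 (lshift N j)))%:C%C)).
  rewrite (prod_mono_exp (fun j => (tnth s (lshift 1 (rshift N j)))%:C%C)).
  have B (A g b g' h e : R[i]) : g * g' = e -> (A * g) * (b * g') * h = A * b * (e * h) by move=> <-; ring.
  apply: B; rewrite -big_split /radius2 mulr_sumr -sumrN -cexp_real rmorph_sum cexp_sum.
  have D (x u : R) : (expR (- (a * x ^+ 2)))%:C%C * (expR (- (a * u ^+ 2)))%:C%C =
      (expR (- (a * (x ^+ 2 + u ^+ 2))))%:C%C :> R[i].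
    by rewrite -real_complexM -expRD; congr ((expR _)%:C%C); ring.
  by apply: eq_bigr => j _; exact: (etrans (D _ _) (esym (cexp_real _))).
under eq_bigr do rewrite E mulrA.
rewrite -mulr_suml /envelope -mulrA !real_complexM; congr (_ * _).
rewrite real_complexX /plane2 real_complexD !real_complexX exprDn; apply: eq_bigr => k _.
by rewrite -!exprM !mul2n mulr_natl.
Qed.

(** A common factor of all the norm bounds: only its positivity enters the final comparison. *)
Definition vertical_mass : R := Rintegral mu setT (fun x => ((4 + x ^+ 2)^-1) ^+ 2).

Lemma tame_vertical : tame (fun x : R => (((4 + x ^+ 2)^-1) ^+ 2)%:C%C).
Proof.
split.
  apply: cmeasurable_real; apply: measurable_funX; apply: measurable_invr.
  by apply: measurable_funD => //; exact: exprn_measurable.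
exists 1 => x; rewrite mul1r normc_real ger0_norm ?sqr_ge0 // /cauchy_weight.
have x0 := sqr_ge0 x.
have p4 : 0 < 4 + x ^+ 2 by lra.
have p1 : 0 < 1 + x ^+ 2 by lra.
rewrite exprVn lef_pV2 ?posrE ?exprn_gt0 //; nra.
Qed.

Lemma cint1_vertical : cint1 (fun x : R => (((4 + x ^+ 2)^-1) ^+ 2)%:C%C) = vertical_mass%:C%C.
Proof. by apply: eq_ReIm => //=; rewrite Rintegral_cst // mul0r. Qed.

(** The inequality 4 + x^2 <= 4 exp (x^2 / 4) bounds the integrand below by exp (- x^2 / 2) / 16,
    whose integral is known and positive. *)
Lemma vertical_mass_gt0 : 0 < vertical_mass.
Proof.
have h2 : 0 < (1 / 2 : R) by rewrite divr_gt0.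
have tg := tame_gaussian 0 0 h2.
have E (x : R) : x%:C%C ^+ 0 * gaussian (1 / 2) 0 x = (expR (- (1 / 2 * x ^+ 2)))%:C%C.
  by rewrite expr0 mul1r gaussian0E.
have ig : mu.-integrable [set: R] (EFin \o (fun x : R => expR (- (1 / 2 * x ^+ 2)))).
  by have := tame_Re tg; under eq_fun do rewrite E.
have Ig : Rintegral mu setT (fun x : R => expR (- (1 / 2 * x ^+ 2))) = gauss_mass (1 / 2 : R).
  by have := gmoment0 0 h2; rewrite /gmoment (eq_cint1 E) => /(congr1 (@complex.Re R)).
apply: (@lt_le_trans _ _ (1 / 16 * gauss_mass (1 / 2 : R))).
  by rewrite mulr_gt0 // ?divr_gt0 // sqrtr_gt0 divr_gt0 // pi_gt0.
rewrite -Ig -RintegralZl //; apply: le_Rintegral => //.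
- exact: integrableZ_EFin.
- exact: (tame_Re tame_vertical).
move=> x _ /=; have x0 := sqr_ge0 x.
have e1 : 1 + x ^+ 2 / 4 <= expR (x ^+ 2 / 4) by exact: expR_ge1Dx.
have p4 : 0 < 4 + x ^+ 2 by lra.
have c1 : 1 / 16 = (4^-1) ^+ 2 :> R by field.
have c2 : - (1 / 2 * x ^+ 2) = 2%:R * (- (x ^+ 2 / 4)) :> R by field.
have E2 : 1 / 16 * expR (- (1 / 2 * x ^+ 2)) = ((4 * expR (x ^+ 2 / 4))^-1) ^+ 2.
  by rewrite c2 expRM_natl c1 -exprMn invfM -expRN.
have D : (4 * expR (x ^+ 2 / 4))^-1 <= (4 + x ^+ 2)^-1.
  by rewrite lef_pV2 ?posrE ?mulr_gt0 ?expR_gt0 //; lra.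
suff : 1 / 16 * expR (- (1 / 2 * x ^+ 2)) <= ((4 + x ^+ 2)^-1) ^+ 2 by [].
rewrite E2; apply: lerXn2r => //; rewrite nnegrE invr_ge0; last exact: ltW.
by rewrite mulr_ge0 ?expR_ge0.
Qed.

Definition envelope_mass m a : R := m`!%:R / a ^+ m * (pi / a) ^+ N * vertical_mass.

Lemma iint_envelope m a : 0 < a ->
  iint (fun s => (envelope m a s)%:E) = (envelope_mass m a)%:E.
Proof.
move=> a0.
have tf k j : tame (envelope_factor m k a j).
  rewrite /envelope_factor; case: (fintype.split j) => [j'|_]; last exact: tame_vertical.
  by case: (fintype.split j') => i; exact: tame_gaussian.
have H := citer_sum (index_enum 'I_m.+1)
  (fun k : 'I_m.+1 => citerZ (('C(m, k))%:R : R[i]) (citer_prod (tf k))).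
have [+ _] := citer_iint (eq_citer (fun s => esym (envelope_sum m a s)) erefl H).
move=> /= ->; congr EFin.
have V (k : 'I_m.+1) : \prod_j cint1 (envelope_factor m k a j) =
    gmoment (m - k).*2 a 0 * gmoment k.*2 a 0 * (((gauss_mass a ^+ 2) ^+ n) * vertical_mass)%:C%C.
  have [E1 E2 E3] := envelope_factorE m k a.
  rewrite big_split_ord big_ord1 big_split_ord /= (eq_cint1 (E3 _)) cint1_vertical.
  under eq_bigr do rewrite (eq_cint1 (E1 _)).
  under [X in _ * X * _]eq_bigr do rewrite (eq_cint1 (E2 _)).
  have G (e : nat) : \prod_(i < n) cint1 (fun x : R => x%:C%C ^+ mono_exp e (lift ord0 i) * gaussian a 0 x) = (gauss_mass a)%:C%C ^+ n.
    have -> : (gauss_mass a)%:C%C ^+ n = \prod_(i < n) (gauss_mass a)%:C%C.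
      by rewrite prodr_const card_ord.
    by apply: eq_bigr => i _; exact: (gmoment0 0 a0).
  have -> : (((gauss_mass a ^+ 2) ^+ n) * vertical_mass)%:C%C =
      (gauss_mass a)%:C%C ^+ n * (gauss_mass a)%:C%C ^+ n * vertical_mass%:C%C :> R[i].
    by rewrite real_complexM !real_complexX -exprMn -expr2.
  rewrite !big_ord_recl !G.
  have B (A b c u : R[i]) : A * c * (b * c) * u = A * b * (c * c * u) by ring.
  exact: B.
under eq_bigr do rewrite V mulrA.
rewrite -mulr_suml gmoment_radial // -real_complexM /=.
by rewrite /envelope_mass -gauss_mass_sq // (exprS (gauss_mass a ^+ 2)); ring.
Qed.

Lemma measurable_coord (i : 'I_(N + N + 1)) : measurable_fun [set: tupleH] (fun s => tnth s i).
Proof. exact: measurable_tnth. Qed.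

Lemma measurable_radius2 : measurable_fun [set: tupleH] radius2.
Proof.
have [+ _] : cmeasurable (fun s => \sum_(j < N) ((tnth s (lshift 1 (lshift N j)) ^+ 2 +
    tnth s (lshift 1 (rshift N j)) ^+ 2)%:C%C : R[i])).
  apply: cmeasurable_sum => j; apply: cmeasurable_real.
  by apply: measurable_funD; apply: measurable_funX; exact: measurable_coord.
by under eq_fun do rewrite -rmorph_sum.
Qed.

Lemma measurable_envelope m a : measurable_fun [set: tupleH] (envelope m a).
Proof.
apply: measurable_funM; first apply: measurable_funM.
- by apply: measurable_funX; apply: measurable_funD; apply: measurable_funX; exact: measurable_coord.
- have m1 : measurable_fun [set: tupleH] (fun s => - (a * radius2 s)).
    apply: measurable_funN; apply: measurable_funM; first exact: measurable_cst.
    exact: measurable_radius2.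
  exact: (measurableT_comp (@measurable_expR R) m1).
- apply: measurable_funX; apply: measurable_invr; apply: measurable_funD; first exact: measurable_cst.
  by apply: measurable_funX; exact: measurable_coord.
Qed.

Lemma cmeasurable_htest m l : cmeasurable (fun s => htest m l (toH s)).
Proof.
have mc i := cmeasurable_real (measurable_coord i).
have mrho : measurable_fun [set: tupleH] (fun s => radius2 s / 4).
  by apply: measurable_funM; [exact: measurable_radius2|exact: measurable_cst].
have mh : measurable_fun [set: tupleH] height by exact: measurable_coord.
rewrite /htest /toH; apply: cmeasurableM.
  apply: cmeasurableX; apply: cmeasurableD => //; apply: cmeasurableN.
  by apply: cmeasurableM => //; exact: cmeasurable_cst.
apply: cmeasurableM.
  apply: cmeasurable_cexp; apply: cmeasurableM; first exact: cmeasurable_cst.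
  by split.
apply: cmeasurableX; apply: cmeasurable_inv; split => //=.
by apply: measurable_funD => //; exact: measurable_cst.
Qed.

Lemma htest_norm_le m l : 0 < l ->
  (iint (fun s => (cabs2 (htest m l (toH s)))%:E) <= (envelope_mass m (l / 2))%:E)%E.
Proof.
move=> l0; rewrite -iint_envelope ?divr_gt0 //; apply: le_iint.
- by apply/measurable_EFinP; apply: cmeasurable_cabs2; exact: cmeasurable_htest.
- by apply/measurable_EFinP; exact: measurable_envelope.
- by move=> s; rewrite lee_fin cabs2_ge0.
- by move=> s; rewrite lee_fin htest_upper.
Qed.

Lemma htest_norm_ge m l : 0 < l ->
  ((envelope_mass m ((l + 1) / 2))%:E <= iint (fun s => (cabs2 (htest m l (toH s)))%:E))%E.
Proof.
move=> l0; have l1 : 0 < l + 1 by lra.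
rewrite -iint_envelope ?divr_gt0 //; apply: le_iint.
- by apply/measurable_EFinP; exact: measurable_envelope.
- by apply/measurable_EFinP; apply: cmeasurable_cabs2; exact: cmeasurable_htest.
- move=> s; rewrite lee_fin /envelope; apply: mulr_ge0; last exact: sqr_ge0.
  by apply: mulr_ge0; [rewrite exprn_ge0 // addr_ge0 ?sqr_ge0|exact: expR_ge0].
- by move=> s; rewrite lee_fin htest_lower.
Qed.

Lemma L2H_htest m l : 0 < l -> L2H (htest m l : Hpt R N -> R[i]).
Proof.
move=> l0; have [a b] := cmeasurable_htest m l; split => //; split => //.
exact: le_lt_trans (htest_norm_le m l0) (ltry _).
Qed.

Lemma envelope_mass_gt0 m a : 0 < a -> 0 < envelope_mass m a.
Proof.
move=> a0; rewrite /envelope_mass; apply: mulr_gt0; last exact: vertical_mass_gt0.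
by rewrite mulr_gt0 ?exprn_gt0 ?divr_gt0 ?pi_gt0 ?exprn_gt0 // ltr0n fact_gt0.
Qed.

Lemma envelope_mass_pred p a : 0 < a ->
  envelope_mass p a = envelope_mass p.+1 a * (a / p.+1%:R).
Proof.
move=> a0; rewrite /envelope_mass factS natrM (exprS a).
have h1 : a != 0 by rewrite gt_eqF.
have h2 : a ^+ p != 0 by rewrite expf_neq0.
have h3 : p.+1%:R != 0 :> R by rewrite pnatr_eq0.
move: (a ^+ p) (p.+1%:R) (p`!%:R) (_ ^+ N) vertical_mass h2 h3 => A q f P V h2 h3.
by field; rewrite ?h1 ?h2 ?h3.
Qed.

Lemma envelope_mass_succ p a b : 0 < a -> 0 < b ->
  envelope_mass p.+2 b = envelope_mass p.+1 a * (p.+2%:R / a * (a / b) ^+ (p.+2 + N)).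
Proof.
move=> a0 b0; rewrite /envelope_mass (factS p.+1) natrM (exprD (a / b)) !expr_div_n (exprS a p.+1).
have h1 : a != 0 by rewrite gt_eqF.
have h2 : a ^+ p.+1 != 0 by rewrite expf_neq0.
have h3 : b ^+ p.+2 != 0 by rewrite expf_neq0 // gt_eqF.
have h4 : a ^+ N != 0 by rewrite expf_neq0.
have h5 : b ^+ N != 0 by rewrite expf_neq0 // gt_eqF.
move: (a ^+ p.+1) (b ^+ p.+2) (a ^+ N) (b ^+ N) (pi ^+ N) (p.+2%:R) (p.+1`!%:R) vertical_mass h2 h3 h4 h5.
move=> A B AN BN P q f V h2 h3 h4 h5.
by field; rewrite ?h1 ?h2 ?h3 ?h4 ?h5.
Qed.

End TestFunctionNorm.

(** * Measurability and comparison of the three transforms *)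

Section HeatTransformMeasurability.
Context {R : realType}.
Variables (n : nat) (t : R).
Hypothesis t0 : 0 < t.
Local Notation N := n.+1.
Local Notation tupleHC := ((N + N + N + N + 1 + 1).-tuple R).

Lemma cmeasurable_theta d (T : measurableType d) (q : R) (f : T -> R[i]) :
  cmeasurable f -> cmeasurable (fun s => theta n t q (f s)).
Proof.
move=> mf.
have m2 : measurable_fun [set: T * R] (snd : T * R -> R) by exact: measurable_snd.
have mexp (c d' : R) : cmeasurable (fun y : R => (expR (- (c * y ^+ 2 + d' * y)))%:C%C).
  apply: cmeasurable_real.
  have h2 : measurable_fun [set: R] (fun y : R => c * y ^+ 2).
    by apply: measurable_funM => //; exact: exprn_measurable.
  have h3 : measurable_fun [set: R] (fun y : R => d' * y) by apply: measurable_funM.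
  exact: (measurableT_comp (@measurable_expR R) (measurable_funN (measurable_funD h2 h3))).
apply: (@cmeasurable_cint1 R _ T (fun z : T * R => (expR (- (2 * z.2)))%:C%C * pole_mass z.2 *
  ((expR (- (t * z.2 ^+ 2 + (N%:R * t + 2 * t * q) * z.2)))%:C%C * cexp (- (z.2%:C%C * f z.1))))).
apply: cmeasurableM.
  apply: cmeasurableM; last exact: (cmeasurable_comp m2 cmeasurable_pole_mass).
  have E (y : R) : - (2 * y) = - (0 * y ^+ 2 + 2 * y) by rewrite mul0r add0r.
  by under eq_fun do rewrite E; exact: (cmeasurable_comp m2 (mexp 0 2)).
apply: cmeasurableM; first exact: (cmeasurable_comp m2 (mexp _ _)).
apply: cmeasurable_cexp; apply: cmeasurableN; apply: cmeasurableM; first exact: cmeasurable_real.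
exact: (cmeasurable_comp measurable_fst mf).
Qed.

(** Read off the closed form; it gives access to additivity and monotonicity of the iterated
    integral on the complexified group. *)
Lemma cmeasurable_heat_htest m (l : R) : 0 < l ->
  cmeasurable (fun s : tupleHC => heat_transform t (htest m l : Hpt R N -> R[i]) (toHC s)).
Proof.
move=> l0; rewrite /toHC; under eq_fun do rewrite (heat_transform_htest t0 m _ _ _ l0).
have mc i i' : cmeasurable (fun s : tupleHC => (tnth s i +i* tnth s i')%C).
  by split; exact: measurable_tnth.
have mcst (c : R[i]) : cmeasurable (fun s : tupleHC => c) by exact: cmeasurable_cst.
have mph : cmeasurable (fun s : tupleHC => heat_phase (toHC s).1.1 (toHC s).1.2 (toHC s).2).
  apply: cmeasurableD; last by apply: cmeasurableM; [exact: mcst|exact: mc].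
  apply: cmeasurableM; last exact: mcst.
  by apply: cmeasurable_sum => j; apply: cmeasurableD; apply: cmeasurableX; exact: mc.
apply: cmeasurableM; last exact: cmeasurable_theta mph.
apply: cmeasurableM; last first.
  by apply: cmeasurable_cexp; apply: cmeasurableN; apply: cmeasurableM; [exact: mcst|exact: mph].
apply: cmeasurableM; last exact: mcst.
apply: cmeasurableX; apply: cmeasurableD; first exact: mc.
by apply: cmeasurableN; apply: cmeasurableM; [exact: mcst|exact: mc].
Qed.

(* The exponents balance because [l + m] is constant along the triple while [t l^2 + 2 t m l] is not affine along it. *)
Lemma heat_htest_sqr p (l : R) (g : HCpt R N) : 1 < l ->
  heat_transform t (htest p.+1 l) g ^+ 2 = (expR (- (2 * t)))%:C%C *
  (heat_transform t (htest p (l + 1)) g * heat_transform t (htest p.+2 (l - 1)) g).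
Proof.
case: g => [[z v] zeta] l1.
have l0 : 0 < l by lra.
have lp : 0 < l + 1 by lra.
have lm : 0 < l - 1 by lra.
rewrite !heat_transform_htest //.
have -> : l + 1 + p%:R = l + p.+1%:R by rewrite -natr1; ring.
have -> : l - 1 + p.+2%:R = l + p.+1%:R by rewrite -[p.+2%:R]natr1; ring.
set Z := z ord0 - _; set s := heat_phase _ _ _; set T := theta _ _ _ _.
have EC : cexp (- (l%:C%C * s)) ^+ 2 = cexp (- ((l + 1)%:C%C * s)) * cexp (- ((l - 1)%:C%C * s)).
  by rewrite expr2 -!cexpD; congr cexp; rewrite !real_complexD real_complexN; ring.
have EE : expR (- (t * l ^+ 2 + N%:R * t * l + 2 * t * p.+1%:R * l)) ^+ 2 =
  expR (- (2 * t)) * (expR (- (t * (l + 1) ^+ 2 + N%:R * t * (l + 1) + 2 * t * p%:R * (l + 1))) *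
  expR (- (t * (l - 1) ^+ 2 + N%:R * t * (l - 1) + 2 * t * p.+2%:R * (l - 1)))).
  rewrite -expRM_natl -!expRD; congr expR; rewrite -[p.+2%:R]natr1 -[p.+1%:R]natr1; ring.
rewrite !exprMn EC -real_complexX EE !real_complexM -exprM mulnC mul2n -addnn.
have -> : (p.+1 + p.+1 = p + p.+2)%N by rewrite addSn [RHS]addnS.
rewrite exprD.
have B (e a b X Y c d th : R[i]) : X * Y * (e * (a * b)) * (c * d) * th ^+ 2 = e * (X * a * c * th * (Y * b * d * th)) by ring.
exact: B.
Qed.

(** Weighted AM-GM: after squaring, the difference of the two sides is a perfect square. [eps] stays
    free, to be fitted to the norms. *)
Lemma cabs2_heat_htest_le p (l eps : R) (g : HCpt R N) : 1 < l -> 0 < eps ->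
  cabs2 (heat_transform t (htest p.+1 l) g) <=
  expR (- (2 * t)) / 2 * eps * cabs2 (heat_transform t (htest p (l + 1)) g) +
  expR (- (2 * t)) / 2 / eps * cabs2 (heat_transform t (htest p.+2 (l - 1)) g).
Proof.
move=> l1 e0; have := congr1 (@cabs2 R) (heat_htest_sqr p g l1).
rewrite cabs2X !cabs2M cabs2_real.
have := cabs2_ge0 (heat_transform t (htest p.+1 l) g).
have := cabs2_ge0 (heat_transform t (htest p (l + 1)) g).
have := cabs2_ge0 (heat_transform t (htest p.+2 (l - 1)) g).
have := expR_ge0 (- (2 * t)).
move: (expR _) (cabs2 _) (cabs2 _) (cabs2 _) => e X0 X1 X2 e1 h2 h1 h0 E.
have r0 : 0 <= e / 2 * eps * X1 + e / 2 / eps * X2.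
  by rewrite addr_ge0 // mulr_ge0 ?mulr_ge0 ?divr_ge0 ?invr_ge0 // ltW.
rewrite -(ler_pXn2r (n := 2)) ?nnegrE // E -subr_ge0.
have -> : (e / 2 * eps * X1 + e / 2 / eps * X2) ^+ 2 - e ^+ 2 * (X1 * X2) = (e / 2 * eps * X1 - e / 2 / eps * X2) ^+ 2.
  by field; rewrite gt_eqF.
exact: sqr_ge0.
Qed.

End HeatTransformMeasurability.

(** * Choice of parameters, and the contradiction *)

Lemma heat_parameters (R : realType) (t : R) (N : nat) : 0 < t ->
  exists (p : nat) (l : R), 1 < l /\
    1 + p.+2%:R / p.+1%:R * ((l + 1) / (l - 1)) ^+ (p.+2 + N) < 2 * expR (2 * t).
Proof.
(* p + 1 > 2 / t gives (p + 2) / (p + 1) = 1 + 1 / (p + 1) <= exp (t / 2). *)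
move=> t0; pose p := Num.trunc (2 / t); pose M := (p.+2 + N)%N.
(* As 1 + 2 / d <= exp (2 / d), the M-th power is at most exp (2 M / d) = exp (t / 2). M depends on
   p, so p is fixed first. Finally 1 + exp t < 2 exp (2 t). *)
pose d : R := 4 * M%:R / t.
have M0 : 0 < M%:R :> R by rewrite ltr0n.
have d0 : 0 < d by rewrite divr_gt0 // mulr_gt0.
exists p, (1 + d); split; first by rewrite ltrDl.
have hp : 2 / t < p.+1%:R by exact: truncnS_gt.
have p0 : 0 < p.+1%:R :> R by rewrite ltr0n.
have r1 : p.+2%:R / p.+1%:R <= expR (t / 2).
  have -> : p.+2%:R / p.+1%:R = 1 + p.+1%:R^-1 :> R by rewrite -natr1 mulrDl divff ?gt_eqF // mul1r.
  apply: le_trans (expR_ge1Dx _); rewrite lerD2l.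
  rewrite -[t / 2]invrK lef_pV2 ?posrE ?invr_gt0 ?divr_gt0 //.
  by rewrite invf_div ltW.
have r2 : ((1 + d + 1) / (1 + d - 1)) ^+ M <= expR (t / 2).
  have -> : (1 + d + 1) / (1 + d - 1) = 1 + 2 / d by field; rewrite ?gt_eqF //; lra.
  have -> : t / 2 = M%:R * (2 / d) by rewrite /d; field; rewrite !gt_eqF.
  rewrite expRM_natl lerXn2r ?nnegrE ?expR_ge0 ?expR_ge1Dx //.
  by rewrite addr_ge0 // divr_ge0 // ltW.
have r3 : p.+2%:R / p.+1%:R * ((1 + d + 1) / (1 + d - 1)) ^+ M <= expR t.
  have -> : expR t = expR (t / 2) * expR (t / 2) by rewrite -expRD; congr expR; field.
  have q0 : 0 <= (1 + d + 1) / (1 + d - 1) by rewrite divr_ge0 //; lra.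
  apply: (ler_pM _ _ r1 r2); first by apply: divr_ge0; exact: ler0n.
  exact: exprn_ge0.
have e1 : 1 < expR t by rewrite expR_gt1.
have -> : expR (2 * t) = expR t ^+ 2 by rewrite -expRM_natl.
move: r3; rewrite /M; move: (_ * _ ^+ _) (expR t) e1 => A e e1 r3; nra.
Qed.

Unset Implicit Arguments.
Set Strict Implicit.
Set Printing Implicit Defensive.

Theorem theorem6p2 (R : realType) (n : nat) (t : R) :
  (1 <= n)%N -> 0 < t ->
  ~ exists W : HCpt R n -> R,
      measurable_fun [set: (n + n + n + n + 1 + 1).-tuple R]
        (fun s => W (toHC s)) /\
      (forall g, 0 <= W g) /\
      (forall (h : Hpt R n) (g : HCpt R n), W (mulHC (embH h) g) = W g) /\
      (forall f : Hpt R n -> R[i], L2H f ->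
         iint (fun s => (cabs2 (f (toH s)))%:E) =
         iint (fun s => (cabs2 (heat_transform t f (toHC s)) * W (toHC s))%:E)).
Proof.
move=> n1 t0; case: n n1 => [//|n] _ [W [mW [W0 [_ HW]]]].
have [p [l [l1 Hl]]] := heat_parameters n.+1 t0.
have l0 : 0 < l by lra.
have lp : 0 < l + 1 by lra.
have lm : 0 < l - 1 by lra.
(* The lower bound at (p + 1, l) and the upper bound at (p, l + 1) share the rate [a]; only the
   function at (p + 2, l - 1) brings in a second rate [b]. *)
pose a : R := (l + 1) / 2; pose b : R := (l - 1) / 2.
have a0 : 0 < a by rewrite divr_gt0.
have b0 : 0 < b by rewrite divr_gt0.
have p0 : 0 < p.+1%:R :> R by rewrite ltr0n.
(* The ratio of [envelope_mass] at p + 1 and at p for the rate [a]: the first AM-GM term then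
   contributes exactly e / 2 times the mass at p + 1. *)
pose eps : R := p.+1%:R / a; have e0 : 0 < eps by rewrite divr_gt0.
pose e : R := expR (- (2 * t)); have ee : 0 < e by exact: expR_gt0.
pose F m l' (s : (n.+1 + n.+1 + n.+1 + n.+1 + 1 + 1).-tuple R) : R :=
  cabs2 (heat_transform t (htest m l' : Hpt R n.+1 -> R[i]) (toHC s)) * W (toHC s).
have F0 m l' s : 0 <= F m l' s by rewrite mulr_ge0 ?cabs2_ge0.
have mF m l' : 0 < l' -> measurable_fun setT (fun s => (F m l' s)%:E).
  move=> l'0; apply/measurable_EFinP; apply: measurable_funM => //.
  by apply: cmeasurable_cabs2; exact: cmeasurable_heat_htest.
have I m l' : 0 < l' -> iint (fun s => (cabs2 ((htest m l' : Hpt R n.+1 -> R[i]) (toH s)))%:E) = iint (fun s => (F m l' s)%:E).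
  by move=> l'0; apply: HW; exact: L2H_htest.
have eh : 0 < e / 2 by rewrite divr_gt0.
have c1 : 0 <= e / 2 * eps by apply: ltW; exact: mulr_gt0.
have c2 : 0 <= e / 2 / eps by apply: ltW; exact: divr_gt0.
have key : (iint (fun s => (F p.+1 l s)%:E) <= (e / 2 * eps)%:E * iint (fun s => (F p (l + 1) s)%:E) +
    (e / 2 / eps)%:E * iint (fun s => (F p.+2 (l - 1) s)%:E))%E.
  rewrite -(iintZl c1 (mF p _ lp)); last by move=> s; rewrite lee_fin.
  rewrite -(iintZl c2 (mF p.+2 _ lm)); last by move=> s; rewrite lee_fin.
  have m1 : measurable_fun setT (fun s => ((e / 2 * eps)%:E * (F p (l + 1) s)%:E)%E).
    by apply: measurable_funeM; exact: mF.
  have m2 : measurable_fun setT (fun s => ((e / 2 / eps)%:E * (F p.+2 (l - 1) s)%:E)%E).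
    by apply: measurable_funeM; exact: mF.
  have nn1 s : (0 <= (e / 2 * eps)%:E * (F p (l + 1) s)%:E)%E by rewrite -EFinM lee_fin mulr_ge0.
  have nn2 s : (0 <= (e / 2 / eps)%:E * (F p.+2 (l - 1) s)%:E)%E by rewrite -EFinM lee_fin mulr_ge0.
  have nn0 s : (0 <= (F p.+1 l s)%:E)%E by rewrite lee_fin.
  rewrite -(iintD m1 m2 nn1 nn2).
  apply: (le_iint (mF p.+1 l l0) (emeasurable_funD m1 m2) nn0).
  move=> s; rewrite -!EFinM -EFinD lee_fin.
  (* The nonnegativity of the weight turns the pointwise inequality between transforms into one
     between weighted densities. *)
  have h := ler_wpM2r (W0 (toHC s)) (cabs2_heat_htest_le t0 p (toHC s) l1 e0).
  by rewrite /F ![_ * (cabs2 _ * _)]mulrA -mulrDl.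
rewrite -(I _ _ l0) -(I _ _ lp) -(I _ _ lm) in key.
have U0 := htest_norm_ge n p.+1 l0; have U1 := htest_norm_le n p lp; have U2 := htest_norm_le n p.+2 lm.
have U : ((envelope_mass n p.+1 a)%:E <=
    (e / 2 * eps * envelope_mass n p a + e / 2 / eps * envelope_mass n p.+2 b)%:E)%E.
  apply: (le_trans U0); apply: (le_trans key); rewrite EFinD !EFinM.
  apply: leeD; rewrite -EFinM; apply: lee_wpmul2l => //; rewrite lee_fin //.
move: U; rewrite lee_fin (envelope_mass_pred n p a0) (envelope_mass_succ n p a0 b0).
have M0 := envelope_mass_gt0 n p.+1 a0.
set M := envelope_mass n p.+1 a in M0 *; set r := (a / b) ^+ _.
have rE : r = ((l + 1) / (l - 1)) ^+ (p.+2 + n.+1).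
  by rewrite /r /a /b invf_div mulrA mulfVK.
have -> : e / 2 * eps * (M * (a / p.+1%:R)) + e / 2 / eps * (M * (p.+2%:R / a * r)) =
    M * (e / 2 * (1 + p.+2%:R / p.+1%:R * r)).
  have h1 : a != 0 by rewrite gt_eqF.
  have h2 : p.+1%:R != 0 :> R by rewrite gt_eqF.
  rewrite /eps; move: (p.+1%:R) (p.+2%:R) r h2 {rE p0 e0 eps c1 c2 key} => q q' r' h2.
  by field; rewrite ?h1 ?h2.
(* Division by [M] leaves 1 <= e^(-2t) / 2 times the left side of the inequality in
   [heat_parameters], which is below 2 e^(2t). *)
rewrite rE -[leLHS]mulr1 ler_pM2l // leNgt => /negP; apply.
have E2 : e * expR (2 * t) = 1 by rewrite /e -expRD addNr expR0.
have := ltr_pM2l ee; move: Hl; move: (1 + _) (expR (2 * t)) E2 => A B E2 Hl _.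
have : e * A < e * (2 * B) by rewrite ltr_pM2l.
lra.
Qed.
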